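(* Let $u$ be a positive function in $L^2_\psi(\mathbb{B}_n)$. The following statements are equivalent: (a) the Toeplitz operator $T_u$ is bounded on $A^2_\psi(\mathbb{B}_n)$; (b) $\widehat{u}$ is a bounded function on $\mathbb{B}_n$; (c) $u\,dv$ is a $\psi$-Carleson measure, i.e. a Carleson measure for $A^2_\psi(\mathbb{B}_n)$: there is $C>0$ with $\int|f|^2e^{-\psi}u\,dv\le C\int|f|^2e^{-\psi}dv$ for all $f\in A^2_\psi(\mathbb{B}_n)$.
   Context: $\mathbb{B}_n$ is the open unit ball of $\mathbb{C}^n$, $\langle z,w\rangle=\sum_jz_j\overline{w_j}$, $v$ is Lebesgue measure, $\psi(z)=\frac{1}{1-|z|^2}$, $L^2_\psi(\mathbb{B}_n)=L^2(\mathbb{B}_n,e^{-\psi}dv)$, and $A^2_\psi(\mathbb{B}_n)$ is its closed subspace of holomorphic functions, a Hilbert space with $\langle f,g\rangle_\psi=\int f\overline{g}e^{-\psi}dv$ and norm $\|\cdot\|_{2,\psi}$. $K_\psi(z,w)$ is its reproducing (Bergman) kernel: $f(z)=\int f(w)K_\psi(z,w)e^{-\psi(w)}dv(w)$. The Toeplitz operator is $T_uf(z)=\int K_\psi(z,w)f(w)u(w)e^{-\psi(w)}dv(w)$ for $f\in A^2_\psi(\mathbb{B}_n)$. With $\Phi_{2,z}(w)=\exp(\frac{1}{1-\langle w,z\rangle}-\frac12\frac{1}{1-|z|^2})$ and $\widetilde\Phi_{2,z}=\Phi_{2,z}/\|\Phi_{2,z}\|_{2,\psi}$, define $\widehat u(z)=\int|\widetilde\Phi_{2,z}(w)|^2e^{-\psi(w)}u(w)\,dv(w)$.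 *)

(* Defs.v *)
From HB Require Import structures.
From mathcomp Require Import all_boot all_order all_algebra.
From mathcomp Require Import all_classical all_reals all_analysis.
From mathcomp Require Import complex.

Set Implicit Arguments.
Unset Strict Implicit.
Unset Printing Implicit Defensive.

Import Order.TTheory GRing.Theory Num.Theory.
Import numFieldNormedType.Exports.
Local Open Scope classical_set_scope.
Local Open Scope ring_scope.

Section Defs.
Variable R : realType.
Variable n : nat.

Definition Cvec := 'I_n -> complex R.

(* Real coordinates: the Lebesgue measure lives on n.-tuple (R * R) ~ R^(2n),
   with its canonical (product Borel) measurable structure. *)
Definition Rcoords := n.-tuple (R * R).

Definition tz (x : Rcoords) : Cvec :=
  fun j => Complex (tnth x j).1 (tnth x j).2.

Definition csq (c : complex R) : R := complex.Re c ^+ 2 + complex.Im c ^+ 2.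
Definition cabs (c : complex R) : R := Num.sqrt (csq c).

Definition nrm2 (z : Cvec) : R := \sum_(j < n) csq (z j).

Definition cinner (w z : Cvec) : complex R := \sum_(j < n) w j * conjc (z j).

Definition Bn : set Cvec := [set z | nrm2 z < 1].
Definition BnR : set Rcoords := [set x | nrm2 (tz x) < 1].

Definition psi (z : Cvec) : R := (1 - nrm2 z)^-1.
Definition weight (x : Rcoords) : R := expR (- psi (tz x)).

(* v is Lebesgue measure on C^n = R^(2n): it gives every closed box its volume
   (this determines it uniquely on the Borel sets). *)
Definition box (a b : Rcoords) : set Rcoords :=
  [set x | forall j : 'I_n,
     ((tnth a j).1 <= (tnth x j).1 <= (tnth b j).1) /\
     ((tnth a j).2 <= (tnth x j).2 <= (tnth b j).2)].

Definition is_lebesgue (v : {measure set Rcoords -> \bar R}) : Prop :=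
  forall a b : Rcoords,
    (forall j : 'I_n, (tnth a j).1 <= (tnth b j).1 /\ (tnth a j).2 <= (tnth b j).2) ->
    v (box a b) =
      (\prod_(j < n) (((tnth b j).1 - (tnth a j).1) * ((tnth b j).2 - (tnth a j).2)))%:E.

Definition holomorphic_on_Bn (f : Cvec -> complex R) : Prop :=
  forall z : Cvec, Bn z ->
    exists a : Cvec, forall e : R, 0 < e -> exists d : R, 0 < d /\
      forall h : Cvec, nrm2 h < d ^+ 2 -> Bn (fun j => z j + h j) ->
        cabs (f (fun j => z j + h j) - f z - \sum_(j < n) a j * h j)
          <= e * Num.sqrt (nrm2 h).

Variable v : {measure set Rcoords -> \bar R}.

Definition wint (g : Cvec -> R) : \bar R :=
  (\int[v]_(x in BnR) (g (tz x) * weight x)%:E)%E.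

Definition nsq (f : Cvec -> complex R) : \bar R := wint (fun z => csq (f z)).

Definition in_A2 (f : Cvec -> complex R) : Prop :=
  holomorphic_on_Bn f /\ (nsq f < +oo)%E.

Definition cwint (g : Cvec -> complex R) : complex R :=
  Complex (Rintegral v BnR (fun x => complex.Re (g (tz x)) * weight x))
          (Rintegral v BnR (fun x => complex.Im (g (tz x)) * weight x)).

Definition is_bergman_kernel (K : Cvec -> Cvec -> complex R) : Prop :=
  forall z : Cvec, Bn z ->
    in_A2 (fun w => conjc (K z w)) /\
    forall f, in_A2 f -> f z = cwint (fun w => f w * K z w).

Definition toeplitz (K : Cvec -> Cvec -> complex R) (u : Cvec -> R)
  (f : Cvec -> complex R) : Cvec -> complex R :=
  fun z => cwint (fun w => K z w * f w * Complex (u w) 0).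

Definition cexp (c : complex R) : complex R :=
  Complex (expR (complex.Re c) * cos (complex.Im c)) (expR (complex.Re c) * sin (complex.Im c)).

Definition Phi2 (z : Cvec) : Cvec -> complex R :=
  fun w => cexp ((1 - cinner w z)^-1 - Complex (2^-1 * psi z) 0).

(* Berezin-type transform  \hat u(z) = int |Phi~_{2,z}|^2 e^{-psi} u dv,
   Phi~ = Phi / ||Phi||_{2,psi} *)
Definition uhat (u : Cvec -> R) (z : Cvec) : \bar R :=
  wint (fun w => csq (Phi2 z w) / fine (nsq (Phi2 z)) * u w).

End Defs.

(* Main.v *)
Require Import Defs.
From HB Require Import structures.
From mathcomp Require Import all_boot all_order all_algebra.
From mathcomp Require Import all_classical all_reals all_analysis.
From mathcomp Require Import measurable_realfun.
From mathcomp Require Import complex ring lra.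

Set Implicit Arguments.
Unset Strict Implicit.
Unset Printing Implicit Defensive.

Import Order.TTheory GRing.Theory Num.Theory.
Import numFieldNormedType.Exports.
Local Open Scope classical_set_scope.
Local Open Scope ring_scope.

(** On neighbourhoods z + Ebox z of size (1 - |z|^2) and (1 - |z|^2)^(3/2) in the
    tangential and radial directions, |Phi_{2,z}|^2 e^{-psi} is bounded below, and outside it
    decays like a Gaussian, so that ||Phi_{2,z}||^2 is comparable to the volume of Ebox z.
    Hence the Berezin transform dominates the average of u over z + Ebox z.  The sub-mean value
    property of f exp (- 1 / (1 - <., z>)) on this circled neighbourhood bounds
    |f(z)|^2 e^{-psi(z)} by the average of |f|^2 e^{-psi}, and Tonelli turns bounded averages of u
    into the Carleson inequality; conversely one tests that inequality on Phi_{2,z}.  Since T_u is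
    given by its kernel only, <T_u f, phi> = <f u, phi> is obtained from the Riesz representation
    of phi |-> <f u, phi> by an element of A^2, which the reproducing kernel identifies as T_u f. *)

(** The exponents 1 and 3/2 come from an exact identity. With [a = 1 - |z|^2], [b = 1 - |z + h|^2]
    and [s = <h, z>], minus the logarithm of [|Phi_{2,z}|^2 e^{-psi}] at [z + h] equals [(a^2 |h|^2
    + (a + b) |s|^2) / (a b |a - s|^2)], hence behaves near [z] like [|h|^2 / a^2 + 2 |s|^2 / a^3]:
    size [a] in [h], size [a^(3/2)] in [s]. The volume of these neighbourhoods is never computed:
    they are compared through inclusions into dilates, and a dilation by [t] multiplies [v] by
    [t^(2n)]. A lower bound by a power of [a] is enough to absorb the part [|s| > a], where the
    exponent is at least [1 / (4 a)]. Two obstacles shape the rest. The measure [v] is known by its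
    values on boxes, so its invariance under rotations has to be derived; and holomorphy is bare
    differentiability, so the mean value property and the stability under locally bounded pointwise
    limits are proved from Goursat's lemma on. Square integrability of [u] enters from (a) to (b),
    where boundedness of [Phi_{2,z}] puts [Phi_{2,z} u] in [L^2_psi]. *)

Section ComplexModulus.
Variable R : realType.
Implicit Types c d : complex R.

Lemma csq_ge0 c : 0 <= csq c.
Proof. by rewrite /csq addr_ge0 ?sqr_ge0. Qed.

Lemma cabs_ge0 c : 0 <= cabs c.
Proof. exact: sqrtr_ge0. Qed.

Lemma sqr_cabs c : cabs c ^+ 2 = csq c.
Proof. by rewrite sqr_sqrtr ?csq_ge0. Qed.

Lemma cabsE c : cabs c = ComplexField.Normc.normc c.
Proof. by case: c. Qed.

Lemma cabsM c d : cabs (c * d) = cabs c * cabs d.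
Proof. by rewrite !cabsE ComplexField.Normc.normcM. Qed.

Lemma cabsV c : cabs c^-1 = (cabs c)^-1.
Proof. by rewrite !cabsE ComplexField.Normc.normcV. Qed.

Lemma cabsD c d : cabs (c + d) <= cabs c + cabs d.
Proof. by rewrite !cabsE le_normcD. Qed.

Lemma cabsN c : cabs (- c) = cabs c.
Proof. by rewrite !cabsE normcN. Qed.

Lemma cabsB c d : cabs (c - d) <= cabs c + cabs d.
Proof. by rewrite -(cabsN d) cabsD. Qed.

Lemma cabsBC c d : cabs (c - d) = cabs (d - c).
Proof. by rewrite -cabsN opprB. Qed.

Lemma cabs0 : cabs 0 = 0 :> R.
Proof. by rewrite cabsE ComplexField.Normc.normc0. Qed.

Lemma cabs1 : cabs 1 = 1 :> R.
Proof. by rewrite cabsE ComplexField.Normc.normc1. Qed.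

Lemma cabs0_eq0 c : cabs c = 0 -> c = 0.
Proof. by rewrite cabsE => /ComplexField.Normc.eq0_normc. Qed.

Lemma cabs_gt0 c : (0 < cabs c) = (c != 0).
Proof.
rewrite lt_neqAle cabs_ge0 andbT eq_sym; apply/idP/idP; apply: contraNN.
  by move=> /eqP ->; rewrite cabs0.
by move=> /eqP/cabs0_eq0 ->.
Qed.

Lemma csqM c d : csq (c * d) = csq c * csq d.
Proof. by rewrite -!sqr_cabs cabsM exprMn. Qed.

Lemma csq_conj c : csq (conjc c) = csq c.
Proof. by case: c => a b; rewrite /csq /= sqrrN. Qed.

Lemma csqN c : csq (- c) = csq c.
Proof. by rewrite -!sqr_cabs cabsN. Qed.

Lemma csq0 : csq 0 = 0 :> R.
Proof. by rewrite -sqr_cabs cabs0 expr0n. Qed.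

Lemma cabs_real (x : R) : cabs (Complex x 0) = `|x|.
Proof. by rewrite /cabs /csq /= expr0n addr0 sqrtr_sqr. Qed.

Lemma csq_real (x : R) : csq (Complex x 0) = x ^+ 2.
Proof. by rewrite /csq /= expr0n addr0. Qed.

Lemma ReD c d : complex.Re (c + d) = complex.Re c + complex.Re d.
Proof. by case: c; case: d. Qed.
Lemma ImD c d : complex.Im (c + d) = complex.Im c + complex.Im d.
Proof. by case: c; case: d. Qed.
Lemma ReN c : complex.Re (- c) = - complex.Re c. Proof. by case: c. Qed.
Lemma ImN c : complex.Im (- c) = - complex.Im c. Proof. by case: c. Qed.
Lemma ReM c d :
  complex.Re (c * d) = complex.Re c * complex.Re d - complex.Im c * complex.Im d.
Proof. by case: c; case: d. Qed.
Lemma ImM c d :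
  complex.Im (c * d) = complex.Re c * complex.Im d + complex.Im c * complex.Re d.
Proof. by case: c => a b; case: d => e f /=. Qed.
Lemma complex_eq c d :
  complex.Re c = complex.Re d -> complex.Im c = complex.Im d -> c = d.
Proof. by case: c => a b; case: d => e f /= -> ->. Qed.
Lemma ReV c : complex.Re c^-1 = complex.Re c / csq c.
Proof. by case: c. Qed.
Lemma Re_sum (I : Type) (r : seq I) (P : pred I) (F : I -> complex R) :
  complex.Re (\sum_(i <- r | P i) F i) = \sum_(i <- r | P i) complex.Re (F i).
Proof. by apply: (big_morph (@complex.Re R) ReD). Qed.
Lemma Im_sum (I : Type) (r : seq I) (P : pred I) (F : I -> complex R) :
  complex.Im (\sum_(i <- r | P i) F i) = \sum_(i <- r | P i) complex.Im (F i).
Proof. by apply: (big_morph (@complex.Im R) ImD). Qed.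

Lemma normRe_le c : `|complex.Re c| <= cabs c.
Proof.
by rewrite -sqrtr_sqr /cabs ler_wsqrtr // /csq lerDl sqr_ge0.
Qed.

Lemma normIm_le c : `|complex.Im c| <= cabs c.
Proof.
by rewrite -sqrtr_sqr /cabs ler_wsqrtr // /csq lerDr sqr_ge0.
Qed.

Lemma cabs_le_ReIm c : cabs c <= `|complex.Re c| + `|complex.Im c|.
Proof.
rewrite -(ler_pXn2r (n := 2)) ?nnegrE ?cabs_ge0 ?addr_ge0 //.
rewrite sqr_cabs /csq sqrrD !real_normK ?num_real //.
by rewrite -addrA lerD2l lerDr mulrn_wge0 // mulr_ge0.
Qed.

Lemma cabs_sum (I : Type) (r : seq I) (P : pred I) (F : I -> complex R) :
  cabs (\sum_(i <- r | P i) F i) <= \sum_(i <- r | P i) cabs (F i).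
Proof.
elim/big_rec2: _ => [|i y x _ IH]; first by rewrite cabs0.
by rewrite (le_trans (cabsD _ _)) // lerD2l.
Qed.

Lemma csqD_le c d : csq (c + d) <= 2 * (csq c + csq d).
Proof.
rewrite /csq ReD ImD.
move: (complex.Re c) (complex.Re d) (complex.Im c) (complex.Im d) => x y z t.
have := sqr_ge0 (x - y); have := sqr_ge0 (z - t); nra.
Qed.

End ComplexModulus.

(** * Cauchy-Schwarz and the Hermitian geometry of C^n *)

Section CauchySchwarzSum.
Variable R : realType.

(** Nonnegativity of the sum of [(C x_j - B y_j)^2], which equals [C (C A - B^2)]; the case [C = 0]
    is separate because [C] is cancelled at the end. *)
Lemma sum_cauchy_schwarz n (x y : 'I_n -> R) :
  (\sum_j x j * y j) ^+ 2 <= (\sum_j x j ^+ 2) * (\sum_j y j ^+ 2).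
Proof.
set A := \sum_j x j ^+ 2; set B := \sum_j _ * _; set C := \sum_j y j ^+ 2.
have C0 : 0 <= C by apply: sumr_ge0 => j _; exact: sqr_ge0.
have [C0'|Cn0] := eqVneq C 0.
  suff -> : B = 0 by rewrite C0' mulr0 expr0n.
  apply: big1 => j _.
  have /eqP : y j ^+ 2 = 0.
    by apply: (psumr_eq0P _ C0') => // k _; exact: sqr_ge0.
  by rewrite sqrf_eq0 => /eqP ->; rewrite mulr0.
have : 0 <= \sum_j (C * x j - B * y j) ^+ 2.
  by apply: sumr_ge0 => j _; exact: sqr_ge0.
have -> : \sum_j (C * x j - B * y j) ^+ 2 = C * (C * A - B ^+ 2).
  rewrite (eq_bigr (fun j => C ^+ 2 * x j ^+ 2 + (- (2 * C * B)) * (x j * y j) +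
    B ^+ 2 * y j ^+ 2)); last by move=> j _; ring.
  by rewrite !big_split /= -!mulr_sumr -/A -/B -/C; ring.
by rewrite pmulr_rge0 ?lt_def ?Cn0 // subr_ge0 mulrC.
Qed.

End CauchySchwarzSum.

Section Cvectors.
Variables (R : realType) (n : nat).
Local Notation V := (Cvec R n).
Implicit Types z w h a : V.

Definition vadd z h : V := fun j => z j + h j.
Definition vscale (c : complex R) h : V := fun j => c * h j.
Definition vsub z w : V := fun j => z j - w j.
Definition vnorm z : R := Num.sqrt (nrm2 z).
Definition vlin a h : complex R := \sum_(j < n) a j * h j.

Lemma nrm2_ge0 z : 0 <= nrm2 z.
Proof. by apply: sumr_ge0 => j _; exact: csq_ge0. Qed.

Lemma vnorm_ge0 z : 0 <= vnorm z. Proof. exact: sqrtr_ge0. Qed.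

Lemma vnorm0 : vnorm ((fun=> 0) : V) = 0.
Proof. by rewrite /vnorm /nrm2 big1 ?sqrtr0 // => j _; exact: csq0. Qed.

Lemma sqr_vnorm z : vnorm z ^+ 2 = nrm2 z.
Proof. by rewrite sqr_sqrtr ?nrm2_ge0. Qed.

Lemma nrm2_scale c h : nrm2 (vscale c h) = csq c * nrm2 h.
Proof. by rewrite /nrm2 big_distrr /=; apply: eq_bigr => j _; rewrite csqM. Qed.

Lemma vnorm_scale c h : vnorm (vscale c h) = cabs c * vnorm h.
Proof. by rewrite /vnorm nrm2_scale sqrtrM ?csq_ge0. Qed.

Lemma sqrt_le_iff (x y : R) : 0 <= y -> (Num.sqrt x <= y) = (x <= y ^+ 2).
Proof.
by move=> y0; rewrite -{1}(ger0_norm y0) -sqrtr_sqr ler_sqrt ?sqr_ge0.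
Qed.

Lemma nrm2_le z (r : R) : 0 <= r -> (vnorm z <= r) = (nrm2 z <= r ^+ 2).
Proof. exact: sqrt_le_iff. Qed.

Lemma nrm2_lt z (r : R) : 0 <= r -> (vnorm z < r) = (nrm2 z < r ^+ 2).
Proof.
by move=> r0; rewrite -sqr_vnorm ltr_pXn2r ?nnegrE ?vnorm_ge0.
Qed.

Lemma vlin_le a h : cabs (vlin a h) <= vnorm a * vnorm h.
Proof.
rewrite (le_trans (cabs_sum _ _ _)) //.
under eq_bigr do rewrite cabsM.
rewrite -(ler_pXn2r (n := 2)) ?nnegrE ?mulr_ge0 ?vnorm_ge0 //; last first.
  by apply: sumr_ge0 => j _; rewrite mulr_ge0 ?cabs_ge0.
have nE (z : V) : nrm2 z = \sum_j cabs (z j) ^+ 2.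
  by apply: eq_bigr => j _; rewrite sqr_cabs.
by rewrite exprMn !sqr_vnorm !nE sum_cauchy_schwarz.
Qed.

Lemma cinner_le w z : cabs (cinner w z) <= vnorm w * vnorm z.
Proof.
have -> : vnorm z = vnorm (fun j => conjc (z j)).
  by rewrite /vnorm /nrm2; under [in RHS]eq_bigr do rewrite csq_conj.
exact: vlin_le.
Qed.

Lemma nrm2D z w :
  nrm2 (vadd z w) = nrm2 z + 2 * complex.Re (cinner w z) + nrm2 w.
Proof.
rewrite /nrm2 /cinner Re_sum big_distrr /= -!big_split /=.
apply: eq_bigr => j _; rewrite /vadd /csq.
by case: (z j) => a b; case: (w j) => c d /=; ring.
Qed.

Lemma vnormD z w : vnorm (vadd z w) <= vnorm z + vnorm w.
Proof.
rewrite nrm2_le ?addr_ge0 ?vnorm_ge0 // nrm2D sqrrD !sqr_vnorm lerD2r lerD2l.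
rewrite -[X in _ <= X]mulr_natl ler_pM2l // mulrC.
exact: le_trans (ler_norm _) (le_trans (normRe_le _) (cinner_le _ _)).
Qed.

Lemma cinner_conj w z : cinner w z = conjc (cinner z w).
Proof.
rewrite /cinner rmorph_sum; apply: eq_bigr => j _ /=.
by rewrite rmorphM /= conjcK mulrC.
Qed.

Lemma cinnerxx z : cinner z z = Complex (nrm2 z) 0.
Proof.
apply: complex_eq; rewrite /cinner /nrm2 ?Re_sum ?Im_sum /=.
  by apply: eq_bigr => j _; rewrite /csq; case: (z j) => a b /=; ring.
by apply: big1 => j _; case: (z j) => a b /=; ring.
Qed.

Lemma cinnerDl w h z : cinner (vadd w h) z = cinner w z + cinner h z.
Proof. by rewrite /cinner -big_split; apply: eq_bigr => j _; rewrite mulrDl. Qed.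

Lemma cinnerZl c h z : cinner (vscale c h) z = c * cinner h z.
Proof. by rewrite /cinner mulr_sumr; apply: eq_bigr => j _; rewrite -mulrA. Qed.

Lemma cinnerDr w h z : cinner z (vadd w h) = cinner z w + cinner z h.
Proof. by rewrite cinner_conj cinnerDl rmorphD /= -!cinner_conj. Qed.

Lemma vadd_sub z w : vadd z (vsub w z) = w.
Proof. by apply/funext => j; rewrite /vadd /vsub addrC subrK. Qed.

Lemma vaddA z w h : vadd (vadd z w) h = vadd z (vadd w h).
Proof. by apply/funext => j; rewrite /vadd addrA. Qed.

Lemma vscale1 h : vscale 1 h = h.
Proof. by apply/funext => j; rewrite /vscale mul1r. Qed.

Lemma vscale0 h : vscale 0 h = fun=> 0.
Proof. by apply/funext => j; rewrite /vscale mul0r. Qed.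

Lemma vadd0 z : vadd z (fun=> 0) = z.
Proof. by apply/funext => j; rewrite /vadd addr0. Qed.

Lemma vscaleDl c d h : vscale (c + d) h = vadd (vscale c h) (vscale d h).
Proof. by apply/funext => j; rewrite /vscale /vadd mulrDl. Qed.

Lemma vlinZ a c h : vlin a (vscale c h) = c * vlin a h.
Proof. by rewrite /vlin mulr_sumr; apply: eq_bigr => j _; rewrite mulrCA. Qed.

End Cvectors.

(** * Lebesgue measure on C^n *)

Section Coordinates.
Variables (R : realType) (n : nat).
Local Notation V := (Cvec R n).
Local Notation T := (Rcoords R n).

Definition ct (z : V) : T := [tuple (complex.Re (z j), complex.Im (z j)) | j < n].

Lemma ctK z : tz (ct z) = z.
Proof. by apply/funext => j; rewrite /tz tnth_mktuple /=; case: (z j). Qed.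

Lemma tzK x : ct (tz x) = x.
Proof.
by apply: eq_from_tnth => j; rewrite tnth_mktuple /tz /=; case: (tnth x j).
Qed.

Lemma measurable_Re_tz j : measurable_fun setT (fun x : T => complex.Re (tz x j)).
Proof.
exact: (measurableT_comp (measurable_fst : measurable_fun setT (@fst R R)) (measurable_tnth j)).
Qed.

Lemma measurable_Im_tz j : measurable_fun setT (fun x : T => complex.Im (tz x j)).
Proof.
exact: (measurableT_comp (measurable_snd : measurable_fun setT (@snd R R)) (measurable_tnth j)).
Qed.

Lemma measurable_ct d (X : measurableType d) (F : X -> V) :
  (forall j, measurable_fun setT (fun x => complex.Re (F x j))) ->
  (forall j, measurable_fun setT (fun x => complex.Im (F x j))) ->
  measurable_fun setT (fun x => ct (F x)).
Proof.
move=> mRe mIm; apply/measurable_fun_tnthP => j.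
rewrite (_ : _ \o _ = fun x => (complex.Re (F x j), complex.Im (F x j))); last first.
  by apply/funext => x /=; rewrite tnth_mktuple.
exact: measurable_fun_pair.
Qed.

Lemma boxP (a b : V) (x : T) : box (ct a) (ct b) x <->
  forall j, complex.Re (a j) <= complex.Re (tz x j) <= complex.Re (b j) /\
            complex.Im (a j) <= complex.Im (tz x j) <= complex.Im (b j).
Proof. by split => H j; have := H j; rewrite !tnth_mktuple. Qed.

Definition cube (r : R) : set T := box (ct (fun=> Complex (- r) (- r))) (ct (fun=> Complex r r)).

Lemma in_cube (x : T) (r : R) : vnorm (tz x) <= r -> cube r x.
Proof.
move=> xr; apply/boxP => j /=.
have H : cabs (tz x j) <= r.
  apply: le_trans xr; rewrite /vnorm /cabs ler_wsqrtr // /nrm2 (bigD1 j) //=.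
  by rewrite lerDl sumr_ge0 // => i _; exact: csq_ge0.
have := le_trans (normRe_le _) H; have := le_trans (normIm_le _) H.
by rewrite !ler_norml => -> ->.
Qed.

Definition boxes : set (set T) := [set A | exists a b : V, A = box (ct a) (ct b)].

Lemma measurable_box (a b : T) : measurable (box a b).
Proof.
rewrite (_ : box a b = \bigcap_(j in [set: 'I_n]) ((fun x : T => tnth x j) @^-1`
   (`[(tnth a j).1, (tnth b j).1] `*` `[(tnth a j).2, (tnth b j).2]))); last first.
  apply/seteqP; split => x H j; first by move=> _ /=; rewrite !in_itv; exact: H.
  by have := H j I; rewrite /= !in_itv.
apply: fin_bigcap_measurable => // j _.
rewrite -[X in measurable X]setTI; apply: measurable_tnth => //.
exact: measurableX.
Qed.

(** A closed half-space is a countable union of boxes: one face stays at [c] while the others recede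
    to infinity. The pair [proj], [setp] lets one argument serve real and imaginary coordinates. *)
Let halfspace_gen (proj : complex R -> R)
    (setp : complex R -> R -> complex R) :
  (proj = @complex.Re R /\ setp = fun c x => Complex x (complex.Im c)) \/
  (proj = @complex.Im R /\ setp = fun c x => Complex (complex.Re c) x) ->
  forall (i : 'I_n) (c : R), <<s boxes>> [set x | c <= proj (tz x i)].
Proof.
move=> pE i c.
pose lo (k : nat) : V := fun j => if j == i
  then setp (Complex (- k%:R) (- k%:R)) c else Complex (- k%:R) (- k%:R).
pose hi (k : nat) : V := fun=> Complex k%:R k%:R.
rewrite (_ : [set x | _] = \bigcup_k box (ct (lo k)) (ct (hi k))); last first.
  apply/seteqP; split => [x /= cx|x [k _] /boxP /(_ i)]; last first.
    by rewrite /lo eqxx; case: pE => -[-> ->] /= [/andP[? ?] /andP[? ?]].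
  have [k xk] : exists k : nat, vnorm (tz x) <= k%:R.
    exists (Num.truncn (vnorm (tz x))).+1; exact: ltW (truncnS_gt _).
  exists k => //; apply/boxP => j.
  have /boxP /(_ j) /= [xre xim] := in_cube xk.
  rewrite /lo /hi; case: eqP => [ji|//]; subst j.
  case: pE => -[pE sE]; move: cx; rewrite pE sE /= => cx; split => //.
    by rewrite cx; case/andP: xre.
  by rewrite cx; case/andP: xim.
apply: sigma_algebra_bigcup => k; apply: sub_sigma_algebra.
by exists (lo k), (hi k).
Qed.

(** The half-spaces make every coordinate measurable for the sigma-algebra of the boxes, so the
    identity map from it to the product structure is measurable. Uniqueness of Lebesgue measure
    rests on this. *)
Lemma measurable_boxes : @measurable _ T = <<s boxes>>.
Proof.
apply/seteqP; split; last first.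
  apply: smallest_sub; first exact: sigma_algebra_measurable.
  by move=> _ [a [b ->]]; exact: measurable_box.
suff mid : measurable_fun setT (fun x : g_sigma_algebraType boxes => x : T).
  by move=> A mA; have := mid measurableT A mA; rewrite setTI preimage_id.
apply/measurable_fun_tnthP => i; apply/measurable_fun_pairP; split.
- apply: (measurability _ (RGenCInfty.measurableE R)) => _ [_ [c ->] <-].
  rewrite setTI.
  rewrite (_ : _ @^-1` _ = [set x | c <= complex.Re (tz x i)]); last first.
    by apply/seteqP; split => x /=; rewrite in_itv /= andbT.
  by apply: (halfspace_gen (setp := fun c x => Complex x (complex.Im c))); left.
- apply: (measurability _ (RGenCInfty.measurableE R)) => _ [_ [c ->] <-].
  rewrite setTI.
  rewrite (_ : _ @^-1` _ = [set x | c <= complex.Im (tz x i)]); last first.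
    by apply/seteqP; split => x /=; rewrite in_itv /= andbT.
  by apply: (halfspace_gen (setp := fun c x => Complex (complex.Re c) x)); right.
Qed.

End Coordinates.

Lemma measurable_preimage d1 d2 (X : measurableType d1) (Y : measurableType d2) (f : X -> Y) A :
  measurable_fun setT f -> measurable A -> measurable (f @^-1` A).
Proof. by move=> mf mA; rewrite -[X in measurable X]setTI; exact: mf. Qed.

Section SigmaFinitePack.
Context d (T : measurableType d) (R : realType) (m : {measure set T -> \bar R}).
Hypothesis s : sigma_finite setT m.

(** Carries the proof of sigma-finiteness as a phantom argument, so that a structure can be attached
    to it: [v] is an arbitrary measure whose sigma-finiteness is a consequence of [is_lebesgue]. *)
Definition sigma_finite_pack of sigma_finite setT m : set T -> \bar R := m.
HB.instance Definition _ := Measure.on (sigma_finite_pack s).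
HB.instance Definition _ :=
  Measure_isSigmaFinite.Build d T R (sigma_finite_pack s) s.

End SigmaFinitePack.

Section Tonelli.
Context d1 d2 (T1 : measurableType d1) (T2 : measurableType d2) (R : realType).
Variables (m1 : {measure set T1 -> \bar R}) (m2 : {measure set T2 -> \bar R}).
Hypotheses (s1 : sigma_finite setT m1) (s2 : sigma_finite setT m2).

Let m1' : {sigma_finite_measure set T1 -> \bar R} := sigma_finite_pack s1.
Let m2' : {sigma_finite_measure set T2 -> \bar R} := sigma_finite_pack s2.

Lemma tonelli (f : T1 * T2 -> \bar R) :
  measurable_fun setT f -> (forall x, 0 <= f x)%E ->
  (\int[m1]_x \int[m2]_y f (x, y) = \int[m2]_y \int[m1]_x f (x, y))%E.
Proof. by move=> mf f0; exact: (@fubini_tonelli _ _ _ _ _ m1' m2' f mf f0). Qed.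

Lemma tonelli_sections (P : set (T1 * T2)) : measurable P ->
  (\int[m1]_x m2 [set y | P (x, y)] = \int[m2]_y m1 [set x | P (x, y)])%E.
Proof.
move=> mP; have := @indic_fubini_tonelli _ _ _ _ _ m1' m2' P mP.
rewrite indic_fubini_tonelli_FE // indic_fubini_tonelli_GE //= => H.
transitivity (\int[m1]_x (m2 \o xsection P) x)%E.
  by apply: eq_integral => x _ /=; congr (m2 _); apply/seteqP; split => y; rewrite /xsection /= inE.
rewrite H; apply: eq_integral => y _ /=; congr (m1 _).
by apply/seteqP; split => x; rewrite /ysection /= inE.
Qed.

Lemma measurable_section (P : set (T1 * T2)) : measurable P ->
  measurable_fun setT (fun x => m2 [set y | P (x, y)]).
Proof.
move=> mP; have := @measurable_fun_xsection _ _ _ _ _ m2' P mP.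
apply: eq_measurable_fun => x _ /=; congr (m2 _).
by apply/seteqP; split => y; rewrite /xsection /= inE.
Qed.

Lemma measurable_partial_integral (f : T1 * T2 -> \bar R) :
  measurable_fun setT f -> (forall x, 0 <= f x)%E ->
  measurable_fun setT (fun x => \int[m2]_y f (x, y))%E.
Proof. by move=> mf f0; exact: (@measurable_fun_fubini_tonelli_F _ _ _ _ _ m2' f mf f0). Qed.

End Tonelli.

(** * Uniqueness and invariance of Lebesgue measure *)

Section LebesgueMeasure.
Variables (R : realType) (n : nat).
Local Notation V := (Cvec R n).
Local Notation T := (Rcoords R n).
Implicit Types v : {measure set T -> \bar R}.

Lemma box_empty (a b : V) :
  ~ (forall j, complex.Re (a j) <= complex.Re (b j) /\ complex.Im (a j) <= complex.Im (b j)) ->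
  box (ct a) (ct b) = set0.
Proof.
move=> nab; apply/seteqP; split => // x /boxP H; apply: nab => j.
have [/andP[r1 r2] /andP[i1 i2]] := H j.
by split; [exact: le_trans r1 r2|exact: le_trans i1 i2].
Qed.

Lemma lebesgue_box v (a b : V) : is_lebesgue v ->
  (forall j, complex.Re (a j) <= complex.Re (b j) /\ complex.Im (a j) <= complex.Im (b j)) ->
  v (box (ct a) (ct b)) = (\prod_(j < n) ((complex.Re (b j) - complex.Re (a j)) *
     (complex.Im (b j) - complex.Im (a j))))%:E.
Proof.
move=> Hv ab; rewrite Hv; last by move=> j; rewrite !tnth_mktuple; exact: ab.
by congr (_ %:E); apply: eq_bigr => j _; rewrite !tnth_mktuple.
Qed.

Lemma lebesgue_cube v (r : R) : is_lebesgue v -> 0 <= r ->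
  v (@cube R n r) = ((2 * r) ^+ (2 * n))%:E.
Proof.
move=> Hv r0; rewrite lebesgue_box // => [|j /=]; last by split; lra.
congr (_ %:E); rewrite (eq_bigr (fun=> (2 * r) ^+ 2)) => [|j _ /=]; last by ring.
by rewrite prodr_const card_ord -exprM.
Qed.

(** Closed boxes generate, are stable under intersection, and the space is exhausted by cubes of
    finite measure. Boxes with reversed sides are empty, which settles the case on which
    [is_lebesgue] is silent. *)
Lemma lebesgue_unique v1 v2 : is_lebesgue v1 -> is_lebesgue v2 ->
  forall A, measurable A -> v1 A = v2 A.
Proof.
move=> H1 H2 A mA.
apply: (measure_unique (@boxes R n) (fun k => @cube R n k%:R)) => //.
- exact: measurable_boxes.
- move=> _ _ [a [b ->]] [c [d ->]].
  exists (fun j => Complex (Num.max (complex.Re (a j)) (complex.Re (c j)))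
                           (Num.max (complex.Im (a j)) (complex.Im (c j)))).
  exists (fun j => Complex (Num.min (complex.Re (b j)) (complex.Re (d j)))
                           (Num.min (complex.Im (b j)) (complex.Im (d j)))).
  apply/seteqP; split => x.
    move=> [/boxP H /boxP H']; apply/boxP => j /=; have [h1 h2] := H j; have [h3 h4] := H' j.
    rewrite !ge_max !le_min; move: h1 h2 h3 h4 => /=.
    by do 4!(move=> /andP[-> ->]).
  move=> /boxP H; split; apply/boxP => j; have /= := H j;
    rewrite !ge_max !le_min => -[/andP[/andP[h1 h2] /andP[h3 h4]]
      /andP[/andP[h5 h6] /andP[h7 h8]]];
    by rewrite ?h1 ?h2 ?h3 ?h4 ?h5 ?h6 ?h7 ?h8.
- by move=> k; do 2 eexists.
- apply/seteqP; split => // x _.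
  exists (Num.truncn (vnorm (tz x))).+1 => //.
  by apply: in_cube; exact: ltW (truncnS_gt _).
- move=> _ [a [b ->]].
  have [ab|nab] := pselect (forall j, complex.Re (a j) <= complex.Re (b j) /\
      complex.Im (a j) <= complex.Im (b j)); first by rewrite !lebesgue_box.
  by rewrite box_empty // !measure0.
- by move=> k; rewrite lebesgue_cube // ltry.
Qed.

Lemma lebesgue_sigma_finite v : is_lebesgue v -> sigma_finite setT v.
Proof.
move=> Hv; exists (fun k => @cube R n k%:R).
  apply/seteqP; split => // x _.
  exists (Num.truncn (vnorm (tz x))).+1 => //.
  by apply: in_cube; exact: ltW (truncnS_gt _).
by move=> k; split; [exact: measurable_box|rewrite lebesgue_cube // ltry].
Qed.

Definition affine (c : complex R) (a : V) (x : T) : T := ct (vadd (vscale c (tz x)) a).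

Lemma measurable_affine c a : measurable_fun setT (affine c a).
Proof.
apply: measurable_ct => j; rewrite /vadd /vscale.
  under eq_fun do rewrite ReD ReM.
  by apply: measurable_funD => //; apply: measurable_funB; apply: measurable_funM => //;
    [exact: measurable_Re_tz|exact: measurable_Im_tz].
under eq_fun do rewrite ImD ImM.
by apply: measurable_funD => //; apply: measurable_funD; apply: measurable_funM => //;
  [exact: measurable_Im_tz|exact: measurable_Re_tz].
Qed.

Lemma measurable_preimage_affine c a A : measurable A -> measurable (affine c a @^-1` A).
Proof. by move=> mA; rewrite -[X in measurable X]setTI; exact: measurable_affine. Qed.

(** The image of [v] under the homothety, multiplied by [t^(2n)], again gives each box its volume,
    so it is [v] by uniqueness. *)
Lemma lebesgue_homothety v (t : R) (a : V) A : is_lebesgue v -> 0 < t -> measurable A ->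
  v (affine (Complex t 0) a @^-1` A) = ((t^-1 ^+ (2 * n))%:E * v A)%E.
Proof.
move=> Hv t0 mA.
have p0 : 0 <= t ^+ (2 * n) by rewrite exprn_ge0 // ltW.
pose mu' : {measure set T -> \bar R} :=
  mscale (NngNum p0) (pushforward v (affine (Complex t 0) a)).
pose mu := mu' (measurable_affine _ _).
have muE B : mu B = ((t ^+ (2 * n))%:E * v (affine (Complex t 0%R) a @^-1` B))%E by [].
have Hmu : is_lebesgue mu.
  move=> x y xy.
  pose f (z : V) : V := fun j => Complex ((complex.Re (z j) - complex.Re (a j)) / t)
     ((complex.Im (z j) - complex.Im (a j)) / t).
  have E : affine (Complex t 0) a @^-1` box x y = box (ct (f (tz x))) (ct (f (tz y))).
    rewrite -[in LHS](tzK x) -[in LHS](tzK y).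
    apply/seteqP; split => z; rewrite /preimage /= => /boxP H; apply/boxP => j; have := H j;
      rewrite /affine ctK /f /vadd /vscale ReD ImD ReM ImM /= !mul0r subr0 addr0;
      by rewrite !ler_pdivrMr // !ler_pdivlMr // !lerBlDr !lerBrDr ![_ * t]mulrC.
  rewrite muE E lebesgue_box //; last first.
    move=> j; have [x1 x2] := xy j.
    by rewrite /f /= !ler_pM2r ?invr_gt0 // !lerD2r.
  rewrite -EFinM; congr (_ %:E).
  rewrite (eq_bigr (fun j => (t^-1 ^+ 2) * (((tnth y j).1 - (tnth x j).1) *
     ((tnth y j).2 - (tnth x j).2)))); last by move=> j _; rewrite /f /=; ring.
  rewrite big_split /= prodr_const card_ord mulrA -exprM exprVn mulfV ?mul1r //.
  by rewrite expf_neq0 // gt_eqF.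
have -> : v A = mu A by exact: lebesgue_unique.
rewrite muE muleA -EFinM exprVn mulVf ?mul1e //.
by rewrite expf_neq0 // gt_eqF.
Qed.

Lemma lebesgue_translate v (a : V) A : is_lebesgue v -> measurable A ->
  v (affine 1 a @^-1` A) = v A.
Proof.
by move=> Hv mA; rewrite (lebesgue_homothety a Hv ltr01 mA) invr1 expr1n mul1e.
Qed.

Lemma measurable_nrm2 d (X : measurableType d) (F : X -> V) :
  (forall j, measurable_fun setT (fun x => complex.Re (F x j))) ->
  (forall j, measurable_fun setT (fun x => complex.Im (F x j))) ->
  measurable_fun setT (fun x => nrm2 (F x)).
Proof.
move=> mr mi; rewrite /nrm2; apply: measurable_sum => j.
by rewrite /csq; apply: measurable_funD; apply: measurable_funX.
Qed.

Definition vball (r : R) : set T := [set x | nrm2 (tz x) <= r ^+ 2].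

Lemma measurable_vball r : measurable (vball r).
Proof.
rewrite -[X in measurable X]setTI (_ : vball r = (fun x : T => nrm2 (tz x)) @^-1` `]-oo, r ^+ 2]).
  apply: (measurable_nrm2 (F := @tz R n)) => // j;
    [exact: measurable_Re_tz|exact: measurable_Im_tz].
by apply/seteqP; split => x /=; rewrite in_itv.
Qed.

Lemma vball_lty v r : is_lebesgue v -> 0 <= r -> (v (vball r) < +oo)%E.
Proof.
move=> Hv r0; apply: (@le_lt_trans _ _ (v (@cube R n r))).
  apply: le_measure; rewrite ?inE; [exact: measurable_vball|exact: measurable_box|].
  by move=> x /= xr; apply: in_cube; rewrite nrm2_le.
by rewrite lebesgue_cube // ltry.
Qed.

Lemma vball_gt0 v r : is_lebesgue v -> 0 < r -> (0 < v (vball r))%E.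
Proof.
move=> Hv r0.
(* With this half-side the [2 n] squared coordinates, each at most [s^2], add up to at most [r^2];
   [n + 1] keeps the quotient meaningful for [n = 0]. *)
pose s := r / (2 * n.+1%:R).
have s0 : 0 < s by rewrite /s divr_gt0 // mulr_gt0.
apply: (@lt_le_trans _ _ (v (@cube R n s))).
  by rewrite lebesgue_cube ?(ltW s0) // lte_fin exprn_gt0 // mulr_gt0.
apply: le_measure; rewrite ?inE; [exact: measurable_box|exact: measurable_vball|].
move=> x /boxP /= H; rewrite /vball /= /nrm2.
apply: (@le_trans _ _ (\sum_(j < n) (2 * s ^+ 2))).
  apply: ler_sum => j _; have [] := H j; rewrite /csq -!ler_norml => h1 h2.
  have -> : 2 * s ^+ 2 = s ^+ 2 + s ^+ 2 by ring.
  by apply: lerD; rewrite -real_normK ?num_real // ler_pXn2r ?nnegrE // ltW.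
have -> : \sum_(j < n) (2 * s ^+ 2) = n%:R * 2 * r ^+ 2 / (2 * n.+1%:R) ^+ 2.
  by rewrite sumr_const card_ord -[LHS]mulr_natl /s exprMn exprVn !mulrA.
rewrite ler_pdivrMr // [leRHS]mulrC ler_pM2r ?exprn_gt0 // exprMn.
have : (0 : R) <= n%:R by [].
rewrite -natr1; nra.
Qed.

Lemma integral_indic_mul v (A : set T) (k : \bar R) (f : T -> \bar R) : measurable A ->
  (forall x, A x -> f x = k) -> (forall x, ~ A x -> f x = 0%E) ->
  (\int[v]_x f x = k * v A)%E.
Proof.
move=> mA fA fNA; rewrite -integral_cst // integral_mkcond; apply: eq_integral => x _.
by rewrite patchE; case: ifPn => [|/negP] /[!inE]; [exact: fA|exact: fNA].
Qed.

(* Tonelli for {(x, y) | x \in A, y - d^-1 x \in Q}, where the unit ball Q is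
   invariant under d. Only translations are used as changes of variables. *)
Lemma lebesgue_rotation v (d : complex R) A : is_lebesgue v -> csq d = 1 -> measurable A ->
  v (affine d (fun=> 0) @^-1` A) = v A.
Proof.
move=> Hv d1 mA.
have cd1 : csq (conjc d) = 1 by rewrite csq_conj.
have dd : d * conjc d = 1.
  by apply: complex_eq; move: d1; rewrite /csq; case: d {cd1} => x y /=; nra.
pose Q := vball 1.
have mQ : measurable Q by exact: measurable_vball.
have sf := lebesgue_sigma_finite Hv.
pose s (x y : T) : T := ct (fun j => tz y j - conjc d * tz x j).
pose t (x y : T) : T := ct (fun j => tz x j + d * tz y j).
pose P1 : set (T * T) := [set xy | A xy.1 /\ Q (s xy.1 xy.2)].
pose P2 : set (T * T) := [set xy | A (t xy.1 xy.2) /\ Q xy.1].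
have mc j : measurable_fun setT (fun x : T * T => complex.Re (tz x.1 j)) /\
   measurable_fun setT (fun x : T * T => complex.Im (tz x.1 j)) /\
   measurable_fun setT (fun x : T * T => complex.Re (tz x.2 j)) /\
   measurable_fun setT (fun x : T * T => complex.Im (tz x.2 j)).
  split; [|split; [|split]].
  - exact: (measurableT_comp (measurable_Re_tz j) measurable_fst).
  - exact: (measurableT_comp (measurable_Im_tz j) measurable_fst).
  - exact: (measurableT_comp (measurable_Re_tz j) measurable_snd).
  - exact: (measurableT_comp (measurable_Im_tz j) measurable_snd).
have ms : measurable_fun setT (fun xy : T * T => s xy.1 xy.2).
  apply: measurable_ct => j; have [m1 [m2 [m3 m4]]] := mc j.
    under eq_fun do rewrite ReD ReN ReM.
    by do 3?[apply: measurable_funB => //|apply: measurable_funM => //].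
  under eq_fun do rewrite ImD ImN ImM.
  by apply: measurable_funB => //; apply: measurable_funD; apply: measurable_funM.
have mt : measurable_fun setT (fun xy : T * T => t xy.1 xy.2).
  apply: measurable_ct => j; have [m1 [m2 [m3 m4]]] := mc j.
    under eq_fun do rewrite ReD ReM.
    by apply: measurable_funD => //; apply: measurable_funB => //; apply: measurable_funM.
  under eq_fun do rewrite ImD ImM.
  by apply: measurable_funD => //; apply: measurable_funD => //; apply: measurable_funM.
have mP1 : measurable P1.
  apply: measurableI.
    exact: (measurable_preimage measurable_fst mA).
  exact: (measurable_preimage ms mQ).
have mP2 : measurable P2.
  apply: measurableI.
    exact: (measurable_preimage mt mA).
  exact: (measurable_preimage measurable_fst mQ).
(* For fixed [x] the section is a translate of [Q]; in the next integral it is a translate of the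
   rotated set. *)
have I1 : (\int[v]_x v [set y | P1 (x, y)] = v Q * v A)%E.
  apply: integral_indic_mul => // x Ax; last first.
    by rewrite (_ : [set y | _] = set0) ?measure0 //; apply/seteqP; split => // y [].
  rewrite -(lebesgue_translate (fun j => - (conjc d * tz x j)) Hv mQ); congr (v _).
  apply/seteqP; split => y; rewrite /preimage /= /affine vscale1; first by case.
  by split.
have I2 : (\int[v]_x v [set y | P2 (x, y)] = v (affine d (fun=> 0%R) @^-1` A) * v Q)%E.
  apply: integral_indic_mul => // x Qx; last first.
    by rewrite (_ : [set y | _] = set0) ?measure0 //; apply/seteqP; split => // y [].
  rewrite -(lebesgue_translate (fun j => (conjc d * tz x j)) Hv (measurable_preimage_affine _ _ mA)).
  congr (v _).
  have E y : affine d (fun=> 0) (affine 1 (fun j => conjc d * tz x j) y) = t x y.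
    rewrite /affine ctK vscale1 /t; congr ct; apply/funext => j.
    by rewrite /vadd /vscale mulrDr mulrA dd mul1r addr0 addrC.
  by apply/seteqP; split => y; rewrite /preimage /= E; [case|split].
(* For fixed [y] the substitution [x -> x + d y] turns [y - conjc d x] into [- conjc d x], whose
   norm is that of [x]: the two sections are translates of each other. *)
have J : (\int[v]_y v [set x | P1 (x, y)] = \int[v]_y v [set x | P2 (x, y)])%E.
  apply: eq_integral => y _.
  have mS : measurable [set x | P1 (x, y)].
    by apply: (measurable_preimage (f := fun x => (x, y))) mP1; exact: measurable_fun_pair.
  rewrite -(lebesgue_translate (fun j => d * tz y j) Hv mS); congr (v _).
  have E x : affine 1 (fun j => d * tz y j) x = t x y.
    by rewrite /affine vscale1.
  have E' x : nrm2 (tz (s (t x y) y)) = nrm2 (tz x).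
    have -> : tz (s (t x y) y) = vscale (- conjc d) (tz x).
      rewrite /s /t !ctK; apply/funext => j; rewrite /vscale mulrDr mulrA [conjc d * d]mulrC dd.
      by rewrite mul1r opprD addrCA subrr addr0 mulNr.
    by rewrite nrm2_scale csqN cd1 mul1r.
  by apply/seteqP; split => x; rewrite /preimage /= E /P1 /P2 /Q /vball /= E'.
have := tonelli_sections sf sf mP1; rewrite J -(tonelli_sections sf sf mP2) I1 I2.
(* The factor [v Q] is cancelled, so it has to be positive and finite. *)
have q0 := vball_gt0 Hv (@ltr01 R); have qoo := vball_lty Hv (@ler01 R).
have qf : v Q \is a fin_num by rewrite ge0_fin_numE // measure_ge0.
rewrite muleC => /(congr1 (fun z => z * (fine (v Q))^-1%:E)%E).
have -> : v Q = (fine (v Q))%:E by rewrite fineK.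
rewrite -!muleA -EFinM /= mulfV ?mule1 //.
by rewrite gt_eqF // fine_gt0 // q0 qoo.
Qed.

End LebesgueMeasure.

Section ChangeOfVariables.
Context d1 d2 (X : measurableType d1) (Y : measurableType d2) (R : realType).
Variables (m1 : {measure set X -> \bar R}) (m2 : {measure set Y -> \bar R}).

Lemma integral_change (phi : X -> Y) (k : R) (D : set Y) (f : Y -> \bar R) :
  measurable_fun setT phi -> 0 <= k ->
  (forall A, measurable A -> m1 (phi @^-1` A) = (k%:E * m2 A)%E) ->
  measurable D -> measurable_fun D f -> (forall y, D y -> 0 <= f y)%E ->
  (\int[m1]_(x in phi @^-1` D) f (phi x) = k%:E * \int[m2]_(y in D) f y)%E.
Proof.
move=> mphi k0 H mD mf f0.
rewrite -(@ge0_integral_pushforward _ _ X Y R phi mphi m1 D f mD mf); last first.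
  by move=> y /[!inE]; exact: f0.
rewrite -(@ge0_integral_mscale _ _ _ _ _ mD (NngNum k0) f mf f0).
by apply: (@eq_measure_integral _ _ _ _ (mscale (NngNum k0) m2)) => A mA _; exact: H.
Qed.

End ChangeOfVariables.

Section AffineChange.
Variables (R : realType) (n : nat).
Local Notation V := (Cvec R n).
Local Notation T := (Rcoords R n).
Variable v : {measure set T -> \bar R}.
Hypothesis Hv : is_lebesgue v.

Lemma integral_homothety (t : R) (a : V) (D : set T) (f : T -> \bar R) : 0 < t ->
  measurable D -> measurable_fun D f -> (forall y, D y -> 0 <= f y)%E ->
  (\int[v]_(x in affine (Complex t 0%R) a @^-1` D) f (affine (Complex t 0%R) a x)
   = (t^-1 ^+ (2 * n))%:E * \int[v]_(y in D) f y)%E.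
Proof.
move=> t0; apply: integral_change; first exact: measurable_affine.
  by rewrite exprn_ge0 // invr_ge0 ltW.
by move=> A mA; exact: lebesgue_homothety.
Qed.

Lemma integral_translate (a : V) (D : set T) (f : T -> \bar R) :
  measurable D -> measurable_fun D f -> (forall y, D y -> 0 <= f y)%E ->
  (\int[v]_(x in affine 1%R a @^-1` D) f (affine 1%R a x) = \int[v]_(y in D) f y)%E.
Proof.
by move=> mD mf f0; rewrite (integral_homothety _ ltr01) // invr1 expr1n mul1e.
Qed.

Lemma integral_rotation (c : complex R) (D : set T) (f : T -> \bar R) : csq c = 1 ->
  measurable D -> measurable_fun D f -> (forall y, D y -> 0 <= f y)%E ->
  (\int[v]_(x in affine c (fun=> 0%R) @^-1` D) f (affine c (fun=> 0%R) x)
   = \int[v]_(y in D) f y)%E.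
Proof.
move=> c1 mD mf f0; rewrite -[RHS]mul1e.
apply: integral_change => //; first exact: measurable_affine.
by move=> A mA; rewrite mul1e; exact: lebesgue_rotation.
Qed.

End AffineChange.

(** * Measurability of open sets and of continuous functions on the ball *)

Section OpenSets.
Variables (R : realType) (n : nat).
Local Notation V := (Cvec R n).
Local Notation T := (Rcoords R n).

Lemma rat_approx (x e : R) : 0 < e -> exists q : rat, `|x - ratr q| <= e.
Proof.
move=> e0; have /rat_in_itvoo[q] : x - e < x + e by lra.
by rewrite in_itv /= => /andP[h1 h2]; exists q; rewrite ler_norml; apply/andP; split; lra.
Qed.

Lemma sqr_le_norm (x y : R) : `|x| <= y -> x ^+ 2 <= y ^+ 2.
Proof.
move=> xy; rewrite -real_normK ?num_real // ler_pXn2r ?nnegrE //.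
exact: le_trans xy.
Qed.

(** Each point lies in a box inside [O] with rational centre and half-sides [1 / (k + 1)]; there are
    countably many such boxes. *)
Lemma measurable_open (O : set T) :
  (forall x, O x -> exists d, 0 < d /\
     forall y, nrm2 (vsub (tz y) (tz x)) < d ^+ 2 -> O y) ->
  measurable O.
Proof.
move=> HO.
pose qc (q : n.-tuple (rat * rat)) : V :=
  fun j => Complex (ratr (tnth q j).1) (ratr (tnth q j).2).
pose B (i : n.-tuple (rat * rat) * nat) : set T :=
  box (ct (fun j => qc i.1 j - Complex i.2.+1%:R^-1 i.2.+1%:R^-1))
      (ct (fun j => qc i.1 j + Complex i.2.+1%:R^-1 i.2.+1%:R^-1)).
(* A box that is not contained in [O] is replaced by the empty set, so that the union runs over one
   fixed countable type. *)
pose B' i := if `[< B i `<=` O >] then B i else set0.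
have -> : O = \bigcup_i B' i; last first.
  apply: countable_bigcupT_measurable => // i; rewrite /B'.
  by case: ifP => // _; exact: measurable_box.
apply/seteqP; split => [x Ox|x [i _]]; last first.
  by rewrite /B'; case: ifPn => // /asboolP; apply.
have [d [d0 dO]] := HO x Ox.
(* Points of a box of half-side at most [e] containing [x] lie within [2 e] of [x] in each real
   coordinate, so the squared distance is at most [8 n e^2 < d^2]. *)
pose e := d / (4 * n.+1%:R).
have e0 : 0 < e by rewrite /e divr_gt0 // mulr_gt0.
pose k := Num.truncn e^-1.
have ke : k.+1%:R^-1 <= e.
  by rewrite invf_ple ?posrE // ltW // truncnS_gt.
have /choice[q1 hq1] : forall j, exists q : rat, `|(tnth x j).1 - ratr q| <= k.+1%:R^-1.
  by move=> j; exact: rat_approx.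
have /choice[q2 hq2] : forall j, exists q : rat, `|(tnth x j).2 - ratr q| <= k.+1%:R^-1.
  by move=> j; exact: rat_approx.
pose i : n.-tuple (rat * rat) * nat := ([tuple (q1 j, q2 j) | j < n], k).
have iE j : qc i.1 j = Complex (ratr (q1 j)) (ratr (q2 j)).
  by rewrite /qc /i /= tnth_mktuple.
have inB y : B i y <-> forall j, `|(tnth y j).1 - ratr (q1 j)| <= k.+1%:R^-1 /\
     `|(tnth y j).2 - ratr (q2 j)| <= k.+1%:R^-1.
  split=> [/boxP H j|H]; last apply/boxP => j; have := H j; rewrite iE !ReD !ImD ReN ImN /= => -[];
    rewrite !ler_norml; move: (k.+1%:R^-1 : R) => s => /andP[? ?] /andP[? ?];
    by split; apply/andP; split; lra.
have BO : B i `<=` O.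
  move=> y /inB H; apply: dO.
  apply: (@le_lt_trans _ _ (\sum_(j < n) (8 * e ^+ 2))).
    apply: ler_sum => j _; have [h1 h2] := H j.
    have h3 := le_trans (hq1 j) ke; have h4 := le_trans (hq2 j) ke.
    have {}h1 := le_trans h1 ke; have {}h2 := le_trans h2 ke.
    rewrite /csq /vsub /tz /=.
    move: h1 h2 h3 h4; rewrite !ler_norml => /andP[? ?] /andP[? ?] /andP[? ?] /andP[? ?].
    have A1 : ((tnth y j).1 - (tnth x j).1) ^+ 2 <= (2 * e) ^+ 2.
      by apply: sqr_le_norm; rewrite ler_norml; apply/andP; split; lra.
    have A2 : ((tnth y j).2 - (tnth x j).2) ^+ 2 <= (2 * e) ^+ 2.
      by apply: sqr_le_norm; rewrite ler_norml; apply/andP; split; lra.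
    by rewrite (le_trans (lerD A1 A2)) // exprMn; nra.
  have -> : \sum_(j < n) (8 * e ^+ 2) = 8 * n%:R * d ^+ 2 / (4 * n.+1%:R) ^+ 2.
    by rewrite sumr_const card_ord -[LHS]mulr_natl /e exprMn exprVn; ring.
  rewrite ltr_pdivrMr // [ltRHS]mulrC ltr_pM2r ?exprn_gt0 // exprMn.
  have : (0 : R) <= n%:R by [].
  rewrite -natr1; nra.
exists i => //; rewrite /B'; case: ifPn => [_|/asboolP//].
by apply/inB => j; split; [exact: hq1|exact: hq2].
Qed.

Lemma vnorm_vsub_triangle (z w : V) : vnorm w <= vnorm z + vnorm (vsub w z).
Proof. by rewrite -[X in vnorm X <= _](vadd_sub z w) vnormD. Qed.

Lemma BnRP (x : T) : BnR x <-> vnorm (tz x) < 1.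
Proof. by rewrite nrm2_lt // expr1n. Qed.

Lemma BnP (z : V) : Bn z <-> vnorm z < 1.
Proof. by rewrite nrm2_lt // expr1n. Qed.

Lemma measurable_cont_Bn (g : V -> R) :
  (forall z, Bn z -> forall e, 0 < e -> exists d, 0 < d /\
    forall w, Bn w -> nrm2 (vsub w z) < d ^+ 2 -> `|g w - g z| <= e) ->
  measurable_fun (@BnR R n) (fun x => g (tz x)).
Proof.
move=> Hg; apply: (measurability _ (RGenOInfty.measurableE R)) => _ [_ [c ->] <-].
apply: measurable_open => x [Bx /=]; rewrite in_itv /= andbT => cx.
have e0 : 0 < (g (tz x) - c) / 2 by lra.
have [d [d0 H]] := Hg (tz x) Bx _ e0.
have Bx' : vnorm (tz x) < 1 by apply/BnRP.
exists (Num.min d (1 - vnorm (tz x))); split; first by rewrite lt_min d0; lra.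
have m0 : 0 < Num.min d (1 - vnorm (tz x)) by rewrite lt_min d0; lra.
move=> y; rewrite -nrm2_lt ?(ltW m0) // lt_min => /andP[yd yx].
have By : vnorm (tz y) < 1 by have := vnorm_vsub_triangle (tz x) (tz y); lra.
split; first exact/BnRP.
have : `|g (tz y) - g (tz x)| <= (g (tz x) - c) / 2.
  by apply: H; [exact/BnP|rewrite -nrm2_lt // ltW].
by rewrite /= in_itv /= andbT ler_norml => /andP[? ?]; lra.
Qed.

Lemma measurable_BnR : measurable (@BnR R n).
Proof.
apply: measurable_open => x /BnRP Bx.
exists (1 - vnorm (tz x)); split; first by lra.
move=> y; rewrite -nrm2_lt; last by lra.
by move=> yx; apply/BnRP; have := vnorm_vsub_triangle (tz x) (tz y); lra.
Qed.

End OpenSets.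

(** * Cauchy theory for complex differentiable functions *)

Section IntervalIntegral.
Variable R : realType.
Local Notation mu := (@lebesgue_measure R).
Implicit Types f g : R -> R.

Definition itgl f (a b : R) : R := \int[mu]_(x in `[a, b]) f x.

Definition eps_cont f (x : R) := forall e, 0 < e -> exists d, 0 < d /\
  forall y, `|y - x| < d -> `|f y - f x| <= e.

Definition cont_on f a b := forall x, a <= x <= b -> eps_cont f x.

Lemma cont_on_integrable f a b : cont_on f a b -> mu.-integrable `[a, b] (EFin \o f).
Proof.
move=> cf; apply: continuous_compact_integrable; first exact: segment_compact.
apply: continuous_in_subspaceT => x /[!inE] /=; rewrite in_itv /= => xab.
apply/cvgrPdist_le => e e0; have [d [d0 H]] := cf x xab e e0.
by exists d => //= y /=; rewrite distrC => yx; rewrite distrC; exact: H.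
Qed.

Lemma eps_contD f g x : eps_cont f x -> eps_cont g x -> eps_cont (fun y => f y + g y) x.
Proof.
move=> cf cg e e0; have e2 : 0 < e / 2 by lra.
have [d [d0 H]] := cf _ e2; have [d' [d'0 H']] := cg _ e2.
exists (Num.min d d'); split; first by rewrite lt_min d0.
move=> y; rewrite lt_min => /andP[/H h /H' h']; rewrite opprD addrACA.
by rewrite (le_trans (ler_normD _ _)) // (splitr e) lerD.
Qed.

Lemma eps_contN f x : eps_cont f x -> eps_cont (fun y => - f y) x.
Proof.
move=> cf e e0; have [d [d0 H]] := cf _ e0; exists d; split => // y yx.
by rewrite -opprD normrN; exact: H.
Qed.

Lemma eps_contB f g x : eps_cont f x -> eps_cont g x -> eps_cont (fun y => f y - g y) x.
Proof. by move=> cf cg; apply: eps_contD => //; exact: eps_contN. Qed.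

Lemma itgl_split f a b c : a <= b -> b <= c -> cont_on f a c ->
  itgl f a c = itgl f a b + itgl f b c.
Proof.
move=> ab bc cf; have if_ := cont_on_integrable cf.
rewrite /itgl -(@Rintegral_itv_obnd_cbnd _ b); last first.
  apply: integrableS if_ => //= x /=; rewrite !in_itv /= => /andP[h1 h2].
  by rewrite h2 (le_trans ab) // ltW.
by rewrite -(@Rintegral_itvB _ _ _ _ b if_) ?bnd_simp // addrC subrK.
Qed.

Lemma itglD f g a b : cont_on f a b -> cont_on g a b ->
  itgl (fun x => f x + g x) a b = itgl f a b + itgl g a b.
Proof. by move=> cf cg; rewrite /itgl RintegralD //; exact: cont_on_integrable. Qed.

Lemma itglB f g a b : cont_on f a b -> cont_on g a b ->
  itgl (fun x => f x - g x) a b = itgl f a b - itgl g a b.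
Proof. by move=> cf cg; rewrite /itgl RintegralB //; exact: cont_on_integrable. Qed.

Lemma eps_cont_cst k x : eps_cont (fun=> k) x.
Proof. by move=> e e0; exists 1; split => // y _; rewrite subrr normr0 ltW. Qed.

Lemma itgl_cst k a b : a <= b -> itgl (fun=> k) a b = k * (b - a).
Proof.
move=> ab; rewrite /itgl Rintegral_cst //; congr (k * _).
transitivity (fine (if a < b then (b - a)%:E else 0%E)).
  by congr fine; have := @lebesgue_measure_itv R `[a, b]; rewrite /= lte_fin.
by case: (ltP a b) => //= ba; rewrite (le_anti (introT andP (conj ab ba))) subrr.
Qed.

Lemma itgl_near f k E a b : a <= b -> cont_on f a b ->
  (forall x, a <= x <= b -> `|f x - k| <= E) -> `|itgl f a b - k * (b - a)| <= E * (b - a).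
Proof.
move=> ab cf H.
have cc k' : cont_on (fun=> k') a b by move=> x _; exact: eps_cont_cst.
have ci k' := cont_on_integrable (cc k').
have If := cont_on_integrable cf.
have /andP[h1 h2] : (k - E) * (b - a) <= itgl f a b <= (k + E) * (b - a).
  rewrite -!(itgl_cst _ ab); apply/andP; split; apply: le_Rintegral => //=;
    by [exact: ci|move=> x; rewrite in_itv /= => /H; rewrite ler_norml => /andP[]; lra].
by rewrite ler_norml; apply/andP; split; lra.
Qed.

Lemma le_itgl f g a b : cont_on f a b -> cont_on g a b ->
  (forall x, a <= x <= b -> f x <= g x) -> itgl f a b <= itgl g a b.
Proof.
move=> cf cg fg; have If := cont_on_integrable cf; have Ig := cont_on_integrable cg.
by apply: le_Rintegral => // x /=; rewrite in_itv; exact: fg.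
Qed.

End IntervalIntegral.

(** * Bisection and Goursat's lemma *)

Section Bisection.
Variable R : realType.

Lemma half_expn_small (e : R) : 0 < e -> exists k : nat, 2^-1 ^+ k < e.
Proof.
move=> e0; exists (Num.truncn e^-1).
rewrite exprVn invf_plt ?posrE ?exprn_gt0 //.
apply: lt_le_trans (truncnS_gt _) _; rewrite -natrX ler_nat; exact: ltn_expl.
Qed.

(** [P s t l] concerns the rectangle with corner [(s, t)] and sides [l L], [l M]; the hypothesis
    passes it on to one of the four quarters, selected by two booleans. With [M = 0] the same
    statement bisects an interval. *)
Lemma bisection (L M : R) (P : R -> R -> R -> Prop) s0 t0 : 0 <= L -> 0 <= M -> P s0 t0 1 ->
  (forall s t l, 0 < l -> P s t l -> exists i j : bool,
     P (s + i%:R * (l / 2 * L)) (t + j%:R * (l / 2 * M)) (l / 2)) ->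
  exists s' t', forall k, exists s t, [/\ P s t (2^-1 ^+ k),
    s <= s' <= s + 2^-1 ^+ k * L & t <= t' <= t + 2^-1 ^+ k * M].
Proof.
move=> L0 M0 P0 step.
(* [nxt] is total; where [P] fails its value is arbitrary. *)
have /choice[nxt Hn] : forall x : R * R * R, exists y : R * R, 0 < x.2 -> P x.1.1 x.1.2 x.2 ->
    P y.1 y.2 (x.2 / 2) /\ x.1.1 <= y.1 /\ y.1 + x.2 / 2 * L <= x.1.1 + x.2 * L
     /\ x.1.2 <= y.2 /\ y.2 + x.2 / 2 * M <= x.1.2 + x.2 * M.
  move=> [[s t] l] /=.
  have [[l0 Pl]|] := pselect (0 < l /\ P s t l); last by move=> h; exists (0, 0) => l0 Pl; case: h.
  have [i [j H]] := step s t l l0 Pl.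
  exists (s + i%:R * (l / 2 * L), t + j%:R * (l / 2 * M)) => _ _ /=; split => //.
  by case: i j {H} => -[] /=; rewrite ?mul1r ?mul0r; do !split; nra.
pose h k : R := 2^-1 ^+ k.
have h0 k : 0 < h k by rewrite exprn_gt0 // invr_gt0.
have hS k : h k.+1 = h k / 2 by rewrite /h exprSr.
pose x := fix x k : R * R := if k is k'.+1 then nxt (x k', h k') else (s0, t0).
have Px k : P (x k).1 (x k).2 (h k).
  elim: k => [|k IH] //=; have := Hn (x k, h k) (h0 k) IH.
  by rewrite -/(h k.+1) hS => -[].
have st k := (Hn (x k, h k) (h0 k) (Px k)).2.
(* The lower ends increase and the upper ends decrease, so the supremum of the lower ends lies in
   all the intervals. *)
have nested (y : nat -> R) (N : R) : 0 <= N ->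
    (forall k, y k <= y k.+1) -> (forall k, y k.+1 + h k.+1 * N <= y k + h k * N) ->
    exists y', forall k, y k <= y' <= y k + h k * N.
  move=> N0 yi yd.
  have mono k m : y k <= y (k + m)%N /\ y (k + m)%N + h (k + m)%N * N <= y k + h k * N.
    elim: m => [|m [IH1 IH2]]; first by rewrite addn0.
    by rewrite addnS; split; [exact: le_trans (yi _)|exact: le_trans (yd _) _].
  have ub k m : y m <= y k + h k * N.
    have pos i : 0 <= h i * N by rewrite mulr_ge0 // ltW.
    have [km|mk] := leqP k m.
      have [_] := mono k (m - k)%N; rewrite subnKC //; apply: le_trans.
      by rewrite lerDl.
    have [h1 _] := mono m (k - m)%N; rewrite subnKC in h1; last exact: ltnW.
    by rewrite (le_trans h1) // lerDl.
  have hs : has_sup (range y).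
    by split; [exists (y 0%N), 0%N|exists (y 0%N + h 0%N * N) => _ [m _ <-]; exact: ub].
  exists (sup (range y)) => k; apply/andP; split.
    by apply: ub_le_sup; [case: hs|exists k].
  by apply: ge_sup; [case: hs|move=> _ [m _ <-]; exact: ub].
have [k|k|s' Hs] := nested (fun k => (x k).1) L L0.
- by have [] := st k.
- by have [_ []] := st k; rewrite hS.
have [k|k|t' Ht] := nested (fun k => (x k).2) M M0.
- by have [_ [_ []]] := st k.
- by have [_ [_ [_]]] := st k; rewrite hS.
exists s', t' => k; exists (x k).1, (x k).2; split => //.
Qed.

End Bisection.

Section Goursat.
Variable R : realType.
Implicit Types P Q : R -> R -> R.

Definition diff2 P (s t p c : R) := forall e, 0 < e -> exists d, 0 < d /\
  forall x y, `|x - s| < d -> `|y - t| < d ->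
    `|P x y - P s t - p * (x - s) - c * (y - t)| <= e * (`|x - s| + `|y - t|).

Lemma diff2_cont P s t p c : diff2 P s t p c ->
  eps_cont (P ^~ t) s /\ eps_cont (P s) t.
Proof.
move=> D; have [d [d0 H]] := D 1 ltr01.
have main (w : R) e : 0 < e -> exists r, 0 < r /\ forall z : R, `|z| < r ->
    `|z| < d /\ `|w * z| + `|z| <= e.
  move=> e0; have A0 : 0 < `|w| + 1 by rewrite ltr_wpDl.
  exists (Num.min d (e / (`|w| + 1))); split.
    by rewrite lt_min d0 divr_gt0.
  move=> z; rewrite lt_min => /andP[zd ze]; split => //.
  rewrite normrM -[X in _ + X <= _]mul1r -mulrDl mulrC -ler_pdivlMr //; exact: ltW.
split=> e e0.
- have [r [r0 Hr]] := main p e e0; exists r; split => // x xs.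
  have [xd xe] := Hr _ xs.
  have := H x t xd; rewrite subrr normr0 mulr0 subr0 addr0 mul1r => /(_ d0) h.
  rewrite -[P x t - _](subrK (p * (x - s))); apply: le_trans (ler_normD _ _) _.
  by rewrite addrC (le_trans _ xe) // lerD2l.
- have [r [r0 Hr]] := main c e e0; exists r; split => // y yt.
  have [yd ye] := Hr _ yt.
  have := H s y; rewrite subrr normr0 mulr0 subr0 add0r mul1r => /(_ d0 yd) h.
  rewrite -[P s y - _](subrK (c * (y - t))); apply: le_trans (ler_normD _ _) _.
  by rewrite addrC (le_trans _ ye) // lerD2l.
Qed.

(** The integral of the form [P dx + Q dy] along the boundary of a rectangle, counter-clockwise,
    with opposite sides paired. *)
Definition loop P Q s t L M : R :=
  itgl (fun x => P x t - P x (t + M)) s (s + L) +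
  itgl (fun y => Q (s + L) y - Q s y) t (t + M).

Lemma subitv (a b c d x : R) : a <= c -> d <= b -> c <= x <= d -> a <= x <= b.
Proof. by move=> ac db /andP[cx xd]; rewrite (le_trans ac cx) (le_trans xd db). Qed.

Lemma affine_near (F : R -> R -> R) (a b d e s t s' t' X Y : R) : 0 <= X -> 0 <= Y ->
  s <= s' -> s' <= s + X -> t <= t' -> t' <= t + Y -> X + Y < d -> 0 <= e ->
  (forall x y, `|x - s'| < d -> `|y - t'| < d ->
      `|F x y - F s' t' - a * (x - s') - b * (y - t')| <= e * (`|x - s'| + `|y - t'|)) ->
  forall x y, s <= x <= s + X -> t <= y <= t + Y ->
      `|F x y - F s' t' - a * (x - s') - b * (y - t')| <= e * (X + Y).
Proof.
move=> X0 Y0 h1 h2 h3 h4 XYd e0 H x y /andP[hx1 hx2] /andP[hy1 hy2].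
have nx : `|x - s'| <= X by clear H XYd e0; rewrite ler_norml; apply/andP; split; lra.
have ny : `|y - t'| <= Y by clear H XYd e0; rewrite ler_norml; apply/andP; split; lra.
have nxd : `|x - s'| < d by clear -nx Y0 XYd; lra.
have nyd : `|y - t'| < d by clear -ny X0 XYd; lra.
by apply: (le_trans (H x y nxd nyd)); rewrite ler_wpM2l // lerD.
Qed.

(** Both coefficients are affine up to [E], with the same mixed coefficient [c]. The affine part
    contributes [- c Y X + c X Y = 0], and each pair of opposite sides an error of at most [2 E]
    times its length. *)
Lemma loop_small P Q (s t X Y E p c q s' t' : R) : 0 <= X -> 0 <= Y ->
  (forall x y, s <= x <= s + X -> t <= y <= t + Y -> eps_cont (P ^~ y) x) ->
  (forall x y, s <= x <= s + X -> t <= y <= t + Y -> eps_cont (Q x) y) ->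
  (forall x y, s <= x <= s + X -> t <= y <= t + Y ->
    `|P x y - P s' t' - p * (x - s') - c * (y - t')| <= E) ->
  (forall x y, s <= x <= s + X -> t <= y <= t + Y ->
    `|Q x y - Q s' t' - c * (x - s') - q * (y - t')| <= E) ->
  `|loop P Q s t X Y| <= 2 * E * (X + Y).
Proof.
move=> X0 Y0 cP cQ e1 e2.
have sX : s <= s + X by rewrite lerDl.
have tY : t <= t + Y by rewrite lerDl.
have it1 : t <= t <= t + Y by rewrite lexx.
have it2 : t <= t + Y <= t + Y by rewrite lexx tY.
have is1 : s <= s <= s + X by rewrite lexx.
have is2 : s <= s + X <= s + X by rewrite lexx sX.
have I1 : `|itgl (fun x => P x t - P x (t + Y)) s (s + X) - (- c * Y) * (s + X - s)|
    <= (2 * E) * (s + X - s).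
  apply: itgl_near => // x hx; first by apply: eps_contB; exact: cP.
  have := e1 x t hx it1; have := e1 x _ hx it2; rewrite !ler_norml => /andP[i1 i2] /andP[i3 i4].
  by clear -i1 i2 i3 i4; apply/andP; split; lra.
have I2 : `|itgl (fun y => Q (s + X) y - Q s y) t (t + Y) - (c * X) * (t + Y - t)|
    <= (2 * E) * (t + Y - t).
  apply: itgl_near => // y hy; first by apply: eps_contB; exact: cQ.
  have := e2 _ y is1 hy; have := e2 _ y is2 hy; rewrite !ler_norml => /andP[i1 i2] /andP[i3 i4].
  by clear -i1 i2 i3 i4; apply/andP; split; lra.
rewrite /loop.
have sE : s + X - s = X by ring.
have tE : t + Y - t = Y by ring.
move: I1 I2; rewrite sE tE; set U := itgl _ _ _; set W := itgl _ _ _.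
rewrite !ler_norml => /andP[i1 i2] /andP[i3 i4].
by clear -i1 i2 i3 i4; apply/andP; split; lra.
Qed.

Section rect.
Variables (P Q : R -> R -> R) (s0 t0 L M : R).
Hypotheses (L0 : 0 <= L) (M0 : 0 <= M).
Hypothesis D : forall s t, s0 <= s <= s0 + L -> t0 <= t <= t0 + M ->
  exists p c q, diff2 P s t p c /\ diff2 Q s t c q.

Let contP s t : s0 <= s <= s0 + L -> t0 <= t <= t0 + M -> eps_cont (P ^~ t) s.
Proof. by move=> hs ht; have [p [c [q [/diff2_cont[]]]]] := D hs ht. Qed.
Let contQ s t : s0 <= s <= s0 + L -> t0 <= t <= t0 + M -> eps_cont (Q s) t.
Proof. by move=> hs ht; have [p [c [q [_ /diff2_cont[]]]]] := D hs ht. Qed.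

Let inR s t l := [/\ s0 <= s, s + l * L <= s0 + L, t0 <= t & t + l * M <= t0 + M].

(** The integrals over the inner segments cancel between adjacent quarters. *)
Lemma loop_quarter s t l : 0 < l -> inR s t l ->
  let l' := l / 2 in let L' := l' * L in let M' := l' * M in
  loop P Q s t (l * L) (l * M) =
    (loop P Q s t L' M' + loop P Q (s + L') t L' M') +
    (loop P Q s (t + M') L' M' + loop P Q (s + L') (t + M') L' M').
Proof.
move=> l0 [h1 h2 h3 h4] l' L' M'.
have L'0 : 0 <= L' by rewrite !mulr_ge0 ?invr_ge0 // ltW.
have M'0 : 0 <= M' by rewrite !mulr_ge0 ?invr_ge0 // ltW.
have -> : l * L = L' + L' by rewrite /L' /l'; field.
have -> : l * M = M' + M' by rewrite /M' /l'; field.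
have {}h2 : s + L' + L' <= s0 + L by rewrite /L' /l'; lra.
have {}h4 : t + M' + M' <= t0 + M by rewrite /M' /l'; lra.
have cP a b y z : s <= a -> b <= s + L' + L' -> t <= y <= t + M' + M' -> t <= z <= t + M' + M' ->
    cont_on (fun x => P x y - P x z) a b.
  move=> ha hb hy hz x /andP[hx1 hx2]; apply: eps_contB; apply: contP; apply/andP; split; lra.
have cQ a b y z : t <= a -> b <= t + M' + M' -> s <= y <= s + L' + L' -> s <= z <= s + L' + L' ->
    cont_on (fun x => Q y x - Q z x) a b.
  move=> ha hb hy hz x /andP[hx1 hx2]; apply: eps_contB; apply: contQ; apply/andP; split; lra.
have splitP y z a b : s <= a -> a <= b -> b <= s + L' + L' -> t <= y <= t + M' + M' ->
   t <= z <= t + M' + M' -> forall w, t <= w <= t + M' + M' ->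
   itgl (fun x => P x y - P x z) a b =
   itgl (fun x => P x y - P x w) a b + itgl (fun x => P x w - P x z) a b.
  move=> ha hab hb hy hz w hw; rewrite -itglD; [|exact: cP..].
  by congr itgl; apply/funext => x; rewrite addrA subrK.
have splitQ y z a b : t <= a -> a <= b -> b <= t + M' + M' -> s <= y <= s + L' + L' ->
   s <= z <= s + L' + L' -> forall w, s <= w <= s + L' + L' ->
   itgl (fun x => Q y x - Q z x) a b =
   itgl (fun x => Q y x - Q w x) a b + itgl (fun x => Q w x - Q z x) a b.
  move=> ha hab hb hy hz w hw; rewrite -itglD; [|exact: cQ..].
  by congr itgl; apply/funext => x; rewrite addrA subrK.
rewrite /loop !addrA.
rewrite (itgl_split (b := s + L')); [|lra|lra|by apply: cP; lra].
rewrite (itgl_split (a := t) (c := t + M' + M') (b := t + M')); [|lra|lra|by apply: cQ; lra].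
rewrite (splitP t _ s _ _ _ _ _ _ (t + M')); try lra.
rewrite (splitP t _ (s + L') _ _ _ _ _ _ (t + M')); try lra.
rewrite (splitQ _ s t _ _ _ _ _ _ (s + L')); try lra.
rewrite (splitQ _ s (t + M') _ _ _ _ _ _ (s + L')); try lra.
Qed.

(** The hypothesis [D] says that [P dx + Q dy] is closed at each point, without continuity of the
    partial derivatives. Were the integral nonzero, quarters could be chosen whose integral is at
    least [l^2 A] at scale [l], while differentiability at the limit point makes it of order
    [e l^2]. *)
Theorem goursat : loop P Q s0 t0 L M = 0.
Proof.
apply/eqP/negPn/negP => n0.
pose A := `|loop P Q s0 t0 L M|.
have A0 : 0 < A by rewrite normr_gt0.
pose Pr s t l := inR s t l /\ l ^+ 2 * A <= `|loop P Q s t (l * L) (l * M)|.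
have Pr0 : Pr s0 t0 1 by split; [split; rewrite ?mul1r|rewrite expr1n !mul1r].
have step s t l : 0 < l -> Pr s t l -> exists i j : bool,
     Pr (s + i%:R * (l / 2 * L)) (t + j%:R * (l / 2 * M)) (l / 2).
  move=> l0 [inl big]; have lq := loop_quarter l0 inl.
  apply: contrapT => /forallNP no.
  have small (i j : bool) : `|loop P Q (s + i%:R * (l / 2 * L)) (t + j%:R * (l / 2 * M))
      (l / 2 * L) (l / 2 * M)| < (l / 2) ^+ 2 * A.
    rewrite ltNge; apply/negP => H; apply: (no i); exists j; split => //.
    case: inl => h1 h2 h3 h4.
    have lL : 0 <= l * L by rewrite mulr_ge0 // ltW.
    have lM : 0 <= l * M by rewrite mulr_ge0 // ltW.
    by case: i j {H} => -[]; split; rewrite ?mul1r ?mul0r; lra.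
  have := small false false; have := small true false.
  have := small false true; have := small true true.
  rewrite /= !mul1r !mul0r !addr0 => q1 q2 q3 q4.
  move: big; rewrite lq => big.
  have := le_trans big (ler_normD _ _).
  have := ler_normD (loop P Q s t (l / 2 * L) (l / 2 * M))
     (loop P Q (s + l / 2 * L) t (l / 2 * L) (l / 2 * M)).
  have := ler_normD (loop P Q s (t + l / 2 * M) (l / 2 * L) (l / 2 * M))
     (loop P Q (s + l / 2 * L) (t + l / 2 * M) (l / 2 * L) (l / 2 * M)).
  move: q1 q2 q3 q4; rewrite exprMn; set X := l ^+ 2; set W := 2^-1 ^+ 2.
  have -> : W = 4^-1 :> R by rewrite /W; field.
  by lra.
have [s' [t' near]] := bisection L0 M0 Pr0 step.
have st' : s0 <= s' <= s0 + L /\ t0 <= t' <= t0 + M.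
  have [s [t [[[h1 h2 h3 h4] _] /andP[h5 h6] /andP[h7 h8]]]] := near 0%N.
  by move: h2 h4 h6 h8; rewrite expr0 !mul1r => *; split; apply/andP; split; lra.
have [p [c [q [DP DQ]]]] := D st'.1 st'.2.
pose N := (L + M + 1).
have N0 : 0 < N by rewrite /N; lra.
(* [loop_small] yields the bound [2 e N^2 l^2], and [2 N^2 / (4 N^2 + 1) < 1]. *)
pose e := A / (4 * N ^+ 2 + 1).
have e0 : 0 < e by rewrite divr_gt0 // ltr_pwDr // mulr_ge0 // sqr_ge0.
have [d1 [d10 H1]] := DP _ e0; have [d2 [d20 H2]] := DQ _ e0.
have d0 : 0 < Num.min d1 d2 by rewrite lt_min d10.
have [k kd] := half_expn_small (divr_gt0 d0 N0).
have [s [t [[[h1 h2 h3 h4] big] /andP[h5 h6] /andP[h7 h8]]]] := near k.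
have l0 : 0 < 2^-1 ^+ k :> R by rewrite exprn_gt0 // invr_gt0.
move: kd l0 h2 h4 h6 h8 big; set l := 2^-1 ^+ k => kd l0 h2 h4 h6 h8 big.
have lN : l * N < Num.min d1 d2 by rewrite -ltr_pdivlMr.
have lLM : l * L + l * M <= l * N by rewrite -mulrDr ler_wpM2l ?(ltW l0) // /N; lra.
have lL : 0 <= l * L by rewrite mulr_ge0 // ltW.
have lM : 0 <= l * M by rewrite mulr_ge0 // ltW.
have [ld1 ld2] : l * N < d1 /\ l * N < d2 by move: lN; rewrite lt_min => /andP[].
have e1 := affine_near lL lM h5 h6 h7 h8 (le_lt_trans lLM ld1) (ltW e0) H1.
have e2 := affine_near lL lM h5 h6 h7 h8 (le_lt_trans lLM ld2) (ltW e0) H2.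
have : `|loop P Q s t (l * L) (l * M)| <= 2 * e * (l * N) * (l * N).
  have := loop_small lL lM _ _ e1 e2.
  have -> : forall X, 2 * (e * X) * X = 2 * e * X * X by move=> X; ring.
  move=> /(_ _ _)/le_trans; apply.
  - by move=> x y hx hy; apply: contP; apply: subitv h1 h2 _ || apply: subitv h3 h4 _.
  - by move=> x y hx hy; apply: contQ; apply: subitv h1 h2 _ || apply: subitv h3 h4 _.
  - have e20 : 0 <= 2 * e by rewrite mulr_ge0 // ltW.
    have lLM0 := addr_ge0 lL lM.
    by rewrite -2!(mulrA (2 * e)); apply: ler_wpM2l => //; exact: ler_pM.
move=> /(le_trans big).
rewrite (_ : 2 * e * (l * N) * (l * N) = l ^+ 2 * (2 * e * N ^+ 2)); last by ring.
rewrite ler_pM2l ?exprn_gt0 // /e.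
rewrite leNgt => /negP; apply.
rewrite (_ : 2 * _ * _ = A * (2 * N ^+ 2) / (4 * N ^+ 2 + 1)); last by ring.
have NN : 0 <= N ^+ 2 by rewrite sqr_ge0.
rewrite ltr_pdivrMr; last by lra.
by rewrite ltr_pM2l //; lra.
Qed.

End rect.
End Goursat.

(** * Calculus of first-order expansions *)

Section FirstOrderExpansion.
Variable R : realType.
Local Notation C := (complex R).

(** The expansion [F h = f0 + A h + o(N h)], with a gauge [N] and a map [A] that need not be linear.
    Complex derivatives ([cdiff]) and derivatives on C^n ([fdiff]) are instances, so the rules are
    proved once; products and compositions ask for [A] to be bounded by a multiple of [N]. *)
Definition odiff (H : Type) (N : H -> R) (F : H -> C) (f0 : C) (A : H -> C) :=
  forall e, 0 < e -> exists d, 0 < d /\ forall h, N h < d -> cabs (F h - f0 - A h) <= e * N h.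

Definition cdiff (g : C -> C) (x l : C) :=
  odiff (@cabs R) (fun y => g (x + y)) (g x) (fun y => l * y).

Section Generic.
Variables (H : Type) (N : H -> R).
Hypothesis N0 : forall h, 0 <= N h.
Implicit Types F G A B : H -> C.

Lemma odiff_near F f0 A K : 0 <= K -> (forall h, cabs (A h) <= K * N h) -> odiff N F f0 A ->
  forall e, 0 < e -> exists d, 0 < d /\ forall h, N h < d ->
    cabs (F h - f0 - A h) <= e * N h /\ cabs (F h - f0) <= (K + e) * N h /\ (K + e) * N h <= e.
Proof.
move=> K0 AK D e e0; have [d [d0 Hd]] := D e e0.
have Ke : 0 < K + e by rewrite ltr_wpDl.
exists (Num.min d (e / (K + e))); split; first by rewrite lt_min d0 divr_gt0.
move=> h; rewrite lt_min ltr_pdivlMr // mulrC => /andP[/Hd h1 h2]; split => //.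
split; last exact: ltW.
rewrite -[F h - f0](subrK (A h)); apply: le_trans (cabsD _ _) _.
by rewrite mulrDl [leRHS]addrC lerD.
Qed.

Lemma odiff_ext F F' f0 A A' : F =1 F' -> A =1 A' -> odiff N F f0 A -> odiff N F' f0 A'.
Proof. by move=> FF AA D e /D [d [d0 Hd]]; exists d; split => // h /Hd; rewrite FF AA. Qed.

Lemma odiffD F G f0 g0 A B : odiff N F f0 A -> odiff N G g0 B ->
  odiff N (fun h => F h + G h) (f0 + g0) (fun h => A h + B h).
Proof.
move=> DF DG e e0; have e2 : 0 < e / 2 by rewrite divr_gt0.
have [d [d0 Hd]] := DF _ e2; have [d' [d'0 Hd']] := DG _ e2.
exists (Num.min d d'); split; first by rewrite lt_min d0.
move=> h; rewrite lt_min => /andP[/Hd h1 /Hd' h2].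
rewrite (_ : _ - _ = (F h - f0 - A h) + (G h - g0 - B h)); last by ring.
by rewrite (le_trans (cabsD _ _)) // (splitr e) mulrDl lerD.
Qed.

Lemma odiffZ c F f0 A : odiff N F f0 A -> odiff N (fun h => c * F h) (c * f0) (fun h => c * A h).
Proof.
move=> DF e e0; have c1 : 0 < cabs c + 1 by rewrite ltr_wpDl ?cabs_ge0.
have [d [d0 Hd]] := DF _ (divr_gt0 e0 c1).
exists d; split => // h /Hd h1; rewrite -!mulrBr cabsM.
apply: le_trans (ler_wpM2l (cabs_ge0 _) h1) _.
rewrite mulrA ler_wpM2r // mulrCA ler_piMr ?(ltW e0) //.
by rewrite ler_pdivrMr // mul1r lerDl.
Qed.

Lemma odiff_cst c : odiff N (fun=> c) c (fun=> 0).
Proof. by move=> e e0; exists 1; split => // h _; rewrite subrr subr0 cabs0 mulr_ge0 // ltW. Qed.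

Lemma odiffM F G f0 g0 A B K : 0 <= K ->
  (forall h, cabs (A h) <= K * N h) -> (forall h, cabs (B h) <= K * N h) ->
  odiff N F f0 A -> odiff N G g0 B ->
  odiff N (fun h => F h * G h) (f0 * g0) (fun h => A h * g0 + f0 * B h).
Proof.
move=> K0 AK BK DF DG e e0.
(* [m - 1] is the sum of the coefficients of the three error terms below; capping [e'] by 1 gives
   [K + e' <= K + 1]. *)
pose m := cabs f0 + cabs g0 + (K + 1) + 1.
have m1 : 1 <= m by rewrite /m; have := cabs_ge0 f0; have := cabs_ge0 g0; lra.
have m0 : 0 < m by lra.
pose e' := Num.min 1 (e / m).
have e'0 : 0 < e' by rewrite lt_min ltr01 divr_gt0.
have [d [d0 Hd]] := odiff_near K0 AK DF e'0; have [d' [d'0 Hd']] := odiff_near K0 BK DG e'0.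
exists (Num.min d d'); split; first by rewrite lt_min d0.
move=> h; rewrite lt_min => /andP[/Hd [a1 [a2 a3]] /Hd' [b1 [b2 b3]]].
rewrite (_ : _ - _ = (F h - f0 - A h) * g0 + (F h - f0) * (G h - g0) + f0 * (G h - g0 - B h));
  last by ring.
apply: le_trans (cabsD _ _) _; apply: le_trans (lerD (cabsD _ _) (lexx _)) _; rewrite !cabsM.
have e'1 : e' <= 1 by rewrite ge_min lexx.
have e'm : e' * m <= e by rewrite -ler_pdivlMr // ge_min lexx orbT.
have c1 : cabs (F h - f0 - A h) * cabs g0 <= e' * N h * cabs g0 by rewrite ler_wpM2r ?cabs_ge0.
have c3 : cabs f0 * cabs (G h - g0 - B h) <= cabs f0 * (e' * N h) by rewrite ler_wpM2l ?cabs_ge0.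
have c2 : cabs (F h - f0) * cabs (G h - g0) <= e' * ((K + 1) * N h).
  apply: ler_pM; rewrite ?cabs_ge0 //; first exact: le_trans a2 a3.
  by rewrite (le_trans b2) // ler_wpM2r // lerD2l.
apply: le_trans (lerD (lerD c1 c2) c3) _.
rewrite (_ : _ + _ = e' * (m - 1) * N h); last by rewrite /m; ring.
rewrite ler_wpM2r // (le_trans _ e'm) // ler_wpM2l ?(ltW e'0) //; lra.
Qed.

Lemma odiff_chain (phi : C -> C) l F f0 A K : 0 <= K -> (forall h, cabs (A h) <= K * N h) ->
  odiff N F f0 A -> cdiff phi f0 l ->
  odiff N (fun h => phi (F h)) (phi f0) (fun h => l * A h).
Proof.
move=> K0 AK DF Dphi e e0.
pose m := cabs l + (K + 1) + 1.
have m1 : 1 <= m by rewrite /m; have := cabs_ge0 l; lra.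
have m0 : 0 < m by lra.
have em0 : 0 < e / m by rewrite divr_gt0.
have [r [r0 Hr]] := Dphi _ em0.
pose e' := Num.min 1 (Num.min (e / m) (r / 2)).
have e'0 : 0 < e' by rewrite !lt_min ltr01 em0 divr_gt0.
have [d [d0 Hd]] := odiff_near K0 AK DF e'0.
exists d; split => // h /Hd [a1 [a2 a3]].
have e'1 : e' <= 1 by rewrite ge_min lexx.
have e'm : e' <= e / m by rewrite /e' !ge_min lexx orbT.
have e'r : e' < r.
  by apply: (@le_lt_trans _ _ (r / 2)); [rewrite /e' !ge_min lexx !orbT|rewrite ltr_pdivrMr //; lra].
have := Hr (F h - f0) (le_lt_trans (le_trans a2 a3) e'r).
rewrite (_ : f0 + (F h - f0) = F h) => [b1|]; last by rewrite addrC subrK.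
rewrite (_ : _ - _ = (phi (F h) - phi f0 - l * (F h - f0)) + l * (F h - f0 - A h)); last by ring.
apply: le_trans (cabsD _ _) _; rewrite cabsM.
have c2 : cabs l * cabs (F h - f0 - A h) <= cabs l * (e / m * N h).
  by rewrite ler_wpM2l ?cabs_ge0 // (le_trans a1) // ler_wpM2r.
have c1 : e / m * cabs (F h - f0) <= e / m * ((K + 1) * N h).
  rewrite ler_wpM2l ?(ltW em0) // (le_trans a2) // ler_wpM2r // lerD2l //.
apply: le_trans (lerD (le_trans b1 c1) c2) _.
rewrite (_ : _ + _ = e / m * (m - 1) * N h); last by rewrite /m; ring.
rewrite ler_wpM2r // -mulrA ler_piMr ?(ltW e0) // mulrC ler_pdivrMr // mul1r; lra.
Qed.

End Generic.

Lemma odiff_reparam (H H' : Type) (N : H -> R) (N' : H' -> R) (m : H' -> H) F f0 A K :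
  (forall h, 0 <= N' h) -> 0 < K -> (forall h, N (m h) <= K * N' h) ->
  odiff N F f0 A -> odiff N' (F \o m) f0 (A \o m).
Proof.
move=> N'0 K0 mK D e e0; have [d [d0 Hd]] := D _ (divr_gt0 e0 K0).
exists (d / K); split; first by rewrite divr_gt0.
move=> h; rewrite ltr_pdivlMr // mulrC => hd.
apply: le_trans (Hd _ (le_lt_trans (mK h) hd)) _.
by rewrite -mulrA ler_wpM2l ?(ltW e0) // mulrC ler_pdivrMr // mulrC.
Qed.

Lemma cdiff_lin_bound (l y : C) : cabs (l * y) <= cabs l * cabs y.
Proof. by rewrite cabsM. Qed.

Lemma cdiff_comp (f g : C -> C) x l m : cdiff g x l -> cdiff f (g x) m ->
  cdiff (f \o g) x (m * l).
Proof.
move=> Dg Df.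
have := odiff_chain (@cabs_ge0 R) (cabs_ge0 l) (cdiff_lin_bound l) Dg Df.
by apply: odiff_ext => // y; rewrite mulrA.
Qed.

Lemma cdiffM (f g : C -> C) x l m : cdiff f x l -> cdiff g x m ->
  cdiff (fun y => f y * g y) x (l * g x + f x * m).
Proof.
move=> Df Dg.
have K0 : 0 <= cabs l + cabs m by rewrite addr_ge0 ?cabs_ge0.
have bl y : cabs (l * y) <= (cabs l + cabs m) * cabs y.
  by rewrite cabsM ler_wpM2r ?cabs_ge0 // lerDl cabs_ge0.
have bm y : cabs (m * y) <= (cabs l + cabs m) * cabs y.
  by rewrite cabsM ler_wpM2r ?cabs_ge0 // lerDr cabs_ge0.
apply: (odiff_ext (fun=> erefl) _ (odiffM (@cabs_ge0 R) K0 bl bm Df Dg)) => y.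
by ring.
Qed.

Lemma cdiffD (f g : C -> C) x l m : cdiff f x l -> cdiff g x m ->
  cdiff (fun y => f y + g y) x (l + m).
Proof. by move=> Df Dg; apply: odiff_ext (odiffD Df Dg) => // y; rewrite mulrDl. Qed.

Lemma cdiff_cst c x : cdiff (fun=> c) x 0.
Proof. by apply: odiff_ext (odiff_cst (@cabs_ge0 R) c) => // y; rewrite mul0r. Qed.

Lemma cdiff_affine c b x : cdiff (fun y => c * y + b) x c.
Proof.
move=> e e0; exists 1; split => // y _.
rewrite (_ : _ - _ = 0) ?cabs0 ?mulr_ge0 ?cabs_ge0 ?(ltW e0) //; by ring.
Qed.

(* (x + y)^-1 - x^-1 + y / x^2 = y^2 / (x^2 (x + y)) *)
Lemma cdiff_inv x : x != 0 -> cdiff (fun y => y^-1) x (- (x ^+ 2)^-1).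
Proof.
move=> x0 e e0.
have X0 : 0 < cabs x by rewrite cabs_gt0.
pose B := e * cabs x ^+ 3 / 2.
have B0 : 0 < B by rewrite divr_gt0 // mulr_gt0 // exprn_gt0.
exists (Num.min (cabs x / 2) B); split; first by rewrite lt_min divr_gt0.
move=> y; rewrite lt_min => /andP[y1 y2].
have xy : cabs x / 2 <= cabs (x + y).
  have := cabsB (x + y) y; rewrite addrK; lra.
have xy0 : x + y != 0 by rewrite -cabs_gt0 (lt_le_trans _ xy) // divr_gt0.
rewrite (_ : _ - _ = y * y * (x ^+ 2)^-1 * (x + y)^-1); last by field; rewrite x0 xy0.
have Z0 : 0 < cabs (x + y) by rewrite cabs_gt0.
have key : cabs y <= e * (cabs x ^+ 2 * cabs (x + y)).
  apply: le_trans (ltW y2) _.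
  rewrite /B (_ : _ / 2 = e * (cabs x ^+ 2 * (cabs x / 2))); last by field.
  by rewrite ler_wpM2l ?(ltW e0) // ler_wpM2l // sqr_ge0.
rewrite !cabsM !cabsV expr2 cabsM.
rewrite (_ : _ / _ / _ = cabs y * (cabs y / (cabs x ^+ 2 * cabs (x + y)))); last first.
  by field; rewrite !gt_eqF.
by rewrite [leRHS]mulrC ler_wpM2l ?cabs_ge0 // ler_pdivrMr // mulr_gt0 // exprn_gt0.
Qed.

Lemma cos_near (b : R) : 1 - cos b <= b ^+ 2 / 2.
Proof.
have sin_norm (x : R) : 0 <= x -> `|sin x| <= x.
  move=> x0.
  have [|c _ /=] := @MVT_segment R sin cos 0 x x0.
    by apply: continuous_subspaceT => y; exact: continuous_sin.
  rewrite sin0 !subr0 => ->; rewrite normrM (ger0_norm x0) ler_piMl //; exact: cos_max.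
have sin_sq (x : R) : sin x ^+ 2 <= x ^+ 2.
  wlog x0 : x / 0 <= x => [W|].
    have [|/ltW x0] := leP 0 x; first exact: W.
    by rewrite -[X in X <= _]sqrrN -[leRHS]sqrrN -sinN; apply: W; rewrite oppr_ge0.
  by apply: sqr_le_norm; exact: sin_norm.
have -> : b = (b / 2) *+ 2 by rewrite mulr2n -splitr.
move: (b / 2) => h; rewrite cos_mulr2n; have := sin_sq h; have := cos2Dsin2 h.
by rewrite -!(mulr_natl (_ ^+ 2)) -(mulr_natl h); move: (sin h) (cos h) => s c h1 h2; nra.
Qed.

Lemma sin_near (b : R) : `|b| <= 1 -> `|sin b - b| <= b ^+ 2.
Proof.
wlog b0 : b / 0 <= b => [W|].
  have [|/ltW x0] := leP 0 b; first exact: W.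
  move=> b1; have := W (- b); rewrite oppr_ge0 normrN sinN sqrrN opprK.
  by rewrite (addrC (- sin b)) distrC; apply.
rewrite ger0_norm // => b1.
have [|c] := @MVT_segment R sin cos 0 b b0.
  by apply: continuous_subspaceT => y; exact: continuous_sin.
rewrite in_itv /= sin0 !subr0 => /andP[c0 cb] ->.
rewrite (_ : _ - b = - (b * (1 - cos c))); last by ring.
rewrite normrN normrM (ger0_norm b0) ger0_norm ?subr_ge0 ?cos_le1 //.
have := cos_near c; have : c ^+ 2 <= b ^+ 2 by rewrite ler_pXn2r ?nnegrE.
nra.
Qed.

(** Both bounds come from [1 + x <= expR x]: at [a] it makes the remainder nonnegative, and at
    [- a], since [expR a * expR (- a) = 1], it gives [expR a (1 - a) <= 1]. *)
Lemma expR_near (a : R) : `|a| <= 2^-1 -> `|expR a - 1 - a| <= 2 * a ^+ 2 /\ expR a <= 2.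
Proof.
rewrite ler_norml => /andP[a1 a2].
have h1 := expR_ge1Dx a; have h2 := expR_ge1Dx (- a).
have h3 := expRxMexpNx_1 a; have h4 := expR_gt0 a.
split; last by nra.
rewrite ger0_norm; last by lra.
nra.
Qed.

(** The real and imaginary parts of the remainder are at most [2 a^2 + b^2] and [3 a^2 + 4 b^2];
    their sum gives the constant 5. *)
Lemma cexp_near (y : C) : cabs y <= 2^-1 -> cabs (cexp y - 1 - y) <= 5 * cabs y ^+ 2.
Proof.
move=> y2; have a2 := le_trans (normRe_le y) y2; have b2 := le_trans (normIm_le y) y2.
rewrite sqr_cabs; apply: le_trans (cabs_le_ReIm _) _.
case: y y2 a2 b2 => a b /= _ a2 b2; rewrite /csq /=.
have [E1 E2] := expR_near a2; have E0 := expR_gt0 a.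
have b1 : `|b| <= 1 by apply: le_trans b2 _; lra.
have C1 := cos_near b; have C2 := cos_le1 b; have S1 := sin_near b1.
have r1 : `|expR a * cos b - 1 - a| <= 2 * a ^+ 2 + b ^+ 2.
  rewrite (_ : _ - a = (expR a - 1 - a) - expR a * (1 - cos b)); last by ring.
  apply: le_trans (ler_normB _ _) _; rewrite lerD // normrM (ger0_norm (ltW E0)).
  rewrite ger0_norm ?subr_ge0 //; nra.
have r2 : `|expR a * sin b - 0 - b| <= 3 * a ^+ 2 + 4 * b ^+ 2.
  rewrite (_ : _ - b = expR a * (sin b - b) + ((expR a - 1 - a) * b + a * b)); last by ring.
  apply: le_trans (ler_normD _ _) _; rewrite normrM (ger0_norm (ltW E0)).
  have i1 : expR a * `|sin b - b| <= 2 * b ^+ 2 by rewrite ler_pM // ltW.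
  have i2 : `|(expR a - 1 - a) * b + a * b| <= 2 * a ^+ 2 + (a ^+ 2 + b ^+ 2).
    apply: le_trans (ler_normD _ _) _; rewrite !normrM lerD //.
      by rewrite -[leRHS]mulr1 ler_pM.
    rewrite -[a ^+ 2]real_normK ?num_real // -[b ^+ 2]real_normK ?num_real //.
    have := sqr_ge0 (`|a| - `|b|); have := normr_ge0 a; have := normr_ge0 b; nra.
  by apply: le_trans (lerD i1 i2) _; lra.
by apply: le_trans (lerD r1 r2) _; lra.
Qed.

Lemma cexpD (x y : C) : cexp (x + y) = cexp x * cexp y.
Proof.
by apply: complex_eq; rewrite /cexp ?ReM ?ImM ReD ImD /= expRD ?cosD ?sinD; ring.
Qed.

Lemma cabs_cexp (x : C) : cabs (cexp x) = expR (complex.Re x).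
Proof.
rewrite /cabs /csq /= !exprMn -mulrDr cos2Dsin2 mulr1 sqrtr_sqr ger0_norm //.
Qed.

Lemma cdiff_exp x : cdiff (@cexp R) x (cexp x).
Proof.
move=> e e0; pose m := cabs (cexp x) * 5 + 1.
have m0 : 0 < m by rewrite ltr_wpDl // mulr_ge0 ?cabs_ge0.
exists (Num.min 2^-1 (e / m)); split; first by rewrite lt_min invr_gt0 ltr0n divr_gt0.
move=> y; rewrite lt_min => /andP[y2 ym].
rewrite cexpD (_ : _ - _ = cexp x * (cexp y - 1 - y)); last by ring.
rewrite cabsM; apply: le_trans (ler_wpM2l (cabs_ge0 _) (cexp_near (ltW y2))) _.
rewrite expr2 !mulrA ler_wpM2r ?cabs_ge0 //.
move: ym; rewrite ltr_pdivlMr // => ym.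
by apply: le_trans (ltW ym); rewrite mulrC ler_wpM2l ?cabs_ge0 // lerDl.
Qed.

End FirstOrderExpansion.

(** * Mean values over circles *)

Section CircleMean.
Variable R : realType.
Local Notation C := (complex R).

Definition cis (t : R) : C := Complex (cos t) (sin t).

Lemma cabs_cis t : cabs (cis t) = 1.
Proof. by rewrite /cabs /csq /= cos2Dsin2 sqrtr1. Qed.

Lemma cis_cexp t : cis t = cexp (Complex 0 t).
Proof. by rewrite /cis /cexp /= expR0 !mul1r. Qed.

(** The Cauchy-Riemann equations: multiplication by [a + i b] acts on the plane by the matrix with
    rows [(a, - b)] and [(b, a)]. *)
Lemma cdiff_diff2 (g : C -> C) s t a b : cdiff g (Complex s t) (Complex a b) ->
  diff2 (fun x y => complex.Re (g (Complex x y))) s t a (- b) /\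
  diff2 (fun x y => complex.Im (g (Complex x y))) s t b a.
Proof.
move=> D.
have main e : 0 < e -> exists d, 0 < d /\ forall x y, `|x - s| < d -> `|y - t| < d ->
    cabs (g (Complex x y) - g (Complex s t) - Complex a b * Complex (x - s) (y - t)) <=
      e * (`|x - s| + `|y - t|).
  move=> e0; have [d [d0 Hd]] := D e e0; exists (d / 2); split; first by rewrite divr_gt0.
  move=> x y xs yt; have le : cabs (Complex (x - s) (y - t)) <= `|x - s| + `|y - t|.
    exact: cabs_le_ReIm.
  have lt : cabs (Complex (x - s) (y - t)) < d by lra.
  have := Hd _ lt.
  have -> : Complex s t + Complex (x - s) (y - t) = Complex x y.
    by apply: complex_eq; rewrite ?ReD ?ImD /=; ring.
  by move=> h; apply: le_trans h _; rewrite ler_wpM2l ?(ltW e0).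
split=> e e0; have [d [d0 Hd]] := main e e0; exists d; split => // x y hx hy;
  apply: le_trans (Hd x y hx hy).
  apply: le_trans (normRe_le _); rewrite !ReD !ReN ReM /= le_eqVlt; apply/orP; left.
  by apply/eqP; congr (`|_|); ring.
apply: le_trans (normIm_le _); rewrite !ImD !ImN ImM /= le_eqVlt; apply/orP; left.
by apply/eqP; congr (`|_|); ring.
Qed.

Variables (q : C -> C) (l : C).
Hypothesis qd : forall z, 0 < cabs z <= 1 -> exists w, cdiff q z w.
Hypothesis ql : forall e, 0 < e -> exists d, 0 < d /\
  forall z, 0 < cabs z < d -> cabs (q z - l) <= e.

(** In the coordinate [log z] the punctured disc becomes a half-plane and circles become vertical
    segments of length [2 pi], so that Goursat's lemma on rectangles applies. *)
Let F (x t : R) : C := q (cexp (Complex x t)).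

Let Fd x t : x <= 0 -> exists a b, cdiff (fun z => q (cexp z)) (Complex x t) (Complex a b).
Proof.
move=> x0; have [|w Hw] := qd (z := cexp (Complex x t)).
  by rewrite cabs_cexp /= expR_gt0 expR_le1.
have := cdiff_comp (cdiff_exp (Complex x t)) Hw.
by case: (w * _) => a b D; exists a, b.
Qed.

Let Fper x : F x (pi *+ 2) = F x 0.
Proof. by rewrite /F; congr q; rewrite /cexp /= cos2pi sin2pi cos0 sin0. Qed.

(** On the rectangle between the abscissas [x] and 0 the horizontal sides cancel by periodicity, so
    the integrals of [U] over the vertical sides agree. *)
Let circle_const (U P : R -> R -> R) (x : R) : x <= 0 ->
  (forall s t, s <= 0 -> exists p c r, diff2 P s t p c /\ diff2 U s t c r) ->
  (forall s, P s (pi *+ 2) = P s 0) ->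
  itgl (U 0) 0 (pi *+ 2) = itgl (U x) 0 (pi *+ 2).
Proof.
move=> x0 D per; have pi0 : 0 <= pi *+ 2 :> R by rewrite mulrn_wge0 // pi_ge0.
have L0 : 0 <= - x by rewrite oppr_ge0.
have cU s t : s <= 0 -> eps_cont (U s) t.
  by move=> s0; have [p [c [r [_ /diff2_cont[]]]]] := D s t s0.
have : loop P U x 0 (- x) (pi *+ 2) = 0.
  by apply: goursat => // s t /andP[_ +] _; rewrite subrr; exact: D.
rewrite /loop subrr add0r.
have -> : (fun y => P y 0 - P y (pi *+ 2)) = fun=> 0.
  by apply/funext => y; rewrite per subrr.
rewrite itgl_cst ?mul0r ?add0r // itglB; [|by move=> t _; apply: cU..].
by move=> /eqP; rewrite subr_eq0 => /eqP.
Qed.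

(** The circle integral does not depend on the radius, and on small circles [q] is close to [l].
    Asking only for a limit at 0 admits difference quotients as [q]. *)
Lemma circle_mean :
  itgl (fun t => complex.Re (q (cis t))) 0 (pi *+ 2) = complex.Re l * (pi *+ 2) /\
  itgl (fun t => complex.Im (q (cis t))) 0 (pi *+ 2) = complex.Im l * (pi *+ 2).
Proof.
have pi0 : 0 < pi *+ 2 :> R by rewrite mulrn_wgt0 // pi_gt0.
have small e : 0 < e -> exists2 x : R, x <= 0 & forall t, cabs (F x t - l) <= e.
  move=> e0; have [d [d0 Hd]] := ql e0.
  have [x xd] : exists x, expR x = Num.min (d / 2) 1.
    by apply: expR_total; rewrite lt_min divr_gt0 //= ltr01.
  exists x; first by rewrite -expR_le1 xd ge_min lexx orbT.
  move=> t; apply: Hd; rewrite cabs_cexp /= expR_gt0 xd /=.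
  by apply: (@le_lt_trans _ _ (d / 2)); [rewrite ge_min lexx|rewrite ltr_pdivrMr //; lra].
(* Applied to [Im F dx + Re F dy] and [- Re F dx + Im F dy], up to sign the two real components of
   [F dz], which are closed by the Cauchy-Riemann equations. *)
have main (U P : R -> R -> R) k :
  (forall s t, s <= 0 -> exists p c r, diff2 P s t p c /\ diff2 U s t c r) ->
  (forall s, P s (pi *+ 2) = P s 0) ->
  (forall s t, `|U s t - k| <= cabs (F s t - l)) ->
  itgl (U 0) 0 (pi *+ 2) = k * (pi *+ 2).
  move=> D per Uk; apply/eqP; rewrite -subr_eq0 -normr_eq0 eq_le normr_ge0 andbT.
  apply/ler_addgt0Pr => e e0; rewrite add0r.
  have [x x0 Hx] := small _ (divr_gt0 e0 pi0).
  rewrite (circle_const x0 D per).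
  have cU t : eps_cont (U x) t.
    by have [p [c [r [_ /diff2_cont[]]]]] := D x t x0.
  have := @itgl_near R (U x) k (e / (pi *+ 2)) 0 (pi *+ 2) (ltW pi0).
  rewrite subr0 divfK ?gt_eqF //; apply => // t _; exact: le_trans (Uk _ _) (Hx _).
have diff2N (P : R -> R -> R) s t p c : diff2 P s t p c ->
    diff2 (fun x y => - P x y) s t (- p) (- c).
  move=> D e /D[d [d0 Hd]]; exists d; split => // x y hx hy.
  apply: le_trans (Hd x y hx hy); rewrite -normrN le_eqVlt; apply/orP; left.
  by apply/eqP; congr (`|_|); ring.
split.
- have -> : (fun t => complex.Re (q (cis t))) = (fun s t => complex.Re (F s t)) 0.
    by apply/funext => t; rewrite cis_cexp.
  apply: (main (fun s t => complex.Re (F s t)) (fun s t => complex.Im (F s t))) => [s t s0|s|s t].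
  + have [a [b /cdiff_diff2[D1 D2]]] := Fd t s0.
    by exists b, a, (- b).
  + by rewrite Fper.
  + by rewrite -ReN -ReD normRe_le.
- have -> : (fun t => complex.Im (q (cis t))) = (fun s t => complex.Im (F s t)) 0.
    by apply/funext => t; rewrite cis_cexp.
  apply: (main (fun s t => complex.Im (F s t)) (fun s t => - complex.Re (F s t))) => [s t s0|s|s t].
  + have [a [b /cdiff_diff2[D1 D2]]] := Fd t s0.
    exists (- a), b, a; split => //.
    by rewrite -[X in diff2 _ _ _ _ X]opprK; exact: diff2N.
  + by rewrite Fper.
  + by rewrite -ImN -ImD normIm_le.
Qed.

End CircleMean.

(** * Mean value inequalities *)

Section RealMeanValue.
Variable R : realType.

(** If the increment exceeds [B] by [2 eta], bisection gives intervals of length [l] shrinking to a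
    point, on which the increment exceeds [l (B + eta)]; this contradicts a derivative at most [B]
    at that point. *)
Lemma mean_value_le (f : R -> R) (B : R) :
  (forall t, 0 <= t <= 1 -> exists2 a, a <= B & forall e, 0 < e -> exists d, 0 < d /\
     forall y, `|y - t| < d -> `|f y - f t - a * (y - t)| <= e * `|y - t|) ->
  f 1 - f 0 <= B.
Proof.
move=> D; rewrite leNgt; apply/negP => big.
pose eta := (f 1 - f 0 - B) / 2.
have eta0 : 0 < eta by rewrite /eta; lra.
pose P (s t l : R) := [/\ 0 <= s, s + l <= 1 & l * (B + eta) < f (s + l) - f s].
have P0 : P 0 0 1 by split; rewrite ?add0r // mul1r /eta; lra.
have step s t l : 0 < l -> P s t l -> exists i j : bool,
    P (s + i%:R * (l / 2 * 1)) (t + j%:R * (l / 2 * 0)) (l / 2).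
  move=> l0 [s0 s1 bg].
  have [h|h] := ltP (l / 2 * (B + eta)) (f (s + l / 2) - f s).
    by exists false, false; rewrite mul0r addr0; split => //; lra.
  have E : s + l / 2 + l / 2 = s + l by lra.
  exists true, false; rewrite mul1r mulr1; split; [lra|lra|rewrite E; lra].
have [s' [t' near]] := bisection ler01 (lexx 0) P0 step.
have s'1 : 0 <= s' <= 1.
  have [s [t [[h1 h2 _] /andP[h3 h4] _]]] := near 0%N.
  by move: h2 h4; rewrite expr0 mul1r => h2 h4; apply/andP; split; lra.
have [a aB Da] := D s' s'1.
have eta4 : 0 < eta / 4 by lra.
have [d [d0 Hd]] := Da _ eta4.
have [k kd] := half_expn_small d0.
have [s [t [[h1 h2 bg] /andP[h3 h4] _]]] := near k.
have l0 : 0 < 2^-1 ^+ k :> R by rewrite exprn_gt0 // invr_gt0.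
move: kd l0 h2 h4 bg; set l := 2^-1 ^+ k => kd l0 h2 h4 bg.
rewrite mulr1 in h4.
have n1 : `|s - s'| <= l by rewrite ler_norml; apply/andP; split; lra.
have n2 : `|s + l - s'| <= l by rewrite ler_norml; apply/andP; split; lra.
have := Hd s (le_lt_trans n1 kd); have := Hd (s + l) (le_lt_trans n2 kd).
move=> /le_trans /(_ (ler_wpM2l (ltW eta4) n2)) q2 /le_trans /(_ (ler_wpM2l (ltW eta4) n1)) q1.
have al : a * l <= B * l by rewrite ler_wpM2r // ltW.
have el : 0 < eta * l by rewrite mulr_gt0.
move: q1 q2; rewrite !ler_norml => /andP[a1 a2] /andP[b1 b2].
clear -al a1 a2 b1 b2 bg el; nra.
Qed.

End RealMeanValue.

Section SegmentBound.
Variable R : realType.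
Local Notation C := (complex R).

(** The real mean value inequality is applied to the real and to the imaginary part, which accounts
    for the factor 2. *)
Lemma segment_bound (g : C -> C) (B : R) :
  (forall t, 0 <= t <= 1 -> exists2 l, cabs l <= B & cdiff g (Complex t 0) l) ->
  cabs (g 1 - g 0) <= 2 * B.
Proof.
move=> D.
have key (p : C -> R) : (forall x y, p (x - y) = p x - p y) -> (forall x, `|p x| <= cabs x) ->
    (forall (x : R) y, p (Complex x 0 * y) = x * p y) -> `|p (g 1 - g 0)| <= B.
  move=> pB ple pZ; have p0 : p 0 = 0 by rewrite -(subrr 0) pB subrr.
  have half (c : R) : `|c| = 1 -> c * p (g 1 - g 0) <= B.
    move=> c1; rewrite pB mulrBr.
    apply: (@mean_value_le R (fun t => c * p (g (Complex t 0))) B) => t ht.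
    have [l lB Dl] := D t ht.
    exists (c * p l).
      by apply: le_trans (ler_norm _) _; rewrite normrM c1 mul1r (le_trans (ple _)).
    move=> e e0; have [d [d0 Hd]] := Dl e e0; exists d; split => // y yd.
    have := Hd (Complex (y - t) 0); rewrite cabs_real => /(_ yd).
    have -> : Complex t 0 + Complex (y - t) 0 = Complex y 0.
      by apply: complex_eq; rewrite ?ReD ?ImD /=; ring.
    apply: le_trans.
    rewrite (_ : _ - c * p l * (y - t) =
      c * p (g (Complex y 0) - g (Complex t 0) - l * Complex (y - t) 0)); last first.
      by rewrite !pB [l * _]mulrC pZ; ring.
    by rewrite normrM c1 mul1r ple.
  rewrite ler_norml lerNl; apply/andP; split.
    by have := half (-1); rewrite normrN1 mulN1r; apply.
  by have := half 1; rewrite normr1 mul1r; apply.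
apply: le_trans (cabs_le_ReIm _) _; rewrite mulr_natl mulr2n; apply: lerD.
  apply: (key (@complex.Re R)) => [x y|x|x y]; first by rewrite ReD ReN.
    exact: normRe_le.
  by rewrite ReM /= mul0r subr0.
apply: (key (@complex.Im R)) => [x y|x|x y]; first by rewrite ImD ImN.
  exact: normIm_le.
by rewrite ImM /= mul0r addr0.
Qed.

Lemma circle_mean_bound (q : C -> C) (l : C) (M : R) :
  (forall z, 0 < cabs z <= 1 -> exists w, cdiff q z w) ->
  (forall e, 0 < e -> exists d, 0 < d /\ forall z, 0 < cabs z < d -> cabs (q z - l) <= e) ->
  (forall t, cabs (q (cis t)) <= M) -> cabs l <= 2 * M.
Proof.
move=> qd ql qM; have pi0 : 0 < pi *+ 2 :> R by rewrite mulrn_wgt0 // pi_gt0.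
have [m1 m2] := circle_mean qd ql.
have cq t : exists2 w, cdiff q (cis t) w & True.
  by have [|w] := qd (cis t); [rewrite cabs_cis ltr01 lexx|exists w].
have cc t : eps_cont (fun t => complex.Re (q (cis t))) t /\
   eps_cont (fun t => complex.Im (q (cis t))) t.
  have [w Dw _] := cq t; rewrite cis_cexp in Dw.
  have := cdiff_comp (cdiff_exp (Complex 0 t)) Dw; case: (w * _) => a b /cdiff_diff2[].
  move=> /diff2_cont[_ c1] /diff2_cont[_ c2].
  by split => e e0; [have [d [d0 H]] := c1 e e0|have [d [d0 H]] := c2 e e0];
    exists d; split => // y /H; rewrite /= !cis_cexp.
have key (f : R -> R) k : (forall t, eps_cont f t) -> (forall t, `|f t| <= M) ->
    itgl f 0 (pi *+ 2) = k * (pi *+ 2) -> `|k| <= M.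
  move=> cf fM E; have := @itgl_near R f 0 M 0 (pi *+ 2) (ltW pi0) (fun t _ => cf t).
  rewrite E mul0r !subr0 => /(_ _)H.
  have : `|k * (pi *+ 2)| <= M * (pi *+ 2) by apply: H => t _; rewrite subr0.
  by rewrite normrM (gtr0_norm pi0) ler_pM2r.
apply: le_trans (cabs_le_ReIm _) _; rewrite mulr_natl mulr2n; apply: lerD.
  by apply: key m1 => t; [case: (cc t)|exact: le_trans (normRe_le _) (qM t)].
by apply: key m2 => t; [case: (cc t)|exact: le_trans (normIm_le _) (qM t)].
Qed.

End SegmentBound.

Section CauchySequences.
Variable R : realType.

Lemma real_cauchy (x : nat -> R) :
  (forall e, 0 < e -> exists N, forall m k, (N <= m)%N -> (N <= k)%N -> `|x m - x k| <= e) ->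
  exists l, forall e, 0 < e -> exists N, forall m, (N <= m)%N -> `|x m - l| <= e.
Proof.
move=> H.
have : cvg (x @ \oo).
  apply: cauchy_cvg; apply: cauchy_exP => e e0; have e2 : 0 < e / 2 by lra.
  have [N HN] := H _ e2; exists (x N); exists N => // m /= Nm.
  by rewrite /ball /=; apply: le_lt_trans (HN _ _ (leqnn N) Nm) _; lra.
move=> /cvgrPdist_le cx; exists (lim (x @ \oo)) => e e0.
have [N _ HN] := cx e e0; exists N => m Nm; rewrite distrC; exact: HN.
Qed.

Lemma complex_cauchy (x : nat -> complex R) :
  (forall e, 0 < e -> exists N, forall m k, (N <= m)%N -> (N <= k)%N -> cabs (x m - x k) <= e) ->
  exists l, forall e, 0 < e -> exists N, forall m, (N <= m)%N -> cabs (x m - l) <= e.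
Proof.
move=> H.
have [|a Ha] := @real_cauchy (fun m => complex.Re (x m)).
  move=> e /H[N HN]; exists N => m k hm hk; apply: le_trans (HN m k hm hk).
  by rewrite -ReN -ReD normRe_le.
have [|b Hb] := @real_cauchy (fun m => complex.Im (x m)).
  move=> e /H[N HN]; exists N => m k hm hk; apply: le_trans (HN m k hm hk).
  by rewrite -ImN -ImD normIm_le.
exists (Complex a b) => e e0; have e2 : 0 < e / 2 by lra.
have [N1 H1] := Ha _ e2; have [N2 H2] := Hb _ e2.
exists (maxn N1 N2) => m; rewrite geq_max => /andP[h1 h2].
apply: le_trans (cabs_le_ReIm _) _; rewrite ReD ReN ImD ImN /= (splitr e).
by apply: lerD; [exact: H1|exact: H2].
Qed.

End CauchySequences.

(** * Holomorphic functions of several variables *)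

Section Holomorphic.
Variables (R : realType) (n : nat).
Local Notation C := (complex R).
Local Notation V := (Cvec R n).
Implicit Types (f g : V -> C) (z w h a : V).

Definition fdiff f z a := odiff (@vnorm R n) (fun h => f (vadd z h)) (f z) (vlin a).

Lemma Bn_open z : Bn z -> exists r, 0 < r /\ forall h, vnorm h < r -> Bn (vadd z h).
Proof.
move=> /BnP Bz; exists (1 - vnorm z); split; first by lra.
by move=> h hr; apply/BnP; have := vnormD z h; lra.
Qed.

(** [holomorphic_on_Bn] restricts the increments to those that stay in the ball; as the ball is
    open, a smaller radius removes the restriction. *)
Lemma holomorphicP f : holomorphic_on_Bn f <-> forall z, Bn z -> exists a, fdiff f z a.
Proof.
split=> H z Bz; have [a Ha] := H z Bz; exists a => e e0; have [d [d0 Hd]] := Ha e e0.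
  have [r [r0 Hr]] := Bn_open Bz.
  exists (Num.min d r); split; first by rewrite lt_min d0.
  move=> h; rewrite lt_min => /andP[hd hr].
  by apply: Hd; [rewrite -nrm2_lt // ltW|exact: Hr].
exists d; split => // h hd _; apply: Hd; by rewrite nrm2_lt // ltW.
Qed.

Lemma slice_cdiff f z h t a : fdiff f (vadd z (vscale t h)) a ->
  cdiff (fun y => f (vadd z (vscale y h))) t (vlin a h).
Proof.
move=> D; have K0 : 0 < vnorm h + 1 by rewrite ltr_wpDl ?vnorm_ge0.
have mK (y : C) : vnorm (vscale y h) <= (vnorm h + 1) * cabs y.
  by rewrite vnorm_scale mulrC ler_wpM2r ?cabs_ge0 // lerDl.
have := @odiff_reparam R V C (@vnorm R n) (@cabs R) (fun y => vscale y h) _ _ _ _ (@cabs_ge0 R) K0 mK D.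
move=> H; apply: (odiff_ext _ _ H) => y /=.
  by rewrite vaddA -vscaleDl.
by rewrite vlinZ mulrC.
Qed.

(* The mean of (F(z + u h) - F z) / u over the circle |u| = 1 is the derivative. *)
Lemma cauchy_estimate f z h a M : fdiff f z a ->
  (forall t, cabs t <= 1 -> exists b, fdiff f (vadd z (vscale t h)) b) ->
  (forall t, cabs t <= 1 -> cabs (f (vadd z (vscale t h))) <= M) ->
  cabs (vlin a h) <= 4 * M.
Proof.
move=> Da D fM.
pose G (y : C) := f (vadd z (vscale y h)).
rewrite (_ : 4 * M = 2 * (2 * M)); last by ring.
apply: (@circle_mean_bound R (fun y => (G y - G 0) * y^-1)).
- move=> y /andP[y0 y1]; have [b Db] := D y y1.
  have Dn := cdiffD (slice_cdiff Db) (cdiff_cst (- G 0) y).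
  rewrite cabs_gt0 in y0.
  by eexists; exact: cdiffM Dn (cdiff_inv y0).
- move=> e e0.
  have D0 : cdiff G 0 (vlin a h) by apply: slice_cdiff; rewrite vscale0 vadd0.
  have [d [d0 Hd]] := D0 e e0; exists d; split => // y /andP[y0 yd].
  have := Hd y yd; rewrite add0r => H.
  have yn0 : y != 0 by rewrite -cabs_gt0.
  rewrite (_ : _ - _ = (G y - G 0 - vlin a h * y) * y^-1); last by field.
  by rewrite cabsM cabsV ler_pdivrMr.
- move=> t; rewrite cabsM cabsV cabs_cis invr1 mulr1.
  apply: le_trans (cabsB _ _) _; rewrite mulr_natl mulr2n; apply: lerD.
    by apply: fM; rewrite cabs_cis.
  by apply: fM; rewrite cabs0.
Qed.

(** [cauchy_estimate] in the direction [h] rescaled to length [r]; a vector of norm 0 is treated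
    apart. *)
Lemma fdiff_scaled_bound f z h a M r : 0 < r -> fdiff f z a ->
  (forall w, vnorm w <= r -> exists b, fdiff f (vadd z w) b) ->
  (forall w, vnorm w <= r -> cabs (f (vadd z w)) <= M) ->
  cabs (vlin a h) <= 4 * M / r * vnorm h.
Proof.
move=> r0 Da D fM.
have [h0|hn0] := eqVneq (vnorm h) 0.
  by rewrite h0 mulr0; have := vlin_le a h; rewrite h0 mulr0.
have h0 : 0 < vnorm h by rewrite lt_neqAle eq_sym hn0 vnorm_ge0.
pose c := r / vnorm h.
have c0 : 0 < c by rewrite divr_gt0.
have cw t : cabs t <= 1 -> vnorm (vscale t (vscale (Complex c 0) h)) <= r.
  move=> t1; rewrite !vnorm_scale cabs_real gtr0_norm // /c divfK //.
  by rewrite ler_piMl // ltW.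
have := @cauchy_estimate f z (vscale (Complex c 0) h) a M Da
  (fun t t1 => D _ (cw t t1)) (fun t t1 => fM _ (cw t t1)).
rewrite vlinZ cabsM cabs_real gtr0_norm // -ler_pdivlMl // => H.
apply: le_trans H _; rewrite /c le_eqVlt; apply/orP; left; apply/eqP.
by field; rewrite hn0 gt_eqF.
Qed.

Lemma fdiffB f g z a b : fdiff f z a -> fdiff g z b ->
  fdiff (fun w => f w - g w) z (fun j => a j - b j).
Proof.
move=> Df Dg; have := odiffD Df (odiffZ (@vnorm_ge0 R n) (-1) Dg).
rewrite mulN1r => H; apply: (odiff_ext _ _ H) => h; first by rewrite mulN1r.
rewrite /vlin mulN1r -sumrB; apply: eq_bigr => j _; by rewrite mulrBl.
Qed.

Lemma fdiff_shift f z w a : fdiff f (vadd z w) a -> fdiff (fun y => f (vadd y w)) z a.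
Proof.
apply: odiff_ext => // h; congr f; apply/funext => j.
by rewrite /vadd addrAC.
Qed.

Section Taylor.
Variables (f : V -> C) (z0 : V) (M r : R).
Hypothesis r0 : 0 < r.
Hypothesis D : forall w, vnorm w <= 4 * r -> exists b, fdiff f (vadd z0 w) b.
Hypothesis fM : forall w, vnorm w <= 4 * r -> cabs (f (vadd z0 w)) <= M.

(** The radius [4 r] leaves room for a base point at distance [2 r], an increment of length [r] and
    a Cauchy estimate of radius [r]. *)
Let lipschitz z w : vnorm z <= 2 * r -> vnorm w <= r ->
  cabs (f (vadd (vadd z0 z) w) - f (vadd z0 z)) <= 8 * M / r * vnorm w.
Proof.
move=> hz hw.
have := @segment_bound R (fun t => f (vadd (vadd z0 z) (vscale t w))) (4 * M / r * vnorm w).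
rewrite vscale1 vscale0 vadd0 => H.
rewrite (_ : 8 * M / r * vnorm w = 2 * (4 * M / r * vnorm w)); last by ring.
apply: H => t /andP[t0 t1].
have tw : vnorm (vscale (Complex t 0) w) <= r.
  by rewrite vnorm_scale cabs_real ger0_norm // (le_trans _ hw) // ler_piMl // vnorm_ge0.
have near x : vnorm x <= r -> vnorm (vadd (vadd z (vscale (Complex t 0) w)) x) <= 4 * r.
  move=> xr; have := vnormD (vadd z (vscale (Complex t 0) w)) x.
  by have := vnormD z (vscale (Complex t 0) w); lra.
have [b Db] : exists b, fdiff f (vadd (vadd z0 z) (vscale (Complex t 0) w)) b.
  rewrite vaddA; apply: D; have := near (fun=> 0); rewrite vadd0; apply.
  by rewrite vnorm0 ltW.
exists (vlin b w); last exact: slice_cdiff.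
apply: (fdiff_scaled_bound w r0 Db) => x xr; rewrite !vaddA -(vaddA z).
  exact/D/near.
exact/fM/near.
Qed.

(** The derivative at [z0 + t w] minus that at [z0] is the derivative at [z0] of
    [y -> f (y + t w) - f y], a function of size [8 M / r |w|] by [lipschitz]. A Cauchy estimate
    bounds it, so no second derivative appears; the constant 64 is the product of this 8, the 4 of
    the Cauchy estimate and the 2 of [segment_bound]. *)
Lemma taylor a w : fdiff f z0 a -> vnorm w <= r ->
  cabs (f (vadd z0 w) - f z0 - vlin a w) <= 64 * M / r ^+ 2 * vnorm w ^+ 2.
Proof.
move=> Da hw.
have [B BE] : exists B, B = 32 * M / r ^+ 2 * vnorm w ^+ 2 by eexists.
have H := @segment_bound R (fun t => f (vadd z0 (vscale t w)) + (- vlin a w * t + 0)) B.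
rewrite (_ : 64 * M / _ * _ = 2 * B); last by rewrite BE; ring.
rewrite (_ : _ - _ = (f (vadd z0 (vscale 1 w)) + (- vlin a w * 1 + 0)) -
   (f (vadd z0 (vscale 0 w)) + (- vlin a w * 0 + 0))); last first.
  by rewrite vscale1 vscale0 vadd0; ring.
apply: H => t /andP[t0 t1].
have tw : vnorm (vscale (Complex t 0) w) <= vnorm w.
  by rewrite vnorm_scale cabs_real ger0_norm // ler_piMl // vnorm_ge0.
have twr := le_trans tw hw.
have r4 : r <= 4 * r by rewrite ler_peMl ?ler1n // ltW.
have [b Db] := D (le_trans twr r4).
exists (vlin b w + - vlin a w); last first.
  by apply: cdiffD; [exact: slice_cdiff|exact: cdiff_affine].
have DB : fdiff (fun y => f (vadd y (vscale (Complex t 0) w)) - f y) z0 (fun j => b j - a j).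
  by apply: fdiffB => //; exact: fdiff_shift.
have -> : vlin b w + - vlin a w = vlin (fun j => b j - a j) w.
  by rewrite /vlin -sumrB; apply: eq_bigr => j _; rewrite mulrBl.
rewrite (_ : B = 4 * (8 * M / r * vnorm w) / r * vnorm w); last first.
  by rewrite BE; field; rewrite gt_eqF.
clear BE.
apply: (fdiff_scaled_bound w r0 DB) => x xr.
  have x4 := le_trans xr r4.
  have xw4 : vnorm (vadd x (vscale (Complex t 0) w)) <= 4 * r.
    by have := vnormD x (vscale (Complex t 0) w); lra.
  have [b1 D1] := D x4; have [b2 D2] := D xw4.
  exists (fun j => b2 j - b1 j); apply: fdiffB => //.
  by apply: fdiff_shift; rewrite vaddA.
have x2 : vnorm x <= 2 * r by lra.
apply: le_trans (lipschitz x2 twr) _; rewrite ler_wpM2l //.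
have x4 := le_trans xr r4.
have M0 : 0 <= M by apply: le_trans (fM x4); exact: cabs_ge0.
by rewrite !mulr_ge0 ?invr_ge0 // ltW.
Qed.

End Taylor.

(* The quadratic remainder in Taylor's formula only depends on the bound M, so it
   survives pointwise limits; the coefficients converge since they are difference
   quotients up to O(t). *)
Lemma fdiff_pointwise_limit (f_ : nat -> V -> C) (F : V -> C) z0 M r : 0 < r ->
  (forall m w, vnorm w <= 4 * r -> exists b, fdiff (f_ m) (vadd z0 w) b) ->
  (forall m w, vnorm w <= 4 * r -> cabs (f_ m (vadd z0 w)) <= M) ->
  (forall w, vnorm w <= 4 * r -> forall e, 0 < e -> exists N, forall m, (N <= m)%N ->
     cabs (f_ m (vadd z0 w) - F (vadd z0 w)) <= e) ->
  exists a, fdiff F z0 a.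
Proof.
move=> r0 D fM cv.
have r40 : vnorm ((fun=> 0) : V) <= 4 * r by rewrite vnorm0 mulr_ge0 // ltW.
have M0 : 0 <= M by apply: le_trans (fM 0%N _ r40); exact: cabs_ge0.
have /choice[a Ha] : forall m, exists a, fdiff (f_ m) z0 a.
  by move=> m; have [b] := D m _ r40; rewrite vadd0; exists b.
pose K := 64 * M / r ^+ 2.
have K0 : 0 <= K by rewrite /K divr_ge0 ?mulr_ge0 // ltW // exprn_gt0.
have T m w : vnorm w <= r -> cabs (f_ m (vadd z0 w) - f_ m z0 - vlin (a m) w) <= K * vnorm w ^+ 2.
  by move=> wr; apply: (taylor r0 (D m) (fM m) (Ha m) wr).
have cv0 e : 0 < e -> exists N, forall m, (N <= m)%N -> cabs (f_ m z0 - F z0) <= e.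
  by have := cv _ r40 e; rewrite vadd0.
have rr : r <= 4 * r by rewrite ler_peMl ?ler1n // ltW.
(* Subtracting the Taylor bounds of [f_ m] and [f_ k] leaves the difference of the linear parts, up
   to a quadratic error. *)
have close w : vnorm w <= r -> forall e, 0 < e -> exists N, forall m k, (N <= m)%N -> (N <= k)%N ->
   cabs (vlin (a m) w - vlin (a k) w) <= 2 * K * vnorm w ^+ 2 + e.
  move=> wr e e0; have e4 : 0 < e / 4 by lra.
  have [N1 H1] := cv0 _ e4; have [N2 H2] := cv w (le_trans wr rr) _ e4.
  exists (maxn N1 N2) => m k; rewrite !geq_max => /andP[m1 m2] /andP[k1 k2].
  rewrite (_ : _ - _ = (f_ k (vadd z0 w) - f_ k z0 - vlin (a k) w)
    - (f_ m (vadd z0 w) - f_ m z0 - vlin (a m) w)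
    + ((f_ m (vadd z0 w) - F (vadd z0 w)) - (f_ k (vadd z0 w) - F (vadd z0 w)))
    - ((f_ m z0 - F z0) - (f_ k z0 - F z0))); last by ring.
  apply: le_trans (cabsB _ _) _.
  have := cabsD (f_ k (vadd z0 w) - f_ k z0 - vlin (a k) w
    - (f_ m (vadd z0 w) - f_ m z0 - vlin (a m) w)) ((f_ m (vadd z0 w) - F (vadd z0 w)) - (f_ k (vadd z0 w) - F (vadd z0 w))).
  have := cabsB (f_ k (vadd z0 w) - f_ k z0 - vlin (a k) w) (f_ m (vadd z0 w) - f_ m z0 - vlin (a m) w).
  have := cabsB (f_ m (vadd z0 w) - F (vadd z0 w)) (f_ k (vadd z0 w) - F (vadd z0 w)).
  have := cabsB (f_ m z0 - F z0) (f_ k z0 - F z0).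
  have := T m w wr; have := T k w wr.
  have := H1 _ m1; have := H1 _ k1; have := H2 _ m2; have := H2 _ k2.
  by clear; lra.
pose ej (j : 'I_n) : V := fun i => if i == j then 1 else 0.
have vlin_ej b j (c : C) : vlin b (vscale c (ej j)) = b j * c.
  rewrite /vlin (bigD1 j) //= /vscale /ej eqxx mulr1 big1 ?addr0 // => i /negbTE ->.
  by rewrite !mulr0.
have norm_ej j : vnorm (ej j) = 1.
  rewrite /vnorm /nrm2 (bigD1 j) //= /ej eqxx big1 => [|i /negbTE ->]; last exact: csq0.
  by rewrite addr0 -sqr_cabs cabs1 expr1n sqrtr1.
have cauchy j e : 0 < e -> exists N, forall m k, (N <= m)%N -> (N <= k)%N ->
    cabs (a m j - a k j) <= e.
  move=> e0.
  have K1 : 0 < 4 * (K + 1) by lra.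
  (* Division by [t] turns [2 K t^2 + e t / 2] into [2 K t + e / 2], and this [t] makes the first
     term at most [e / 2]. *)
  pose t := Num.min r (e / (4 * (K + 1))).
  have t0 : 0 < t by rewrite lt_min r0 divr_gt0.
  have tE : vnorm (vscale (Complex t 0) (ej j)) = t.
    by rewrite vnorm_scale norm_ej mulr1 cabs_real gtr0_norm.
  have tr : vnorm (vscale (Complex t 0) (ej j)) <= r by rewrite tE ge_min lexx.
  have te : t * (4 * (K + 1)) <= e by rewrite -ler_pdivlMr // ge_min lexx orbT.
  have et : 0 < e * t / 2 by rewrite divr_gt0 // mulr_gt0.
  have [N HN] := close _ tr _ et; exists N => m k mN kN; have := HN m k mN kN.
  rewrite !vlin_ej tE -mulrBl cabsM cabs_real gtr0_norm //.
  move=> H; rewrite -(ler_pM2r t0); apply: le_trans H _.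
  clear -t0 te K0; nra.
have /choice[b Hb] : forall j, exists b, forall e, 0 < e -> exists N, forall m, (N <= m)%N ->
    cabs (a m j - b) <= e.
  by move=> j; exact: complex_cauchy (cauchy j).
exists b => e e0.
(* The quadratic bound passes to the limit; the index [m] is taken large for all [n] coefficients at
   once. *)
have bound w : vnorm w <= r -> cabs (F (vadd z0 w) - F z0 - vlin b w) <= K * vnorm w ^+ 2.
  move=> wr; apply/ler_addgt0Pr => e1 e10.
  have e4 : 0 < e1 / 4 by rewrite divr_gt0.
  have [N1 H1] := cv0 _ e4; have [N2 H2] := cv w (le_trans wr rr) _ e4.
  have w1 : 0 < n%:R * (vnorm w + 1) + 1 :> R.
    by rewrite ltr_wpDl // mulr_ge0 // addr_ge0 ?vnorm_ge0.
  have e5 : 0 < e1 / 4 / (n%:R * (vnorm w + 1) + 1) by rewrite divr_gt0.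
  have /choice[N3 H3] : forall j, exists N, forall m, (N <= m)%N ->
      cabs (a m j - b j) <= e1 / 4 / (n%:R * (vnorm w + 1) + 1).
    by move=> j; exact: Hb.
  pose m := maxn (maxn N1 N2) (\max_j N3 j)%N.
  have m1 : (N1 <= m)%N by rewrite /m !leq_max leqnn.
  have m2 : (N2 <= m)%N by rewrite /m !leq_max leqnn orbT.
  have m3 j : (N3 j <= m)%N by rewrite /m leq_max leq_bigmax orbT.
  have ab : cabs (vlin (a m) w - vlin b w) <= e1 / 4.
    rewrite /vlin -sumrB; apply: le_trans (cabs_sum _ _ _) _.
    apply: (@le_trans _ _ (\sum_(j < n) (e1 / 4 / (n%:R * (vnorm w + 1) + 1) * (vnorm w + 1)))).
      apply: ler_sum => j _; rewrite -mulrBl cabsM; apply: ler_pM; rewrite ?cabs_ge0 ?H3 //.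
      apply: (@le_trans _ _ (vnorm w)); last by rewrite lerDl.
      rewrite /vnorm /cabs ler_wsqrtr // /nrm2 (bigD1 j) //= lerDl sumr_ge0 // => i _.
      exact: csq_ge0.
    rewrite sumr_const card_ord -[leLHS]mulr_natl.
    rewrite (_ : _ * _ = e1 / 4 * (n%:R * (vnorm w + 1) / (n%:R * (vnorm w + 1) + 1))); last by ring.
    by rewrite -[leRHS]mulr1 ler_wpM2l ?(ltW e4) // ler_pdivrMr // mul1r lerDl.
  rewrite (_ : _ - _ = (f_ m (vadd z0 w) - f_ m z0 - vlin (a m) w)
    + (vlin (a m) w - vlin b w)
    - (f_ m (vadd z0 w) - F (vadd z0 w)) + (f_ m z0 - F z0)); last by ring.
  apply: le_trans (cabsD _ _) _.
  have := cabsB (f_ m (vadd z0 w) - f_ m z0 - vlin (a m) w + (vlin (a m) w - vlin b w))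
     (f_ m (vadd z0 w) - F (vadd z0 w)).
  have := cabsD (f_ m (vadd z0 w) - f_ m z0 - vlin (a m) w) (vlin (a m) w - vlin b w).
  have := T m w wr; have := H1 _ m1; have := H2 _ m2.
  by clear -ab e10; lra.
have K1 : 0 < K + 1 by lra.
exists (Num.min r (e / (K + 1))); split; first by rewrite lt_min r0 divr_gt0.
move=> h; rewrite lt_min ltr_pdivlMr // => /andP[hr he].
apply: le_trans (bound h (ltW hr)) _.
rewrite expr2 mulrA ler_wpM2r ?vnorm_ge0 //; have := vnorm_ge0 h; clear -he K0; nra.
Qed.

End Holomorphic.

(** * Sub-mean value property *)

Section TonelliOn.
Context d1 d2 (T1 : measurableType d1) (T2 : measurableType d2) (R : realType).

Lemma integral_indicM d (T : measurableType d) (m : {measure set T -> \bar R}) (E : set T)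
    (F : T -> R) :
  (\int[m]_x (\1_E x * F x)%:E = \int[m]_(x in E) (F x)%:E)%E.
Proof.
rewrite [RHS]integral_mkcond; apply: eq_integral => x _; rewrite patchE indicE.
by case: ifPn => _; rewrite ?mul1r ?mul0r.
Qed.

Lemma tonelli_on (m1 : {measure set T1 -> \bar R}) (m2 : {measure set T2 -> \bar R})
    (A : set T1) (B : set T2) (f : T1 * T2 -> R) :
  sigma_finite setT m1 -> sigma_finite setT m2 -> measurable A -> measurable B ->
  measurable_fun setT f -> (forall xy, 0 <= f xy) ->
  (\int[m1]_(x in A) \int[m2]_(y in B) (f (x, y))%:E =
   \int[m2]_(y in B) \int[m1]_(x in A) (f (x, y))%:E)%E.
Proof.
move=> s1 s2 mA mB mf f0.
pose F (xy : T1 * T2) : R := \1_A xy.1 * (\1_B xy.2 * f xy).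
have mF : measurable_fun setT (fun xy => (F xy)%:E).
  apply/measurable_EFinP; apply: measurable_funM.
    exact: (measurableT_comp (measurable_indic mA) measurable_fst).
  by apply: measurable_funM => //; exact: (measurableT_comp (measurable_indic mB) measurable_snd).
have F0 xy : (0 <= (F xy)%:E)%E by rewrite lee_fin !mulr_ge0.
have := tonelli s1 s2 mF F0.
have -> : (\int[m1]_x \int[m2]_y (F (x, y))%:E = \int[m1]_(x in A) \int[m2]_(y in B) (f (x, y))%:E)%E.
  rewrite [RHS]integral_mkcond; apply: eq_integral => x _; rewrite patchE /F /= indicE.
  case: ifPn => _; last by apply: integral0_eq => y _; rewrite mul0r.
  by under eq_integral do rewrite mul1r; rewrite integral_indicM.
move=> ->.
rewrite [RHS]integral_mkcond; apply: eq_integral => y _; rewrite patchE /F /= indicE.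
case: ifPn => _; last by apply: integral0_eq => x _; rewrite mul0r mulr0.
by under eq_integral do rewrite mul1r; rewrite integral_indicM.
Qed.

End TonelliOn.

Section CircleSquareMean.
Variable R : realType.
Local Notation C := (complex R).

Definition leb : {measure set (measurableTypeR R) -> \bar R} := @lebesgue_measure R.

Lemma leb_sigma_finite : sigma_finite setT leb.
Proof. exact: (@sigma_finiteT _ _ _ (@lebesgue_measure R)). Qed.

Lemma leb_itv (a b : R) : a < b -> leb `[a, b]%classic = (b - a)%:E.
Proof. by move=> ab; have := @lebesgue_measure_itv R `[a, b]; rewrite /= lte_fin ab. Qed.

Lemma EFin_itgl (f : R -> R) a b : cont_on f a b ->
  (\int[leb]_(x in `[a, b]) (f x)%:E = (itgl f a b)%:E)%E.
Proof.
move=> cf; rewrite /itgl /Rintegral fineK //.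
by apply: integrable_fin_num => //; exact: cont_on_integrable.
Qed.

Lemma cis_cdiff_cont (G : C -> C) : (forall y, cabs y <= 1 -> exists l, cdiff G y l) ->
  forall t, eps_cont (fun t => complex.Re (G (cis t))) t /\
   eps_cont (fun t => complex.Im (G (cis t))) t.
Proof.
move=> GD t; have [|w Dw] := GD (cis t); first by rewrite cabs_cis.
rewrite cis_cexp in Dw.
have := cdiff_comp (cdiff_exp (Complex 0 t)) Dw; case: (w * _) => a b /cdiff_diff2[].
move=> /diff2_cont[_ c1] /diff2_cont[_ c2].
by split => e e0; [have [d [d0 H]] := c1 e e0|have [d [d0 H]] := c2 e e0];
  exists d; split => // y /H; rewrite /= !cis_cexp.
Qed.

Lemma eps_cont_sqr (f : R -> R) t : eps_cont f t -> eps_cont (fun x => f x ^+ 2) t.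
Proof.
move=> cf e e0; pose m := 2 * `|f t| + 1.
have m0 : 0 < m by rewrite ltr_wpDl // mulr_ge0.
have k0 : 0 < Num.min 1 (e / m) by rewrite lt_min ltr01 divr_gt0.
have [d [d0 Hd]] := cf _ k0; exists d; split => // y /Hd; rewrite le_min ler_pdivlMr //.
move=> /andP[h1 h2].
rewrite (_ : _ - _ = (f y - f t) * (f y + f t)); last by ring.
rewrite normrM; apply: le_trans h2; rewrite ler_wpM2l //.
rewrite (_ : f y + f t = (f y - f t) + 2 * f t); last by ring.
apply: le_trans (ler_normD _ _) _; rewrite normrM /m ger0_norm // addrC.
by rewrite lerD2l.
Qed.

(** The mean value property of the real and of the imaginary part, each combined with Jensen's
    inequality for the square. *)
Lemma circle_sqr_mean (G : C -> C) : (forall y, cabs y <= 1 -> exists l, cdiff G y l) ->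
  cont_on (fun t => csq (G (cis t))) 0 (pi *+ 2) /\
  csq (G 0) * (pi *+ 2) <= itgl (fun t => csq (G (cis t))) 0 (pi *+ 2).
Proof.
move=> GD; have pi0 : 0 <= pi *+ 2 :> R by rewrite mulrn_wge0 // pi_ge0.
have cc := cis_cdiff_cont GD.
have cG : cont_on (fun t => csq (G (cis t))) 0 (pi *+ 2).
  by move=> t _; rewrite /csq; apply: eps_contD; apply: eps_cont_sqr; case: (cc t).
split=> //.
have [||m1 m2] := @circle_mean R G (G 0).
- by move=> z /andP[_]; exact: GD.
- move=> e e0; have [|l Dl] := GD 0; first by rewrite cabs0.
  have [d [d0 Hd]] := odiff_near (cabs_ge0 l) (cdiff_lin_bound l) Dl e0.
  exists d; split => // z /andP[_ /Hd[_ [h1 h2]]].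
  by move: h1; rewrite add0r => h1; exact: le_trans h1 h2.
(* Integration of [2 k f - k^2 <= f^2], with [k] the mean of [f]. *)
have key (f : R -> R) k : (forall t, eps_cont f t) -> itgl f 0 (pi *+ 2) = k * (pi *+ 2) ->
    k ^+ 2 * (pi *+ 2) <= itgl (fun t => f t ^+ 2) 0 (pi *+ 2).
  move=> cf E.
  have cf2 : cont_on (fun t => f t * (2 * k) - k ^+ 2) 0 (pi *+ 2).
    move=> t _; apply: eps_contB; last exact: eps_cont_cst.
    move=> e e0; have m0 : 0 < `|2 * k| + 1 by rewrite ltr_wpDl.
    have [d [d0 Hd]] := cf t _ (divr_gt0 e0 m0); exists d; split => // y /Hd h.
    rewrite -mulrBl normrM; apply: (@le_trans _ _ (e / (`|2 * k| + 1) * (`|2 * k| + 1))).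
      by rewrite ler_pM // lerDl.
    by rewrite divfK // gt_eqF.
  have := @le_itgl R _ (fun t => f t ^+ 2) 0 (pi *+ 2) cf2 (fun t _ => eps_cont_sqr (cf t)).
  have ck : cont_on (fun=> k ^+ 2) 0 (pi *+ 2) by move=> t _; exact: eps_cont_cst.
  have cf3 : cont_on (fun t => f t * (2 * k)) 0 (pi *+ 2).
    move=> t ht; have := eps_contD (cf2 t ht) (ck t ht).
    by move=> H e e0; have [d [d0 Hd]] := H e e0; exists d; split => // y /Hd; rewrite !subrK.
  rewrite itglB // itgl_cst // subr0.
  have -> : itgl (fun t => f t * (2 * k)) 0 (pi *+ 2) = itgl f 0 (pi *+ 2) * (2 * k).
    by rewrite /itgl RintegralZr //; apply: cont_on_integrable => t _; exact: cf.
  rewrite E => H.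
  have E2 (P : R) : k ^+ 2 * P = k * P * (2 * k) - k ^+ 2 * P by ring.
  by rewrite E2; apply: H => t _; have := sqr_ge0 (f t - k); nra.
rewrite /csq mulrDl itglD; last 2 first.
- by move=> t _; apply: eps_cont_sqr; case: (cc t).
- by move=> t _; apply: eps_cont_sqr; case: (cc t).
apply: lerD; first by apply: key m1 => t; case: (cc t).
by apply: key m2 => t; case: (cc t).
Qed.

End CircleSquareMean.

Section SubMean.
Variables (R : realType) (n : nat).
Local Notation C := (complex R).
Local Notation RM := (measurableTypeR R).
Local Notation V := (Cvec R n).
Local Notation T := (Rcoords R n).
Variable v : {measure set T -> \bar R}.
Hypothesis Hv : is_lebesgue v.

Definition fhol (g : V -> C) := forall z, Bn z -> exists a, fdiff g z a.

Lemma fhol_measurable g (p : C -> R) : fhol g ->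
  (forall x y, `|p x - p y| <= cabs (x - y)) ->
  measurable_fun (@BnR R n) (fun x => p (g (tz x))).
Proof.
move=> hg pl; apply: (measurable_cont_Bn (g := fun z => p (g z))) => z Bz e e0.
have [a Da] := hg z Bz.
have [d [d0 Hd]] := odiff_near (vnorm_ge0 a) (vlin_le a) Da e0.
exists d; split => // w Bw; rewrite -nrm2_lt ?(ltW d0) // => /Hd[_ []].
rewrite vadd_sub => h1 h2; apply: le_trans (pl _ _) _; exact: le_trans h1 h2.
Qed.

Lemma fhol_measurable_Re g : fhol g -> measurable_fun (@BnR R n) (fun x => complex.Re (g (tz x))).
Proof. by move=> hg; apply: fhol_measurable => // x y; rewrite -ReN -ReD normRe_le. Qed.

Lemma fhol_measurable_Im g : fhol g -> measurable_fun (@BnR R n) (fun x => complex.Im (g (tz x))).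
Proof. by move=> hg; apply: fhol_measurable => // x y; rewrite -ImN -ImD normIm_le. Qed.

Lemma fhol_measurable_csq g : fhol g -> measurable_fun (@BnR R n) (fun x => csq (g (tz x))).
Proof.
move=> hg; rewrite /csq; apply: measurable_funD; apply: measurable_funX.
  exact: fhol_measurable_Re.
exact: fhol_measurable_Im.
Qed.

Lemma measurable_rotate (z : V) :
  measurable_fun setT (fun tx : RM * T => ct (vadd z (vscale (cis tx.1) (tz tx.2)))).
Proof.
have mcos : measurable_fun setT (fun tx : RM * T => cos tx.1).
  apply: (measurableT_comp _ measurable_fst); apply: continuous_measurable_fun.
  exact: continuous_cos.
have msin : measurable_fun setT (fun tx : RM * T => sin tx.1).
  apply: (measurableT_comp _ measurable_fst); apply: continuous_measurable_fun.
  exact: continuous_sin.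
have mr j : measurable_fun setT (fun tx : RM * T => complex.Re (tz tx.2 j)).
  exact: (measurableT_comp (measurable_Re_tz j) measurable_snd).
have mi j : measurable_fun setT (fun tx : RM * T => complex.Im (tz tx.2 j)).
  exact: (measurableT_comp (measurable_Im_tz j) measurable_snd).
apply: measurable_ct => j; rewrite /vadd /vscale.
  under eq_fun do rewrite ReD ReM.
  apply: measurable_funD; first exact: measurable_cst.
  by apply: measurable_funB; [exact: measurable_funM mcos (mr j)|exact: measurable_funM msin (mi j)].
under eq_fun do rewrite ImD ImM.
apply: measurable_funD; first exact: measurable_cst.
by apply: measurable_funD; [exact: measurable_funM mcos (mi j)|exact: measurable_funM msin (mr j)].
Qed.

Definition circled (E : set T) := forall x t, E x -> E (affine (cis t) (fun=> 0) x).

Lemma affine_cisK t (x : T) :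
  affine (cis (- t)) (fun=> 0) (affine (cis t) (fun=> 0) x) = x.
Proof.
rewrite /affine ctK -[RHS]tzK; congr ct; apply/funext => j.
rewrite /vadd /vscale !addr0 mulrA; set w := cis _ * _.
have -> : w = 1.
  by apply: complex_eq; rewrite /w ?ReM ?ImM /= sinN cosN; have := cos2Dsin2 t; lra.
by rewrite mul1r.
Qed.

(** For fixed [x] in [E] the mean of [|g(z + e^{it} x)|^2] over [t] dominates [|g(z)|^2]. After
    integration over [E] and Tonelli, each rotated integral equals the unrotated one, because [E] is
    circled and [v] is invariant under rotations. *)
Lemma sub_mean (g : V -> C) (z : V) (E : set T) : fhol g -> measurable E -> circled E ->
  (forall x y, E x -> cabs y <= 1 -> Bn (vadd z (vscale y (tz x)))) ->
  ((csq (g z))%:E * v E <= \int[v]_(x in E) (csq (g (vadd z (tz x))))%:E)%E.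
Proof.
move=> hg mE cE EB.
have pi0 : 0 < pi *+ 2 :> R by rewrite mulrn_wgt0 // pi_gt0.
(* Extension by 0 outside the ball makes the integrand measurable on the whole product space. *)
pose H' : T -> R := (fun x => csq (g (tz x))) \_ (@BnR R n).
have mH' : measurable_fun setT H'.
  exact: ((measurable_restrictT (fun x => csq (g (tz x))) (@measurable_BnR R n)).1 (fhol_measurable_csq hg)).
have H'0 x : 0 <= H' x by rewrite /H' patchE; case: ifP => // _; exact: csq_ge0.
have H'E w : Bn w -> H' (ct w) = csq (g w).
  move=> Bw; rewrite /H' patchE ctK ifT // inE /BnR /= ctK; exact: Bw.
pose f (tx : RM * T) := H' (ct (vadd z (vscale (cis tx.1) (tz tx.2)))).
have mf : measurable_fun setT f by exact: measurableT_comp mH' (measurable_rotate z).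
have f0 tx : 0 <= f tx by exact: H'0.
pose I : set RM := `[0, pi *+ 2]%classic.
have muI : leb R I = (pi *+ 2)%:E by rewrite leb_itv // subr0.
have slice x : E x -> forall y : C, cabs y <= 1 ->
    exists l, cdiff (fun y => g (vadd z (vscale y (tz x)))) y l.
  move=> Ex y y1; have [a Da] := hg _ (EB x y Ex y1).
  by exists (vlin a (tz x)); exact: slice_cdiff.
have low x : E x -> ((csq (g z) * (pi *+ 2))%:E <= \int[leb R]_(t in I) (f (t, x))%:E)%E.
  move=> Ex; have [c1 c2] := circle_sqr_mean (slice x Ex).
  have -> : (\int[leb R]_(t in I) (f (t, x))%:E =
     \int[leb R]_(t in I) (csq (g (vadd z (vscale (cis t) (tz x)))))%:E)%E.
    apply: eq_integral => t _; congr (_ %:E); rewrite /f /= H'E //.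
    by apply: EB => //; rewrite cabs_cis.
  by rewrite (EFin_itgl c1) lee_fin; move: c2; rewrite vscale0 vadd0.
pose J := (\int[v]_(x in E) (csq (g (vadd z (tz x))))%:E)%E.
have rot t : (\int[v]_(x in E) (f (t, x))%:E = J)%E.
  have mfn : measurable_fun setT (fun y : T => (H' (ct (vadd z (tz y))))%:E).
    apply/measurable_EFinP; apply: measurableT_comp mH' _.
    apply: measurable_ct => j; rewrite /vadd.
      by under eq_fun do rewrite ReD; apply: measurable_funD => //; exact: measurable_Re_tz.
    by under eq_fun do rewrite ImD; apply: measurable_funD => //; exact: measurable_Im_tz.
  have c1 : csq (cis t) = 1 by rewrite -sqr_cabs cabs_cis expr1n.
  have := @integral_rotation R n v Hv (cis t) E _ c1 mE (measurable_funTS mfn).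
  move=> /(_ (fun y _ => H'0 _)).
  have -> : affine (cis t) (fun=> 0) @^-1` E = E.
    apply/seteqP; split => x /=; last exact: cE.
    by move=> /(cE _ (- t)); rewrite affine_cisK.
  have -> : (\int[v]_(y in E) (H' (ct (vadd z (tz y))))%:E = J)%E.
    apply: eq_integral => x /[!inE] Ex; congr (_ %:E); rewrite H'E //.
    by rewrite -[tz x]vscale1; apply: EB => //; rewrite cabs1.
  move=> <-; apply: eq_integral => x _; congr (_ %:E).
  by rewrite /f /= /affine ctK; congr (H' (ct _)); apply/funext => j; rewrite /vadd /vscale addr0.
have ton : (\int[leb R]_(t in I) \int[v]_(x in E) (f (t, x))%:E =
    \int[v]_(x in E) \int[leb R]_(t in I) (f (t, x))%:E)%E.
  apply: tonelli_on => //; first exact: leb_sigma_finite.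
    exact: lebesgue_sigma_finite Hv.
  exact: measurable_itv.
have : ((csq (g z) * (pi *+ 2))%:E * v E <= J * (pi *+ 2)%:E)%E.
  apply: (@le_trans _ _ (\int[v]_(y in E) \int[leb R]_(x in I) (f (x, y))%:E)%E).
    rewrite -integral_cst //; apply: ge0_le_integral => //.
    - by move=> x _; rewrite lee_fin mulr_ge0 ?csq_ge0 // ltW.
    - apply: measurable_funTS.
      pose fs (xt : T * RM) : \bar R := (\1_I xt.2 * f (xt.2, xt.1))%:E.
      have mfs : measurable_fun setT fs.
        apply/measurable_EFinP; apply: measurable_funM.
          exact: (measurableT_comp (measurable_indic (measurable_itv _)) measurable_snd).
        apply: (measurableT_comp mf); exact: measurable_swap.
      have fs0 xt : (0 <= fs xt)%E by rewrite lee_fin mulr_ge0 // H'0.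
      apply: (eq_measurable_fun (fun x => \int[leb R]_t fs (x, t))%E).
        by move=> x _; rewrite /fs /= integral_indicM.
      by refine (measurable_partial_integral (leb_sigma_finite R) _ _).
  rewrite -ton; under eq_integral do rewrite rot.
  by rewrite integral_cst ?muI //; exact: measurable_itv.
rewrite EFinM -muleA [X in (_ * X)%E]muleC muleA.
by rewrite lee_pmul2r.
Qed.

End SubMean.

(** * The Bergman space and Riesz representation *)

Section FatouBound.
Context d (T : measurableType d) (R : realType) (m : {measure set T -> \bar R}).

Lemma fatou_le (D : set T) (h_ : nat -> T -> R) (h : T -> R) (c : R) :
  measurable D -> (forall k, measurable_fun D (h_ k)) -> (forall k x, D x -> 0 <= h_ k x) ->
  (forall x, D x -> forall e, 0 < e -> exists N, forall k, (N <= k)%N -> `|h_ k x - h x| <= e) ->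
  (forall e, 0 < e -> exists N, forall k, (N <= k)%N ->
     (\int[m]_(x in D) (h_ k x)%:E <= (c + e)%:E)%E) ->
  (\int[m]_(x in D) (h x)%:E <= c%:E)%E.
Proof.
move=> mD mh h0 cv bd.
have := @fatou _ T R m D mD (fun k x => (h_ k x)%:E) (fun k => (measurable_EFinP _ _).2 (mh k))
  (fun k x Dx => h0 k x Dx).
have -> : (\int[m]_(x in D) limn_einf (fun k => (h_ k x)%:E) = \int[m]_(x in D) (h x)%:E)%E.
  apply: eq_integral => x /[!inE] Dx.
  suff /cvg_limn_einf_sup[] : (fun k => (h_ k x)%:E) @ \oo --> (h x)%:E by [].
  apply/fine_cvgP; split; first by exists 0%N.
  apply/cvgrPdist_le => e e0; have [N HN] := cv x Dx e e0.
  by exists N => // k /= Nk; rewrite distrC; exact: HN.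
move=> /le_trans; apply; rewrite limn_einf_lim.
apply/lee_addgt0Pr => e e0; rewrite -EFinD.
apply: lime_le; first exact: is_cvg_einfs.
have [N HN] := bd e e0; exists N => // k /= Nk.
by apply: (le_trans _ (HN k Nk)); apply: ereal_inf_lbound; exists k => /=.
Qed.

End FatouBound.

(** * Cauchy-Schwarz inequalities and abstract minimisation *)

Section Discriminant.
Variable R : realType.

Lemma discriminant_le (p c a : R) : 0 <= p ->
  (forall t, 0 <= t ^+ 2 * p + 2 * t * c + a) -> c ^+ 2 <= a * p.
Proof.
move=> p0 key; have [pE|pn0] := eqVneq p 0; last first.
  have pp : 0 < p by rewrite lt_neqAle eq_sym pn0.
  have := key (- c / p).
  rewrite (_ : _ + _ = (a * p - c ^+ 2) / p); last by field.
  by rewrite pmulr_lge0 ?invr_gt0 // subr_ge0.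
rewrite pE mulr0; have [->|cn0] := eqVneq c 0; first by rewrite expr0n.
(* For [p = 0] the polynomial is affine in [t]; with [c] nonzero it takes the value [-1] here. *)
have := key (- (a + 1) / (2 * c)).
rewrite pE mulr0 add0r (_ : _ + _ = -1); last by field.
by rewrite lerNr oppr0 ler10.
Qed.

(** Cauchy-Schwarz for three integrands linked by a pointwise nonnegative quadratic polynomial: one
    statement serves the scalar product of the space and the pairings weighted by [u]. *)
Lemma integral_discriminant d (T : measurableType d) (m : {measure set T -> \bar R})
    (D : set T) (p c a : T -> R) : measurable D ->
  m.-integrable D (EFin \o p) -> m.-integrable D (EFin \o c) -> m.-integrable D (EFin \o a) ->
  (forall x, D x -> 0 <= p x) ->
  (forall x, D x -> forall t, 0 <= t ^+ 2 * p x + 2 * t * c x + a x) ->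
  (\int[m]_(x in D) c x) ^+ 2 <= \int[m]_(x in D) a x * \int[m]_(x in D) p x.
Proof.
move=> mD ip ic ia p0 key; apply: discriminant_le; first exact: Rintegral_ge0.
move=> t; rewrite -!RintegralZl // -RintegralD //; last 2 first.
- by have := integrableZl mD (t ^+ 2) ip.
- by have := integrableZl mD (2 * t) ic.
rewrite -RintegralD //; first by apply: Rintegral_ge0 => x /key.
exact: (integrableD mD (integrableZl mD (t ^+ 2) ip) (integrableZl mD (2 * t) ic)).
Qed.

End Discriminant.

Section MinimisingSequence.
Variables (R : realType) (S : Type) (A : S -> Prop) (comb : R -> S -> R -> S -> S).
Variables (ip : S -> S -> R) (L : S -> R) (B : R).
Hypothesis combA : forall a f b g, A f -> A g -> A (comb a f b g).
Hypothesis ipC : forall f g, A f -> A g -> ip f g = ip g f.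
Hypothesis ipD : forall a f b g h, A f -> A g -> A h ->
  ip (comb a f b g) h = a * ip f h + b * ip g h.
Hypothesis ip_ge0 : forall f, A f -> 0 <= ip f f.
Hypothesis LD : forall a f b g, A f -> A g -> L (comb a f b g) = a * L f + b * L g.
Hypothesis B0 : 0 <= B.
Hypothesis LB : forall f, A f -> L f ^+ 2 <= B * ip f f.

Let ip_comb a f b g : A f -> A g -> ip (comb a f b g) (comb a f b g) =
  a ^+ 2 * ip f f + 2 * a * b * ip f g + b ^+ 2 * ip g g.
Proof.
move=> Af Ag; have Ac := combA a b Af Ag.
rewrite ipD // (ipC Af Ac) (ipC Ag Ac) !ipD // (ipC Ag Af); ring.
Qed.

Let Q f := ip f f - 2 * L f.

Let Q_ge f : A f -> - B <= Q f.
Proof.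
move=> Af; rewrite /Q; have h1 := LB Af; have h2 := ip_ge0 Af.
have := sqr_ge0 (B - ip f f); move: h1 h2; move: (ip f f) (L f) => q l h1 h2 h3.
have : 2 * l <= B + q; last by lra.
apply: (@le_trans _ _ `|2 * l|); first exact: ler_norm.
rewrite -(ler_pXn2r (n := 2)) ?nnegrE ?addr_ge0 // real_normK ?num_real //; nra.
Qed.

(** Near-minimisers of [Q f = <f, f> - 2 L f]. Comparison with the midpoint of two of them gives the
    Cauchy bound (parallelogram law), comparison with [f_ m + t phi] a quadratic polynomial in [t]
    whose discriminant controls [<f_ m, phi> - L phi], and comparison with the zero vector the norm
    bound. The conclusion is a sequence, so that no completeness has to be assumed. *)
Lemma minimising_sequence (f0 : S) : A f0 ->
  exists f_ : nat -> S, [/\ forall m, A (f_ m),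
    forall m k, ip (comb 1 (f_ m) (-1) (f_ k)) (comb 1 (f_ m) (-1) (f_ k))
        <= 2 * (m.+1%:R^-1 + k.+1%:R^-1),
    forall m phi, A phi -> (ip (f_ m) phi - L phi) ^+ 2 <= m.+1%:R^-1 * ip phi phi &
    forall m, ip (f_ m) (f_ m) <= 4 * B + 2 * m.+1%:R^-1].
Proof.
move=> A0; pose E := [set Q f | f in A].
have hi : has_inf E.
  by split; [exists (Q f0), f0|exists (- B) => _ [f Af <-]; exact: Q_ge].
have /choice[f_ Hf] : forall m : nat, exists f, A f /\ Q f <= inf E + m.+1%:R^-1.
  move=> m; have d0 : 0 < m.+1%:R^-1 :> R by rewrite invr_gt0.
  have [_ [f Af <-] hf] := inf_adherent d0 hi.
  by exists f; split => //; exact: ltW.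
have infle f : A f -> inf E <= Q f by move=> Af; apply: ge_inf; [case: hi|exists f].
have d0 m : 0 < m.+1%:R^-1 :> R by rewrite invr_gt0.
exists f_; split.
- by move=> m; case: (Hf m).
- move=> m k; have [Am hm] := Hf m; have [Ak hk] := Hf k.
  have := infle _ (combA 2^-1 2^-1 Am Ak).
  move: hm hk; rewrite /Q !ip_comb // LD //.
  move: (ip (f_ m) (f_ m)) (ip (f_ m) (f_ k)) (ip (f_ k) (f_ k)) (L _) (L _) (inf E)
    (m.+1%:R^-1 : R) (k.+1%:R^-1 : R) => a b c l1 l2 i d1 d2 h1 h2 h3.
  have q : 4 * i <= a + 2 * b + c - 4 * (l1 + l2) by lra.
  by lra.
- move=> m phi Ap; have [Am hm] := Hf m.
  have key t : 0 <= t ^+ 2 * ip phi phi + 2 * t * (ip (f_ m) phi - L phi) + m.+1%:R^-1.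
    have := infle _ (combA 1 t Am Ap); move: hm; rewrite /Q ip_comb // LD //.
    move: (ip _ _) (ip _ _) (ip _ _) (L _) (L _) (inf E) (m.+1%:R^-1 : R) => a b c l1 l2 i dd.
    by lra.
  exact: discriminant_le (ip_ge0 Ap) key.
- move=> m; have [Am hm] := Hf m.
  have i0 : inf E <= 0.
    have := infle _ (combA 0 0 A0 A0); rewrite /Q ip_comb // LD // !mul0r; lra.
  have h1 := LB Am; have h2 := ip_ge0 Am; move: hm i0; rewrite /Q; move: h1 h2.
  move: (ip _ _) (L _) (inf E) (m.+1%:R^-1 : R) => q l i dd h1 h2 h3 h4.
  (* With [q - 2 l <= dd] this gives [q / 2 <= 2 B + dd]. *)
  have : 2 * l <= 2 * B + q / 2; last by lra.
  apply: (@le_trans _ _ `|2 * l|); first exact: ler_norm.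
  rewrite -(ler_pXn2r (n := 2)) ?nnegrE ?addr_ge0 ?divr_ge0 ?mulr_ge0 // real_normK ?num_real //.
  have := sqr_ge0 (2 * B - q / 2); nra.
Qed.

End MinimisingSequence.

(** * Weight, translations and point evaluations *)

Section BergmanSpace.
Variables (R : realType) (n : nat).
Local Notation C := (complex R).
Local Notation V := (Cvec R n).
Local Notation T := (Rcoords R n).
Variable v : {measure set T -> \bar R}.
Hypothesis Hv : is_lebesgue v.
Local Notation BR := (@BnR R n).

Lemma weight_ge0 (x : T) : 0 <= weight x. Proof. exact: expR_ge0. Qed.

Lemma weight_le1 (x : T) : BR x -> weight x <= 1.
Proof.
move=> Bx; rewrite /weight /psi expR_le1 oppr_le0 invr_ge0 subr_ge0 ltW //; exact: Bx.
Qed.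

Lemma measurable_nrm2_tz : measurable_fun setT (fun x : T => nrm2 (tz x)).
Proof.
by apply: measurable_nrm2 => j; [exact: measurable_Re_tz|exact: measurable_Im_tz].
Qed.

Lemma measurable_weight : measurable_fun BR (@weight R n).
Proof.
(* On the ball [1 - |x|^2] is positive, so its inverse agrees with a real power, which is measurable
   everywhere. *)
apply: (eq_measurable_fun (fun x : T => expR (- (1 - nrm2 (tz x)) `^ (-1)))).
  move=> x /[!inE] Bx; rewrite powR_inv1 // subr_ge0 ltW //; exact: Bx.
apply: measurable_funTS; apply: measurableT_comp => //; apply: measurableT_comp => //.
apply: (measurableT_comp (measurable_powR _)).
by apply: measurable_funB => //; exact: measurable_nrm2_tz.
Qed.

Lemma BnR_vball : BR `<=` @vball R n 1.
Proof. by move=> x Bx; rewrite /vball /= expr1n ltW //; exact: Bx. Qed.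

Lemma BnR_lty : (v BR < +oo)%E.
Proof.
apply: le_lt_trans (vball_lty Hv (@ler01 R)).
apply: le_measure; rewrite ?inE; [exact: measurable_BnR|exact: measurable_vball|].
exact: BnR_vball.
Qed.

Definition vshift (z : V) (E : set T) : set T := [set y | E (ct (vsub (tz y) z))].

Lemma vshiftE z E : vshift z E = affine 1 (fun j => - z j) @^-1` E.
Proof. by apply/seteqP; split => y; rewrite /vshift /preimage /= /affine vscale1. Qed.

Lemma measurable_vshift z E : measurable E -> measurable (vshift z E).
Proof. by move=> mE; rewrite vshiftE; exact: measurable_preimage_affine. Qed.

Lemma integral_vshift (z : V) (E : set T) (F : V -> R) : measurable E ->
  measurable_fun (vshift z E) (fun y => F (tz y)) -> (forall y, 0 <= F y) ->
  (\int[v]_(x in E) (F (vadd z (tz x)))%:E = \int[v]_(y in vshift z E) (F (tz y))%:E)%E.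
Proof.
move=> mE mF F0.
have mF' : measurable_fun (vshift z E) (fun y => (F (tz y))%:E) by apply/measurable_EFinP.
rewrite -(integral_translate Hv z (measurable_vshift z mE) mF') => [|y _]; last by rewrite lee_fin.
have -> : affine 1 z @^-1` vshift z E = E.
  apply/seteqP; split => x; rewrite /preimage /vshift /affine /= vscale1 ctK;
    rewrite (_ : vsub _ _ = tz x) ?tzK //;
    by apply/funext => j; rewrite /vsub /vadd addrK.
apply: eq_integral => x _; congr (F _)%:E.
by rewrite /affine ctK vscale1; apply/funext => j; rewrite /vadd addrC.
Qed.

Lemma vball_circled r : circled (@vball R n r).
Proof.
move=> x t; rewrite /vball /= /affine ctK.
have -> : vadd (vscale (cis t) (tz x)) (fun=> 0) = vscale (cis t) (tz x) by exact: vadd0.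
by rewrite nrm2_scale -sqr_cabs cabs_cis expr1n mul1r.
Qed.

Lemma measurable_csq_weight f : fhol f ->
  measurable_fun BR (fun x => csq (f (tz x)) * weight x).
Proof. by move=> hf; apply: measurable_funM; [exact: fhol_measurable_csq|exact: measurable_weight]. Qed.

Lemma in_A2_fhol f : in_A2 v f -> fhol f.
Proof. by case=> /holomorphicP. Qed.

Lemma nsq_ge0 f : (0 <= nsq v f)%E.
Proof. by apply: integral_ge0 => x _; rewrite lee_fin mulr_ge0 ?csq_ge0 ?weight_ge0. Qed.

Lemma nsq_fin f : in_A2 v f -> nsq v f = (fine (nsq v f))%:E.
Proof. by move=> [_ fin]; rewrite fineK // ge0_fin_numE // nsq_ge0. Qed.

(* The sub-mean value property over a ball on which the weight is bounded below. *)
Lemma local_bound z0 : Bn z0 -> exists r c, [/\ 0 < r, 0 <= c,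
  forall w, vnorm w <= 4 * r -> Bn (vadd z0 w) &
  forall f, in_A2 v f -> forall w, vnorm w <= 4 * r ->
    csq (f (vadd z0 w)) <= c * fine (nsq v f)].
Proof.
move=> /BnP Bz0; have z00 := vnorm_ge0 z0.
(* Since [|z0| + 8 r = rho < 1], balls of radius [4 r] around points at distance [4 r] from [z0]
   stay where the weight is at least [c0]. *)
pose r := (1 - vnorm z0) / 16; pose rho := (1 + vnorm z0) / 2.
have r0 : 0 < r by rewrite /r; lra.
have r40 : 0 < 4 * r by lra.
have rhoE : vnorm z0 + 4 * r + 4 * r = rho by rewrite /r /rho; lra.
have rho0 : 0 <= rho by rewrite /rho; lra.
have rho1 : rho < 1 by rewrite /rho; lra.
have rho2 : rho ^+ 2 < 1 by rewrite expr_lt1.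
pose c0 := expR (- (1 - rho ^+ 2)^-1).
have c00 : 0 < c0 by exact: expR_gt0.
have b0 := vball_gt0 Hv r40; have boo := vball_lty Hv (ltW r40).
have bE : v (@vball R n (4 * r)) = (fine (v (@vball R n (4 * r))))%:E.
  by rewrite fineK // ge0_fin_numE // measure_ge0.
pose b := fine (v (@vball R n (4 * r))).
have bb0 : 0 < b by rewrite -lte_fin -bE.
exists r, (c0 * b)^-1; split => //.
- by rewrite invr_ge0 mulr_ge0 // ltW.
- move=> w hw; apply/BnP; have := vnormD z0 w; lra.
move=> f fA w hw; have hf := in_A2_fhol fA.
have nearw x : vnorm x <= 4 * r -> vnorm (vadd (vadd z0 w) x) <= rho.
  by move=> hx; have := vnormD (vadd z0 w) x; have := vnormD z0 w; lra.
have := @sub_mean R n v Hv f (vadd z0 w) (@vball R n (4 * r)) hf (@measurable_vball R n _)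
   (@vball_circled _).
move=> H; have {}H : ((csq (f (vadd z0 w)))%:E * v (@vball R n (4 * r)) <=
    \int[v]_(x in @vball R n (4 * r)) (csq (f (vadd (vadd z0 w) (tz x))))%:E)%E.
  apply: H => x y; rewrite /vball /= -nrm2_le ?(ltW r40) // => hx y1.
  apply/BnP; apply: le_lt_trans rho1; apply: nearw.
  by rewrite vnorm_scale (le_trans _ hx) // ler_piMl // vnorm_ge0.
have sub : vshift (vadd z0 w) (@vball R n (4 * r)) `<=` [set y | vnorm (tz y) <= rho].
  move=> y; rewrite /vshift /vball /= ctK -nrm2_le ?(ltW r40) // => hy.
  by have := nearw _ hy; rewrite vadd_sub.
have subB : vshift (vadd z0 w) (@vball R n (4 * r)) `<=` BR.
  by move=> y /sub /= hy; apply/BnRP; exact: le_lt_trans hy rho1.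
have mS := measurable_vshift (vadd z0 w) (@measurable_vball R n (4 * r)).
have mB := @measurable_BnR R n.
rewrite (integral_vshift (F := fun z => csq (f z))) in H => //; last 3 first.
- exact: measurable_vball.
- exact: measurable_funS (fhol_measurable_csq hf).
- by move=> y; exact: csq_ge0.
have step : (c0%:E * \int[v]_(y in vshift (vadd z0 w) (@vball R n (4 * r))) (csq (f (tz y)))%:E <= nsq v f)%E.
  rewrite -ge0_integralZl_EFin ?(ltW c00) //; last 2 first.
  - by move=> y _; rewrite lee_fin csq_ge0.
  - by apply/measurable_EFinP; exact: measurable_funS (fhol_measurable_csq hf).
  apply: (@le_trans _ _ (\int[v]_(y in vshift (vadd z0 w) (@vball R n (4 * r))) (csq (f (tz y)) * weight y)%:E)%E).
    apply: ge0_le_integral => //.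
    - by move=> y _; rewrite -EFinM lee_fin mulr_ge0 ?csq_ge0 // ltW.
    - apply: measurable_funeM; apply/measurable_EFinP.
      exact: measurable_funS (fhol_measurable_csq hf).
    - by apply/measurable_EFinP; exact: measurable_funS (measurable_csq_weight hf).
    - move=> y /sub /= hy; rewrite -EFinM lee_fin mulrC ler_wpM2l ?csq_ge0 //.
      rewrite /c0 /weight /psi ler_expR lerN2 lef_pV2 ?posrE; last 2 first.
      + by rewrite subr_gt0 -sqr_vnorm expr_lt1 ?vnorm_ge0 // (le_lt_trans hy).
      + by rewrite subr_gt0.
      by rewrite lerD2l lerN2 -nrm2_le.
  apply: ge0_subset_integral => //.
    by apply/measurable_EFinP; exact: measurable_csq_weight.
  by move=> y _; rewrite lee_fin mulr_ge0 ?csq_ge0 ?weight_ge0.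
have c0e : (0 <= c0%:E)%E by rewrite lee_fin ltW.
have := le_trans (lee_wpmul2l c0e H) step.
rewrite bE (nsq_fin fA) -!EFinM lee_fin -/b => {}H.
rewrite mulrC ler_pdivlMr ?mulr_gt0 //.
by rewrite mulrCA.
Qed.

End BergmanSpace.

(** * Riesz representation through the reproducing kernel *)

Section BergmanRiesz.
Variables (R : realType) (n : nat).
Local Notation C := (complex R).
Local Notation V := (Cvec R n).
Local Notation T := (Rcoords R n).
Variable v : {measure set T -> \bar R}.
Hypothesis Hv : is_lebesgue v.
Local Notation BR := (@BnR R n).
Implicit Types f g phi : V -> C.

Definition rdot (a b : C) : R := complex.Re a * complex.Re b + complex.Im a * complex.Im b.

Definition cross f g (x : T) : R := rdot (f (tz x)) (g (tz x)) * weight x.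

(** The real part of the Hermitian product. Riesz representation takes place in the underlying real
    space; imaginary parts are recovered by pairing with [icomb]. *)
Definition ip f g : R := \int[v]_(x in BR) cross f g x.

Definition comb (a : R) f (b : R) g : V -> C :=
  fun z => Complex a 0 * f z + Complex b 0 * g z.

Lemma rdotC a b : rdot a b = rdot b a.
Proof. by rewrite /rdot ![complex.Re a * _]mulrC ![complex.Im a * _]mulrC. Qed.

Lemma rdotxx a : rdot a a = csq a.
Proof. by rewrite /rdot /csq -!expr2. Qed.

Lemma rdot_comb a b (x y z : C) :
  rdot (Complex a 0 * x + Complex b 0 * y) z = a * rdot x z + b * rdot y z.
Proof. by rewrite /rdot ReD ImD !ReM !ImM /=; ring. Qed.

Lemma cross_comb a f b g h x : cross (comb a f b g) h x = a * cross f h x + b * cross g h x.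
Proof. by rewrite /cross /comb rdot_comb; ring. Qed.

Lemma crossC f g x : cross f g x = cross g f x.
Proof. by rewrite /cross rdotC. Qed.

Lemma crossxx f x : cross f f x = csq (f (tz x)) * weight x.
Proof. by rewrite /cross rdotxx. Qed.

Lemma csq_quadratic t (a b : C) : csq (Complex t 0 * a + b) = t ^+ 2 * csq a + 2 * t * rdot a b + csq b.
Proof. by rewrite /csq /rdot ReD ImD ReM ImM /=; ring. Qed.

Lemma rdot_le (a b : C) : `|rdot a b| <= csq a + csq b.
Proof.
have h1 := csq_ge0 (Complex 1 0 * a + b); have h2 := csq_ge0 (Complex (-1) 0 * a + b).
by move: h1 h2; rewrite !csq_quadratic => h1 h2; rewrite ler_norml; apply/andP; split; lra.
Qed.

Lemma measurable_rdot f g : fhol f -> fhol g -> measurable_fun BR (fun x => rdot (f (tz x)) (g (tz x))).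
Proof.
move=> hf hg; rewrite /rdot; apply: measurable_funD; apply: measurable_funM;
  solve [exact: fhol_measurable_Re|exact: fhol_measurable_Im].
Qed.

Lemma cross_integrable f g : in_A2 v f -> in_A2 v g -> v.-integrable BR (EFin \o cross f g).
Proof.
move=> fA gA; have hf := in_A2_fhol fA; have hg := in_A2_fhol gA.
have mB := @measurable_BnR R n.
have isq h : in_A2 v h -> v.-integrable BR (fun x => (csq (h (tz x)) * weight x)%:E).
  move=> hA; apply/integrableP; split.
    by apply/measurable_EFinP; exact: measurable_csq_weight (in_A2_fhol hA).
  rewrite (eq_integral (fun x => (csq (h (tz x)) * weight x)%:E)); first by case: hA.
  by move=> x _ /=; rewrite ger0_norm // mulr_ge0 ?csq_ge0 ?weight_ge0.
apply: (le_integrable mB _ _ (integrableD mB (isq f fA) (isq g gA))).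
  apply/measurable_EFinP; apply: measurable_funM; first exact: measurable_rdot.
  exact: measurable_weight.
move=> x Bx /=; rewrite lee_fin [leRHS]ger0_norm; last first.
  by rewrite addr_ge0 // mulr_ge0 ?csq_ge0 ?weight_ge0.
rewrite /cross normrM (ger0_norm (weight_ge0 x)) -mulrDl ler_wpM2r ?weight_ge0 //.
exact: rdot_le.
Qed.

Lemma ip_self f : in_A2 v f -> ip f f = fine (nsq v f).
Proof.
by move=> _; rewrite /ip /Rintegral /nsq /wint; congr fine.
Qed.

Lemma ip_ge0 f : 0 <= ip f f.
Proof.
by apply: Rintegral_ge0 => x _; rewrite crossxx mulr_ge0 ?csq_ge0 ?weight_ge0.
Qed.

Lemma ipC f g : ip f g = ip g f.
Proof. by apply: eq_Rintegral => x _; rewrite crossC. Qed.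

Lemma ip_comb_gen a f b g h : v.-integrable BR (EFin \o cross f h) ->
  v.-integrable BR (EFin \o cross g h) -> ip (comb a f b g) h = a * ip f h + b * ip g h.
Proof.
move=> If Ig; have mB := @measurable_BnR R n.
rewrite /ip -!RintegralZl // -RintegralD //; last 2 first.
- exact: (integrableZl mB a If).
- exact: (integrableZl mB b Ig).
by apply: eq_Rintegral => x _; rewrite cross_comb.
Qed.

Lemma fdiff_comb a f b g z p q : fdiff f z p -> fdiff g z q ->
  fdiff (comb a f b g) z (fun j => Complex a 0 * p j + Complex b 0 * q j).
Proof.
move=> Df Dg; have N0 := @vnorm_ge0 R n.
apply: (odiff_ext (fun=> erefl) _ (odiffD (odiffZ N0 (Complex a 0) Df) (odiffZ N0 (Complex b 0) Dg))) => h.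
rewrite /vlin !mulr_sumr -big_split; by apply: eq_bigr => j _; rewrite mulrDl -!mulrA.
Qed.

Lemma fhol_comb a f b g : fhol f -> fhol g -> fhol (comb a f b g).
Proof.
move=> hf hg z Bz; have [p Dp] := hf z Bz; have [q Dq] := hg z Bz.
by eexists; exact: (fdiff_comb a b Dp Dq).
Qed.

Lemma in_A2_comb a f b g : in_A2 v f -> in_A2 v g -> in_A2 v (comb a f b g).
Proof.
move=> fA gA; have hf := in_A2_fhol fA; have hg := in_A2_fhol gA.
have mB := @measurable_BnR R n.
split; first by apply/holomorphicP; exact: fhol_comb.
have I1 := integrableZl mB (2 * a ^+ 2) (cross_integrable fA fA).
have I2 := integrableZl mB (2 * b ^+ 2) (cross_integrable gA gA).
have := integrable_lty mB (integrableD mB I1 I2).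
apply: le_lt_trans; rewrite /nsq /wint; apply: ge0_le_integral => //.
- by move=> x _; rewrite lee_fin mulr_ge0 ?csq_ge0 ?weight_ge0.
- by apply/measurable_EFinP; exact: measurable_csq_weight (fhol_comb a b hf hg).
- exact: measurable_int (integrableD mB I1 I2).
- move=> x _ /=; rewrite lee_fin !crossxx !mulrA -mulrDl ler_wpM2r ?weight_ge0 //.
  apply: le_trans (csqD_le _ _) _.
  by rewrite !csqM !csq_real mulrDr !mulrA.
Qed.

Definition icomb f : V -> C := fun z => Complex 0 1 * f z.

Lemma csq_i (c : C) : csq (Complex 0 1 * c) = csq c.
Proof. by rewrite csqM /csq /= expr0n expr1n add0r mul1r. Qed.

Lemma in_A2_icomb f : in_A2 v f -> in_A2 v (icomb f).
Proof.
move=> fA; have hf := in_A2_fhol fA; split.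
  apply/holomorphicP => z Bz; have [p Dp] := hf z Bz.
  exists (fun j => Complex 0 1 * p j).
  apply: (odiff_ext (fun=> erefl) _ (odiffZ (@vnorm_ge0 R n) (Complex 0 1) Dp)) => h.
  by rewrite /vlin mulr_sumr; apply: eq_bigr => j _; rewrite -mulrA.
have [_ fin] := fA; rewrite /nsq /wint in fin *.
by under eq_integral do rewrite csq_i.
Qed.

Lemma ip_cauchy_schwarz f g : in_A2 v f -> in_A2 v g -> ip f g ^+ 2 <= ip g g * ip f f.
Proof.
move=> fA gA; apply: integral_discriminant; [exact: measurable_BnR|exact: cross_integrable..| |].
  by move=> x _; rewrite crossxx mulr_ge0 ?csq_ge0 ?weight_ge0.
move=> x _ t; rewrite !crossxx /cross.
have := mulr_ge0 (csq_ge0 (Complex t 0 * f (tz x) + g (tz x))) (weight_ge0 x).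
by rewrite csq_quadratic; congr (_ <= _); ring.
Qed.

Lemma csq_close (a b : C) e : cabs (a - b) <= e -> e <= 1 ->
  `|csq a - csq b| <= e * (1 + 2 * cabs b).
Proof.
move=> ab e1; rewrite -!sqr_cabs subr_sqr normrM.
have h1 : `|cabs a - cabs b| <= e.
  rewrite ler_norml; have := cabsD (a - b) b; have := cabsD (b - a) a; rewrite !subrK.
  by rewrite (cabsBC b a); move=> *; apply/andP; split; lra.
apply: ler_pM => //; rewrite ger0_norm ?addr_ge0 ?cabs_ge0 //.
by move: h1; rewrite ler_norml => /andP[_ h1]; lra.
Qed.

Variable K : V -> V -> C.
Hypothesis HK : is_bergman_kernel v K.

Let phiR (z : V) : V -> C := fun w => conjc (K z w).

Lemma Re_cwint_kernel (z : V) g :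
  complex.Re (cwint v (fun w => K z w * g w)) = ip (phiR z) g.
Proof.
apply: eq_Rintegral => x _; rewrite ReM /cross /rdot /phiR; case: (K z _) => a b /=.
by ring.
Qed.

Lemma Im_cwint_kernel (z : V) g :
  complex.Im (cwint v (fun w => K z w * g w)) = ip (icomb (phiR z)) g.
Proof.
apply: eq_Rintegral => x _; rewrite ImM /cross /rdot /phiR /icomb ReM ImM.
by case: (K z _) => a b /=; ring.
Qed.

Lemma reproducing (z : V) f : Bn z -> in_A2 v f -> f z = cwint v (fun w => K z w * f w).
Proof.
move=> Bz fA; have [_ /(_ f fA) {1}->] := HK Bz.
by congr (cwint v _); apply/funext => w; rewrite mulrC.
Qed.

Section Representation.
Variables (g : V -> C) (B : R).
Hypothesis B0 : 0 <= B.
Hypothesis gint : forall phi, in_A2 v phi -> v.-integrable BR (EFin \o cross phi g).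
Hypothesis gB : forall phi, in_A2 v phi -> ip phi g ^+ 2 <= B * fine (nsq v phi).

Let F (z : V) : C := cwint v (fun w => K z w * g w).

(** Along the minimising sequence [f_ m z = <f_ m, K_z>] tends to [<g, K_z> = F z], so the
    reproducing kernel supplies the limit as an explicit function. It remains to see that this
    pointwise limit is holomorphic, of finite norm and a limit in norm as well. *)
Theorem riesz_kernel : [/\ in_A2 v F, (nsq v F <= (4 * B)%:E)%E &
  forall phi, in_A2 v phi -> ip F phi = ip phi g].
Proof.
have mB := @measurable_BnR R n.
have zeroA : in_A2 v (fun=> 0).
  split; first by apply/holomorphicP => z Bz; exists (fun=> 0) => e e0; exists 1; split => // h _;
    rewrite subrr sub0r cabsN /vlin big1 ?cabs0 ?mulr_ge0 ?vnorm_ge0 ?(ltW e0) // => j _; rewrite mul0r.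
  by rewrite /nsq /wint integral0_eq // => x _; rewrite csq0 mul0r.
have [f_ [fA fC fL fN]] := @minimising_sequence R (V -> C) (in_A2 v) comb ip
  (fun phi => ip phi g) B in_A2_comb (fun f g _ _ => ipC f g)
  (fun a f b g' h fA gA hA => ip_comb_gen a b (cross_integrable fA hA) (cross_integrable gA hA))
  (fun f _ => ip_ge0 f)
  (fun a f b g' fA gA => ip_comb_gen a b (gint fA) (gint gA)) B0
  (fun f fA => eq_ind_r (fun x => _ <= B * x) (gB fA) (ip_self fA)) _ zeroA.
have inv_small (e : R) : 0 < e -> exists N : nat, forall m : nat, (N <= m)%N -> m.+1%:R^-1 <= e :> R.
  move=> e0; exists (Num.truncn e^-1) => m Nm.
  rewrite invf_ple ?posrE //; apply: le_trans (ltW (truncnS_gt _)) _.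
  by rewrite ler_nat.
(* The real and imaginary parts of [f_ m z - F z] are the errors of [f_ m] against [phiR z] and
   [icomb (phiR z)]. *)
have cvF z : Bn z -> forall e, 0 < e -> exists N, forall m, (N <= m)%N -> cabs (f_ m z - F z) <= e.
  move=> Bz e e0; have KA : in_A2 v (phiR z) by case: (HK Bz).
  have iKA := in_A2_icomb KA.
  pose p := ip (phiR z) (phiR z) + ip (icomb (phiR z)) (icomb (phiR z)) + 1.
  have p0 : 0 < p by rewrite ltr_wpDl // addr_ge0 // ip_ge0.
  have [N HN] := inv_small (e ^+ 2 / p) (divr_gt0 (exprn_gt0 2 e0) p0).
  exists N => m /HN; rewrite ler_pdivlMr // => hm.
  have m0 : 0 <= m.+1%:R^-1 :> R by rewrite invr_ge0.
  rewrite -(ler_pXn2r (n := 2)) ?nnegrE ?cabs_ge0 ?(ltW e0) // sqr_cabs.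
  rewrite /csq ReD ReN ImD ImN (reproducing Bz (fA m)) /F.
  rewrite !Re_cwint_kernel !Im_cwint_kernel.
  have := fL m _ KA; have := fL m _ iKA; rewrite (ipC (f_ m)) [ip (f_ m) (phiR z)]ipC => h1 h2.
  by apply: le_trans (lerD h2 h1) _; rewrite -mulrDr (le_trans _ hm) // ler_wpM2l // /p lerDl.
(* The sequence is bounded in norm, hence uniformly bounded near [z0] by [local_bound]. *)
have hF : fhol F.
  move=> z0 Bz0; have [r [c [r0 c0 rB rf]]] := local_bound Hv Bz0.
  pose M := Num.sqrt (c * (4 * B + 2)).
  apply: (@fdiff_pointwise_limit R n f_ F z0 M r r0).
  - by move=> m w /rB Bw; exact: (in_A2_fhol (fA m)).
  - move=> m w hw; rewrite /cabs /M ler_wsqrtr //.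
    apply: le_trans (rf _ (fA m) w hw) _; rewrite ler_wpM2l // -ip_self //.
    apply: le_trans (fN m) _; rewrite lerD2l ler_piMr //.
    by rewrite invf_le1 // ler1n.
  - by move=> w /rB Bw; exact: cvF.
have cvcsq (h_ : nat -> V -> C) (h : V -> C) : (forall z, Bn z -> forall e, 0 < e ->
    exists N, forall m, (N <= m)%N -> cabs (h_ m z - h z) <= e) ->
  forall x : T, BR x -> forall e, 0 < e -> exists N, forall m, (N <= m)%N ->
    `|csq (h_ m (tz x)) * weight x - csq (h (tz x)) * weight x| <= e.
  move=> cv x Bx e e0.
  have k0 : 0 < 1 + 2 * cabs (h (tz x)) by rewrite ltr_pwDl // mulr_ge0 // cabs_ge0.
  have m0 : 0 < Num.min 1 (e / (1 + 2 * cabs (h (tz x)))) by rewrite lt_min ltr01 divr_gt0.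
  have [N HN] := cv (tz x) Bx _ m0; exists N => m /HN hm.
  rewrite -mulrBl normrM (ger0_norm (weight_ge0 x)).
  apply: (@le_trans _ _ (`|csq (h_ m (tz x)) - csq (h (tz x))| * 1)).
    by rewrite ler_wpM2l // weight_le1.
  rewrite mulr1; apply: le_trans (csq_close hm _) _; first by rewrite ge_min lexx.
  by rewrite -ler_pdivlMr // ge_min lexx orbT.
have nF : (nsq v F <= (4 * B)%:E)%E.
  apply: (fatou_le (h_ := fun k x => csq (f_ k (tz x)) * weight x)) => //.
  - by move=> k; exact: measurable_csq_weight (in_A2_fhol (fA k)).
  - by move=> k x _; rewrite mulr_ge0 ?csq_ge0 ?weight_ge0.
  - exact: cvcsq.
  - move=> e e0; have e2 : 0 < e / 2 by lra.
    have [N HN] := inv_small _ e2; exists N => k /HN hk.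
    rewrite -[leLHS]/(nsq v (f_ k)) (nsq_fin (fA k)) lee_fin -ip_self //.
    apply: le_trans (fN k) _; rewrite lerD2l.
    by move: (k.+1%:R^-1 : R) hk => q hk; lra.
have FA : in_A2 v F.
  split; first exact/holomorphicP.
  exact: le_lt_trans nF (ltry _).
split=> // phi pA.
(* Fatou's lemma in the Cauchy bound for [f_ k - f_ m] as [k] grows. *)
have close m : ip (comb 1 F (-1) (f_ m)) (comb 1 F (-1) (f_ m)) <= 2 * m.+1%:R^-1.
  have DA : in_A2 v (comb 1 F (-1) (f_ m)) by exact: in_A2_comb.
  rewrite ip_self // -lee_fin -nsq_fin //.
  apply: (fatou_le (h_ := fun k x => csq (comb 1 (f_ k) (-1) (f_ m) (tz x)) * weight x)) => //.
  - by move=> k; exact: measurable_csq_weight (in_A2_fhol (in_A2_comb 1 (-1) (fA k) (fA m))).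
  - by move=> k x _; rewrite mulr_ge0 ?csq_ge0 ?weight_ge0.
  - apply: (cvcsq (fun k => comb 1 (f_ k) (-1) (f_ m))) => z Bz e e0.
    have [N HN] := cvF z Bz e e0; exists N => k /HN; rewrite /comb.
    have -> : Complex (1 : R) 0 = 1 by [].
    by congr (cabs _ <= _); ring.
  - move=> e e0; have e2 : 0 < e / 2 by lra.
    have [N HN] := inv_small _ e2; exists N => k /HN hk.
    have cA := in_A2_comb 1 (-1) (fA k) (fA m).
    rewrite -[leLHS]/(nsq v _) (nsq_fin cA) lee_fin -ip_self //.
    apply: le_trans (fC k m) _; rewrite mulrDr addrC lerD2l.
    by move: (k.+1%:R^-1 : R) hk => q hk; lra.
(* From [(a - c)^2 <= 2 (a - b)^2 + 2 (b - c)^2] with [b = ip (f_ m) phi]: the first square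
   contributes 4, the second 2. *)
have sq m : (ip F phi - ip phi g) ^+ 2 <= 6 * m.+1%:R^-1 * ip phi phi.
  have DA : in_A2 v (comb 1 F (-1) (f_ m)) by exact: in_A2_comb.
  have h1 := ip_cauchy_schwarz DA pA.
  rewrite (ip_comb_gen _ _ (cross_integrable FA pA) (cross_integrable (fA m) pA)) in h1.
  have h2 := fL m phi pA; have h3 := ip_ge0 phi.
  have h4 := ler_wpM2l h3 (close m).
  have h5 := le_trans h1 h4.
  move: h2 h5; move: (ip F phi) (ip (f_ m) phi) (ip phi g) (ip phi phi) (m.+1%:R^-1 : R).
  move=> a b c p q h2 h5; have := sqr_ge0 (a - b - (b - c)); nra.
apply/eqP; rewrite -subr_eq0 -sqrf_eq0 eq_le sqr_ge0 andbT.
apply/ler_addgt0Pr => e e0; rewrite add0r.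
have p0 : 0 < 6 * (ip phi phi + 1) by have := ip_ge0 phi; lra.
have [N HN] := inv_small _ (divr_gt0 e0 p0).
apply: le_trans (sq N) _; have := HN N (leqnn N); rewrite ler_pdivlMr // => h.
have : 0 <= N.+1%:R^-1 :> R by rewrite invr_ge0.
have := ip_ge0 phi; move: h; move: (ip phi phi) (N.+1%:R^-1 : R) => a b h1 h2 h3. lra.
Qed.

End Representation.
End BergmanRiesz.

(** * Estimates of the test functions *)

Section KernelExponent.
Variable R : realType.
Implicit Types a b x y H : R.

(** In these three inequalities [a] and [b] stand for [1 - |z|^2] and [1 - |z + h|^2], [x + i y] for
    [<h, z>] and [H] for [|h|^2]. Here [|x| <= a / 8] forces [b >= a / 2], and the left side is at
    most [a^4 / 16] against [a^4 / 4] on the right. *)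
Lemma near_inequality a b x y H : 0 < a <= 1 -> 0 <= H <= a ^+ 2 / 64 ->
  x ^+ 2 + y ^+ 2 <= a ^+ 3 / 64 -> b = a - 2 * x - H ->
  [/\ a / 2 <= b, b <= 2 * a &
  a ^+ 2 * H + (a + b) * (x ^+ 2 + y ^+ 2) <= a * b * ((a - x) ^+ 2 + y ^+ 2)].
Proof.
move=> /andP[a0 a1] /andP[H0 H1] p1 bE.
have a2 : 0 < a ^+ 2 by rewrite exprn_gt0.
have a32 : a ^+ 3 <= a ^+ 2 by rewrite exprS ler_piMl // ltW.
have a21 : a ^+ 2 <= a by rewrite expr2 ler_piMl // ltW.
have y2 := sqr_ge0 y.
have xa : x ^+ 2 <= (a / 8) ^+ 2.
  by rewrite (_ : (a / 8) ^+ 2 = a ^+ 2 / 64); [lra|field].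
have xn : `|x| <= a / 8.
  by rewrite -(ler_pXn2r (n := 2)) ?nnegrE ?divr_ge0 ?(ltW a0) // real_normK ?num_real.
have {xn xa} [x1 x2] : - (a / 8) <= x /\ x <= a / 8 by apply/andP; rewrite -ler_norml.
have b1 : a / 2 <= b by lra.
have b2 : b <= 2 * a by lra.
split => //.
have Q : a ^+ 2 / 2 <= (a - x) ^+ 2 + y ^+ 2.
  have s1 : 0 <= 7 / 8 * a by lra.
  have s2 : 7 / 8 * a <= a - x by lra.
  have : (7 / 8 * a) ^+ 2 <= (a - x) ^+ 2.
    by rewrite ler_pXn2r ?nnegrE // (le_trans s1).
  have -> : (7 / 8 * a) ^+ 2 = 49 / 64 * a ^+ 2 by field.
  by lra.
have rhs : a * (a / 2) * (a ^+ 2 / 2) <= a * b * ((a - x) ^+ 2 + y ^+ 2).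
  have u1 : 0 <= a * (a / 2) by rewrite mulr_ge0 ?divr_ge0 // ltW.
  have u2 : 0 <= a ^+ 2 / 2 by rewrite divr_ge0 // ltW.
  have u3 : a * (a / 2) <= a * b by rewrite ler_wpM2l // ltW.
  exact: ler_pM.
apply: le_trans rhs.
have l1 : a ^+ 2 * H <= a ^+ 2 * (a ^+ 2 / 64) by rewrite ler_wpM2l // ltW.
have l2 : (a + b) * (x ^+ 2 + y ^+ 2) <= (3 * a) * (a ^+ 3 / 64).
  by apply: ler_pM => //; [lra|rewrite addr_ge0 ?sqr_ge0|lra].
apply: le_trans (lerD l1 l2) _.
have -> : a ^+ 2 * (a ^+ 2 / 64) + 3 * a * (a ^+ 3 / 64) = a ^+ 4 / 16 by field.
have -> : a * (a / 2) * (a ^+ 2 / 2) = a ^+ 4 / 4 by field.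
have a4 : 0 < a ^+ 4 by rewrite exprn_gt0.
lra.
Qed.

(** The numerator is at least [a (a H + x^2 + y^2)], while [b <= 3 a] and [(a - x)^2 + y^2 <= 4 a^2]
    bound the denominator by [12 a^4]. *)
Lemma middle_inequality a b x y H : 0 < a -> 0 < b -> 0 <= H -> b = a - 2 * x - H ->
  0 < (a - x) ^+ 2 + y ^+ 2 -> x ^+ 2 + y ^+ 2 <= a ^+ 2 ->
  H / (12 * a ^+ 2) + (x ^+ 2 + y ^+ 2) / (12 * a ^+ 3) <=
  (a ^+ 2 * H + (a + b) * (x ^+ 2 + y ^+ 2)) / (a * b * ((a - x) ^+ 2 + y ^+ 2)).
Proof.
move=> a0 b0 H0 bE Q0 pa.
have y2 := sqr_ge0 y; have p0 : 0 <= x ^+ 2 + y ^+ 2 by rewrite addr_ge0 ?sqr_ge0.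
have xn : `|x| <= a.
  by rewrite -(ler_pXn2r (n := 2)) ?nnegrE ?(ltW a0) // real_normK ?num_real //; lra.
have {xn} [x1 x2] : - a <= x /\ x <= a by apply/andP; rewrite -ler_norml.
have b3 : b <= 3 * a by lra.
have Q4 : (a - x) ^+ 2 + y ^+ 2 <= 4 * a ^+ 2.
  nra.
move: Q0 Q4; set Q := (a - x) ^+ 2 + y ^+ 2; set p := x ^+ 2 + y ^+ 2 in pa p0 *; move=> Q0 Q4.
have den : b * Q <= 12 * a ^+ 3.
  rewrite (_ : 12 * a ^+ 3 = (3 * a) * (4 * a ^+ 2)); last by ring.
  by apply: ler_pM => //; exact: ltW.
have a30 : 0 < 12 * a ^+ 3 by rewrite mulr_gt0 // exprn_gt0.
have bQ : 0 < b * Q by rewrite mulr_gt0.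
have iv : (12 * a ^+ 3)^-1 <= (b * Q)^-1 by rewrite lef_pV2.
rewrite (_ : _ / (a * b * Q) = (a * H + p + b * p / a) * (b * Q)^-1); last first.
  by field; rewrite !gt_eqF.
rewrite (_ : H / _ + _ = (a * H + p) * (12 * a ^+ 3)^-1); last by field; rewrite gt_eqF.
apply: ler_pM => //.
- by rewrite addr_ge0 // mulr_ge0 // ltW.
- by rewrite invr_ge0 ltW.
- by rewrite lerDl divr_ge0 ?mulr_ge0 // ltW.
Qed.

(** The term [b (x^2 + y^2)] of the numerator suffices, since the last factor of the denominator is
    at most [4 (x^2 + y^2)]. *)
Lemma far_inequality a b x y H : 0 < a -> 0 < b -> 0 <= H ->
  0 < (a - x) ^+ 2 + y ^+ 2 -> a ^+ 2 < x ^+ 2 + y ^+ 2 ->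
  (4 * a)^-1 <= (a ^+ 2 * H + (a + b) * (x ^+ 2 + y ^+ 2)) / (a * b * ((a - x) ^+ 2 + y ^+ 2)).
Proof.
move=> a0 b0 H0 Q0 pa.
have Q4 : (a - x) ^+ 2 + y ^+ 2 <= 4 * (x ^+ 2 + y ^+ 2).
  by have := sqr_ge0 (a + x); have := sqr_ge0 y; lra.
move: Q0 Q4; set Q := (a - x) ^+ 2 + y ^+ 2; set p := x ^+ 2 + y ^+ 2 in pa *; move=> Q0 Q4.
have p0 : 0 <= p by apply: le_trans (ltW pa); exact: sqr_ge0.
rewrite ler_pdivlMr ?mulr_gt0 // (_ : (4 * a)^-1 * _ = b * (Q / 4)); last by field; rewrite gt_eqF.
have h1 : b * (Q / 4) <= b * p by rewrite ler_wpM2l ?(ltW b0) //; lra.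
apply: le_trans h1 _; rewrite mulrDl.
have h2 : 0 <= a ^+ 2 * H by rewrite mulr_ge0 // sqr_ge0.
have h3 : 0 <= a * p by rewrite mulr_ge0 // ltW.
lra.
Qed.

End KernelExponent.

Section TestFunctions.
Variables (R : realType) (n : nat).
Local Notation C := (complex R).
Local Notation V := (Cvec R n).
Local Notation T := (Rcoords R n).
Variable v : {measure set T -> \bar R}.
Hypothesis Hv : is_lebesgue v.
Local Notation BR := (@BnR R n).
Implicit Types z w h : V.

Definition defect z : R := 1 - nrm2 z.

Lemma defect_gt0 z : (0 < defect z) <-> Bn z.
Proof. by rewrite /defect subr_gt0. Qed.

Lemma defect_le1 z : defect z <= 1.
Proof. by rewrite /defect gerBl nrm2_ge0. Qed.

Lemma defectD z h : defect (vadd z h) = defect z - 2 * complex.Re (cinner h z) - nrm2 h.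
Proof. by rewrite /defect nrm2D; ring. Qed.

(** Minus the logarithm of [|Phi_{2,z}(w)|^2 e^{-psi(w)}]; its symmetry transfers estimates on the
    box around [w] to the test function at [z]. *)
Definition kexp z w : R := psi z + psi w - 2 * complex.Re (1 - cinner w z)^-1.

Lemma kexp_sym z w : kexp z w = kexp w z.
Proof.
rewrite /kexp [psi z + _]addrC; congr (_ - 2 * _).
rewrite !ReV (cinner_conj w z); case: (cinner z w) => x y.
by rewrite /csq !ReD !ImD !ReN !ImN /= !sub0r !sqrrN.
Qed.

Lemma csq_cexp (c : C) : csq (cexp c) = expR (2 * complex.Re c).
Proof. by rewrite -sqr_cabs cabs_cexp -expRM_natl. Qed.

Lemma Phi2_weight z (x : T) : csq (Phi2 z (tz x)) * weight x = expR (- kexp z (tz x)).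
Proof.
rewrite /Phi2 csq_cexp /weight -expRD; congr expR.
by rewrite ReD ReN /kexp /=; field.
Qed.

Lemma Re_one_sub_gt0 z w : Bn z -> Bn w -> 0 < complex.Re (1 - cinner w z).
Proof.
move=> /BnP Bz /BnP Bw; rewrite ReD ReN /= subr_gt0.
apply: le_lt_trans (ler_norm _) _; apply: le_lt_trans (normRe_le _) _.
apply: le_lt_trans (cinner_le _ _) _.
have z0 := vnorm_ge0 z; have w0 := vnorm_ge0 w; nra.
Qed.

(** As [1 - <z + h, z> = a - s], the three fractions have the common denominator [a b |a - s|^2];
    substituting [|h|^2 = a - 2 Re s - b] exhibits the numerator as a sum of nonnegative terms. *)
Lemma kexpE z h : Bn z -> Bn (vadd z h) ->
  let s := cinner h z in let Q := (defect z - complex.Re s) ^+ 2 + complex.Im s ^+ 2 in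
  0 < Q /\ kexp z (vadd z h) = (defect z ^+ 2 * nrm2 h + (defect z + defect (vadd z h)) *
     (complex.Re s ^+ 2 + complex.Im s ^+ 2)) / (defect z * defect (vadd z h) * Q).
Proof.
move=> Bz Bw s Q; have := Re_one_sub_gt0 Bz Bw.
have a0 : 0 < defect z by apply/defect_gt0.
have b0 : 0 < defect (vadd z h) by apply/defect_gt0.
have E : 1 - cinner (vadd z h) z = Complex (defect z - complex.Re s) (- complex.Im s).
  rewrite cinnerDl cinnerxx -/s; apply: complex_eq.
    by rewrite ReD ReN ReD /= /defect; ring.
  by rewrite ImD ImN ImD /=; ring.
rewrite E /= => r0.
have Q0 : 0 < Q by rewrite /Q ltr_wpDr ?sqr_ge0 // exprn_gt0.
split => //; rewrite /kexp E ReV /csq /= sqrrN -/Q /psi -!/(defect _).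
have nE : nrm2 h = defect z - 2 * complex.Re s - defect (vadd z h) by rewrite defectD /s; ring.
rewrite nE /Q; move: Q0 a0 b0; rewrite /Q.
move: (defect z) (defect (vadd z h)) (complex.Re s) (complex.Im s) => a b x y Q0 a0 b0.
by field; rewrite !gt_eqF.
Qed.

(* A neighbourhood of the origin, so that z + Ebox z is a region around z on which kexp z
   stays bounded and which carries most of the mass of exp (- kexp z). *)
Definition Ebox z : set T := [set x | nrm2 (tz x) <= defect z ^+ 2 / 64 /\
   csq (cinner (tz x) z) <= defect z ^+ 3 / 64].

Lemma Ebox_near z h : Bn z -> Ebox z (ct h) ->
  [/\ Bn (vadd z h), defect z / 2 <= defect (vadd z h), defect (vadd z h) <= 2 * defect z &
   kexp z (vadd z h) <= 1].
Proof.
move=> Bz; rewrite /Ebox /= ctK => -[h1 h2].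
have a0 : 0 < defect z by apply/defect_gt0.
have a1 : 0 < defect z <= 1 by rewrite a0 defect_le1.
have H1 : 0 <= nrm2 h <= defect z ^+ 2 / 64 by rewrite nrm2_ge0.
have [b1 b2 b3] := near_inequality a1 H1 h2 (defectD z h).
have Bw : Bn (vadd z h) by apply/defect_gt0; apply: lt_le_trans b1; rewrite divr_gt0.
split => //; have [Q0 ->] := kexpE Bz Bw.
have b0 : 0 < defect (vadd z h) by apply/defect_gt0.
by rewrite ler_pdivrMr ?mul1r // !mulr_gt0.
Qed.

Lemma Ebox_scale z h (y : C) : cabs y <= 1 -> Ebox z (ct h) -> Ebox z (ct (vscale y h)).
Proof.
move=> y1; rewrite /Ebox /= !ctK nrm2_scale cinnerZl csqM => -[h1 h2].
have c1 : csq y <= 1 by rewrite -sqr_cabs expr_le1 ?cabs_ge0.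
by split; [apply: le_trans h1|apply: le_trans h2]; rewrite ler_piMl ?nrm2_ge0 ?csq_ge0.
Qed.

Lemma Ebox_circled z : circled (Ebox z).
Proof.
move=> x t Ex; have := @Ebox_scale z (tz x) (cis t); rewrite cabs_cis tzK.
by move=> /(_ (lexx _) Ex); rewrite /affine (_ : vadd _ _ = vscale (cis t) (tz x)) //; exact: vadd0.
Qed.

Lemma measurable_cinner d (X : measurableType d) (F G : X -> V) :
  (forall j, measurable_fun setT (fun x => complex.Re (F x j))) ->
  (forall j, measurable_fun setT (fun x => complex.Im (F x j))) ->
  (forall j, measurable_fun setT (fun x => complex.Re (G x j))) ->
  (forall j, measurable_fun setT (fun x => complex.Im (G x j))) ->
  measurable_fun setT (fun x => csq (cinner (F x) (G x))).
Proof.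
move=> Fr Fi Gr Gi; rewrite /csq /cinner.
apply: measurable_funD; apply: measurable_funX.
  under eq_fun do rewrite Re_sum; apply: measurable_sum => j.
  apply: (eq_measurable_fun (fun x => complex.Re (F x j) * complex.Re (G x j) +
     complex.Im (F x j) * complex.Im (G x j))).
    by move=> x _; rewrite ReM; case: (G x j) => a b /=; ring.
  by apply: measurable_funD; apply: measurable_funM.
under eq_fun do rewrite Im_sum; apply: measurable_sum => j.
apply: (eq_measurable_fun (fun x => complex.Im (F x j) * complex.Re (G x j) -
   complex.Re (F x j) * complex.Im (G x j))).
  by move=> x _; rewrite ImM; case: (G x j) => a b /=; ring.
by apply: measurable_funB; apply: measurable_funM.
Qed.

Lemma measurable_le_set d (X : measurableType d) (f g : X -> R) :
  measurable_fun setT f -> measurable_fun setT g -> measurable [set x | f x <= g x].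
Proof.
move=> mf mg; have := measurable_fun_ler mf mg.
move=> /(_ measurableT [set true] I); rewrite setTI.
by congr measurable; apply/seteqP; split => x /=.
Qed.

Lemma measurable_Ebox z : measurable (Ebox z).
Proof.
have mr := @measurable_Re_tz R n; have mi := @measurable_Im_tz R n.
apply: measurableI; apply: measurable_le_set => //.
  exact: measurable_nrm2_tz.
by apply: (measurable_cinner (F := @tz R n) (G := fun=> z)).
Qed.

Lemma Ebox_sub_vball z : Bn z -> Ebox z `<=` @vball R n 1.
Proof.
move=> Bz x [h1 _]; apply: le_trans h1 _.
have a0 : 0 < defect z by apply/defect_gt0.
rewrite expr1n ler_pdivrMr // mul1r; apply: (@le_trans _ _ 1); last by rewrite ler1n.
by rewrite expr_le1 ?defect_le1 // ltW.
Qed.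

Lemma Ebox_lty z : Bn z -> (v (Ebox z) < +oo)%E.
Proof.
move=> Bz; apply: le_lt_trans (vball_lty Hv (@ler01 R)).
apply: le_measure; rewrite ?inE; [exact: measurable_Ebox|exact: measurable_vball|].
exact: Ebox_sub_vball.
Qed.

Lemma vball_scale (r : R) : 0 < r -> v (@vball R n r) = ((r ^+ (2 * n))%:E * v (@vball R n 1))%E.
Proof.
move=> r0; have r1 : 0 < r^-1 by rewrite invr_gt0.
have := lebesgue_homothety (fun=> 0) Hv r1 (@measurable_vball R n 1); rewrite invrK => <-.
congr (v _); apply/seteqP; split => x; rewrite /vball /preimage /= /affine ctK vadd0 nrm2_scale csq_real
  exprVn expr1n mulrC ler_pdivrMr ?exprn_gt0 ?mul1r //.
Qed.

(** The ball of radius [a^2 / 8] fits into the box because [a^4 / 64 <= a^3 / 64]. The bound is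
    crude, but a power of [a] is all that the exponentially small tail requires. *)
Lemma Ebox_lower z : Bn z ->
  (((defect z ^+ 2 / 8) ^+ (2 * n))%:E * v (@vball R n 1) <= v (Ebox z))%E.
Proof.
move=> Bz; have a0 : 0 < defect z by apply/defect_gt0.
have r0 : 0 < defect z ^+ 2 / 8 by rewrite divr_gt0 // exprn_gt0.
rewrite -vball_scale //; apply: le_measure; rewrite ?inE;
  [exact: measurable_vball|exact: measurable_Ebox|].
move=> x; rewrite /vball /= => hx.
have e3 : (defect z ^+ 2 / 8) ^+ 2 <= defect z ^+ 3 / 64.
  rewrite exprMn exprVn -exprM (_ : 8 ^+ 2 = 64 :> R); last by ring.
  by rewrite ler_wpM2r // ler_wiXn2l ?defect_le1 // ltW.
have e2 : defect z ^+ 3 / 64 <= defect z ^+ 2 / 64.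
  by rewrite ler_wpM2r // ler_wiXn2l ?defect_le1 // ltW.
split; first exact: le_trans hx (le_trans e3 e2).
apply: le_trans (le_trans hx e3).
rewrite -sqr_cabs -sqr_vnorm ler_pXn2r ?nnegrE ?cabs_ge0 ?vnorm_ge0 //.
apply: le_trans (cinner_le _ _) _; rewrite ler_piMr ?vnorm_ge0 // ltW //.
exact/BnP.
Qed.

Lemma Ebox_gt0 z : Bn z -> (0 < v (Ebox z))%E.
Proof.
move=> Bz; apply: lt_le_trans (Ebox_lower Bz).
rewrite mule_gt0 ?vball_gt0 // lte_fin exprn_gt0 // divr_gt0 // exprn_gt0 //.
by apply/defect_gt0.
Qed.

(* q(x / 2) = q(x) / 4 lets the part of the integral where q > rho^2 be absorbed. *)
Lemma gaussian_bound (q : V -> R) : measurable_fun setT (fun x => q (tz x)) ->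
  (forall h, 0 <= q h) -> (forall h (t : R), q (vscale (Complex t 0) h) = t ^+ 2 * q h) ->
  (\int[v]_(x in @vball R n 2) (expR (- q (tz x)))%:E <=
   2%:E * v [set x | (q (tz x) <= 4 ^+ n.+1)%R])%E.
Proof.
move=> mq q0 qZ; set S := @vball R n 2; set J := (\int[v]_(x in S) _)%E.
pose rho2 : R := 4 ^+ n.+1.
have mS : measurable S by exact: measurable_vball.
have me : measurable_fun setT (fun x : T => expR (- q (tz x))) by do 2 apply: measurableT_comp => //.
have e0 x : (0 <= (expR (- q (tz x)))%:E)%E by rewrite lee_fin expR_ge0.
have mA : measurable [set x : T | q (tz x) <= rho2] by exact: measurable_le_set.
have Soo : (v S < +oo)%E by exact: vball_lty.
have Jfin : J \is a fin_num.
  rewrite ge0_fin_numE; last by apply: integral_ge0.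
  apply: (@le_lt_trans _ _ (\int[v]_(x in S) (cst 1%:E) x)%E); last by rewrite integral_cst // mul1e.
  apply: ge0_le_integral => //.
    by apply: measurable_funTS; apply/measurable_EFinP.
  by move=> x _; rewrite lee_fin expR_le1 oppr_le0.
(* Where [q > 4^(n+1)], three quarters of [q] exceed [3 * 4^n], so [expR (- q) <= k expR (- q / 4)].
   Halving the variable costs a factor [4^n], and [k 4^n <= 1/2] allows absorption, [J] being
   finite. *)
pose k : R := expR (- (3 * 4 ^+ n)).
have k4 : k * 4 ^+ n <= 2^-1.
  have p0 : 1 <= 4 ^+ n :> R by rewrite exprn_ege1 // ler1n.
  rewrite /k expRN mulrC ler_pdivrMr ?expR_gt0 //.
  by have := expR_ge1Dx (3 * 4 ^+ n : R); lra.
pose half := affine (Complex (2^-1 : R) 0) (fun=> 0 : C) : T -> T.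
have halfE x : tz (half x) = vscale (Complex 2^-1 0) (tz x) by rewrite /half /affine ctK vadd0.
have mh : measurable_fun setT (fun x : T => (expR (- q (tz (half x))))%:E).
  apply/measurable_EFinP; apply: (measurableT_comp me); exact: measurable_affine.
have subS : S `<=` half @^-1` S.
  move=> x; rewrite /S /vball /preimage /= halfE nrm2_scale csq_real => hx.
  apply: le_trans hx; rewrite ler_piMl ?nrm2_ge0 // exprVn invf_le1 ?exprn_gt0 //.
  by rewrite exprn_ege1 // ler1n.
have split x : S x -> ((expR (- q (tz x)))%:E <=
    (\1_[set x | (q (tz x) <= rho2)%R] x : R)%:E + k%:E * (expR (- q (tz (half x))))%:E)%E.
  move=> _; rewrite -EFinM -EFinD lee_fin indicE.
  have [le|gt] := leP (q (tz x)) rho2.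
    rewrite mem_set // ; apply: (@le_trans _ _ 1); first by rewrite expR_le1 oppr_le0.
    by rewrite lerDl mulr_ge0 ?expR_ge0.
  rewrite memNset ?add0r; last by move=> /=; rewrite leNgt gt.
  rewrite /k -expRD ler_expR halfE qZ.
  have E : rho2 = 4 * 4 ^+ n by rewrite /rho2 exprS.
  have -> : 2^-1 ^+ 2 = 4^-1 :> R by field.
  by move: gt; rewrite E; move: (q (tz x)) (4 ^+ n : R) => a b; lra.
have JE : (J <= v [set x | (q (tz x) <= rho2)%R] + (2^-1)%:E * J)%E.
  apply: (@le_trans _ _ (\int[v]_(x in S) ((\1_[set x | (q (tz x) <= rho2)%R] x : R)%:E +
     k%:E * (expR (- q (tz (half x))))%:E))%E).
    apply: ge0_le_integral => //.
    - by apply: measurable_funTS; apply/measurable_EFinP.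
    - apply: measurable_funTS; apply: emeasurable_funD; last exact: measurable_funeM.
      by apply/measurable_EFinP; exact: measurable_indic.
  have mI : measurable_fun S (fun x => (\1_[set x | (q (tz x) <= rho2)%R] x : R)%:E).
    by apply/measurable_EFinP; exact: measurable_indic.
  have mk : measurable_fun S (fun x => (k%:E * (expR (- q (tz (half x))))%:E)%E).
    by apply: measurable_funeM; exact: measurable_funTS.
  have k0 (x : T) : S x -> (0 <= k%:E * (expR (- q (tz (half x))))%:E)%E.
    by move=> _; rewrite -EFinM lee_fin mulr_ge0 ?expR_ge0.
  have i0 (x : T) : S x -> (0 <= (\1_[set x | (q (tz x) <= rho2)%R] x : R)%:E)%E.
    by move=> _; rewrite lee_fin.
  rewrite ge0_integralD //.
  apply: leeD.
    rewrite integral_indic //; apply: le_measure; rewrite ?inE //; exact: measurableI.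
  rewrite ge0_integralZl_EFin ?expR_ge0 //; last exact: measurable_funTS.
  apply: (@le_trans _ _ (k%:E * ((4 ^+ n)%:E * J))%E).
    apply: lee_wpmul2l; first by rewrite lee_fin expR_ge0.
    have h2 : 0 < 2^-1 :> R by rewrite invr_gt0.
    have := @integral_homothety R n v Hv (2^-1) (fun=> 0) S (fun x => (expR (- q (tz x)))%:E) h2 mS.
    move=> /(_ (measurable_funTS ((measurable_EFinP _ _).2 me)) (fun x _ => e0 x)).
    rewrite invrK exprM (_ : 2 ^+ 2 = 4 :> R); last by ring.
    move=> <-; apply: ge0_subset_integral => //; first exact: measurable_preimage_affine.
    by apply: measurable_funTS.
  rewrite muleA -EFinM; apply: lee_wpmul2r; first exact: integral_ge0.
  by rewrite lee_fin.
rewrite -/rho2.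
have [Aoo|Afin] := eqVneq (v [set x | q (tz x) <= rho2]) +oo%E.
  by rewrite Aoo mulry gtr0_sg // mul1e leey.
have Af : v [set x | q (tz x) <= rho2] \is a fin_num.
  by rewrite ge0_fin_numE ?measure_ge0 // ltey.
move: JE; rewrite -(fineK Jfin) -(fineK Af) -!EFinM -EFinD !lee_fin; lra.
Qed.

End TestFunctions.

Section TestFunctionNorms.
Variables (R : realType) (n : nat).
Local Notation C := (complex R).
Local Notation V := (Cvec R n).
Local Notation T := (Rcoords R n).
Variable v : {measure set T -> \bar R}.
Hypothesis Hv : is_lebesgue v.
Local Notation BR := (@BnR R n).
Implicit Types z w h : V.

Lemma fdiff_chain_cinner (phi : C -> C) z w l : cdiff phi (cinner w z) l ->
  exists a, fdiff (fun y => phi (cinner y z)) w a.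
Proof.
move=> D; pose c : V := fun j => conjc (z j).
have cE h : vlin c h = cinner h z by apply: eq_bigr => j _; rewrite mulrC.
have DF : odiff (@vnorm R n) (fun h => cinner (vadd w h) z) (cinner w z) (vlin c).
  move=> e e0; exists 1; split => // h _.
  rewrite (_ : _ - _ = 0); last by rewrite cinnerDl cE; ring.
  by rewrite cabs0 mulr_ge0 ?vnorm_ge0 // ltW.
exists (fun j => l * c j).
apply: (odiff_ext (fun=> erefl) _ (odiff_chain (@vnorm_ge0 R n) (vnorm_ge0 c) (vlin_le c) DF D)) => h.
by rewrite /vlin mulr_sumr; apply: eq_bigr => j _; rewrite mulrA.
Qed.

(** The parameter [s] is 1 for [Phi2] and [-1] for the factor that compensates the weight in
    [weighted_sub_mean]. *)
Lemma cdiff_exp_inv (s d c : C) : 1 - c != 0 ->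
  exists l, cdiff (fun y => cexp (s * (1 - y)^-1 + d)) c l.
Proof.
move=> c0.
have D : cdiff (fun y => 1 - y) c (-1).
  move=> e e0; exists 1; split => // y _.
  by rewrite (_ : _ - _ = 0); [rewrite cabs0 mulr_ge0 ?cabs_ge0 // ltW|ring].
have D1 := cdiff_comp D (cdiff_inv c0).
have D2 := cdiff_comp D1 (cdiff_affine s d _).
by eexists; exact: cdiff_comp D2 (cdiff_exp _).
Qed.

(** [Re (1 / c) <= 1 / Re c], and [Re c >= 1 - |z|] for [c = 1 - <w, z>]. *)
Lemma Phi2_bounded z : Bn z -> exists M, 0 <= M /\ forall w, Bn w -> csq (Phi2 z w) <= M.
Proof.
move=> Bz; have z1 : vnorm z < 1 by apply/BnP.
exists (expR (2 * (1 - vnorm z)^-1)); split; first exact: expR_ge0.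
move=> w Bw; rewrite /Phi2 csq_cexp ler_expR ler_pM2l // ReD ReN ReV /=.
have r0 := Re_one_sub_gt0 Bz Bw; set c := 1 - cinner w z in r0 *.
have rc : 1 - vnorm z <= complex.Re c.
  rewrite /c ReD ReN /= lerD2l lerN2; apply: le_trans (ler_norm _) _.
  apply: le_trans (normRe_le _) _; apply: le_trans (cinner_le _ _) _.
  by rewrite ler_piMl ?vnorm_ge0 // ltW //; apply/BnP.
have p0 : 0 <= 2^-1 * psi z.
  by rewrite mulr_ge0 // /psi invr_ge0 subr_ge0 ltW //; exact: Bz.
have q0 : 0 < csq c by rewrite /csq ltr_wpDr ?sqr_ge0 // exprn_gt0.
have : complex.Re c / csq c <= (1 - vnorm z)^-1; last by lra.
rewrite ler_pdivrMr // mulrC ler_pdivlMr; last by rewrite subr_gt0.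
apply: (@le_trans _ _ (complex.Re c * complex.Re c)).
  by rewrite ler_wpM2l // ltW.
by rewrite -expr2 /csq lerDl sqr_ge0.
Qed.

Lemma nsq_Phi2E z : nsq v (Phi2 z) = (\int[v]_(y in BR) (expR (- kexp z (tz y)))%:E)%E.
Proof. by apply: eq_integral => y _; rewrite Phi2_weight. Qed.

Lemma Phi2_in_A2 z : Bn z -> in_A2 v (Phi2 z).
Proof.
move=> Bz; have hP : fhol (Phi2 z).
  move=> w Bw; have r0 := Re_one_sub_gt0 Bz Bw.
  have c0 : 1 - cinner w z != 0 by apply: contraTneq r0 => ->; rewrite ltxx.
  have [l Dl] := cdiff_exp_inv 1 (- Complex (2^-1 * psi z) 0) c0.
  have [a Da] := fdiff_chain_cinner Dl.
  exists a; rewrite (_ : Phi2 z = fun y =>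
    cexp (1 * (1 - cinner y z)^-1 + - Complex (2^-1 * psi z) 0)) //.
  by apply/funext => y; rewrite mul1r.
split; first exact/holomorphicP.
have [M [M0 HM]] := Phi2_bounded Bz.
apply: (@le_lt_trans _ _ (\int[v]_(x in BR) (cst M%:E) x)%E).
  apply: ge0_le_integral => //.
  - exact: measurable_BnR.
  - by move=> x _; rewrite lee_fin mulr_ge0 ?csq_ge0 ?weight_ge0.
  - by apply/measurable_EFinP; exact: measurable_csq_weight.
  - move=> x Bx; rewrite lee_fin -[leRHS]mulr1; apply: ler_pM; rewrite ?csq_ge0 ?weight_ge0 ?weight_le1 //.
    exact: HM.
rewrite integral_cst; last exact: measurable_BnR.
by rewrite lte_mul_pinfty // BnR_lty.
Qed.

Lemma measurable_kexp z : Bn z -> measurable_fun BR (fun y => expR (- kexp z (tz y))).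
Proof.
move=> Bz; have := measurable_csq_weight (in_A2_fhol (Phi2_in_A2 Bz)).
by apply: eq_measurable_fun => y _; rewrite Phi2_weight.
Qed.

Lemma vshift_Ebox_sub z : Bn z -> vshift z (Ebox z) `<=` BR.
Proof.
move=> Bz y /(Ebox_near Bz)[]; rewrite vadd_sub => By _ _ _; exact: By.
Qed.

Lemma vshift_measure z (E : set T) : measurable E -> v (vshift z E) = v E.
Proof. by move=> mE; rewrite vshiftE lebesgue_translate. Qed.

Lemma nsq_Phi2_lower z : Bn z -> ((expR (-1))%:E * v (Ebox z) <= nsq v (Phi2 z))%E.
Proof.
move=> Bz; have mE := measurable_vshift z (@measurable_Ebox R n z).
have mB := @measurable_BnR R n.
rewrite nsq_Phi2E -(vshift_measure z (@measurable_Ebox R n z)) -integral_cst //.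
apply: (@le_trans _ _ (\int[v]_(y in vshift z (Ebox z)) (expR (- kexp z (tz y)))%:E)%E).
  apply: ge0_le_integral => //.
  - by move=> y _; rewrite /= lee_fin expR_ge0.
  - apply/measurable_EFinP; apply: measurable_funS (measurable_kexp Bz) => //.
    exact: vshift_Ebox_sub.
  - move=> y /(Ebox_near Bz)[_ _ _]; rewrite vadd_sub => k1.
    by rewrite /= lee_fin ler_expR lerN2.
apply: ge0_subset_integral => //.
- by apply/measurable_EFinP; exact: measurable_kexp.
- exact: vshift_Ebox_sub.
Qed.

Lemma nsq_Phi2_gt0 z : Bn z -> 0 < fine (nsq v (Phi2 z)).
Proof.
move=> Bz; rewrite -lte_fin -nsq_fin; last exact: Phi2_in_A2.
apply: lt_le_trans (nsq_Phi2_lower Bz).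
by rewrite mule_gt0 ?lte_fin ?expR_gt0 // Ebox_gt0.
Qed.

Lemma Ebox_fin z : Bn z -> v (Ebox z) = (fine (v (Ebox z)))%:E.
Proof. by move=> Bz; rewrite fineK // ge0_fin_numE ?measure_ge0 // Ebox_lty. Qed.

Lemma dilate_measure (lam : R) (E : set T) : 0 < lam -> measurable E ->
  v (affine (Complex lam^-1 0) (fun=> 0) @^-1` E) = ((lam ^+ (2 * n))%:E * v E)%E.
Proof.
by move=> l0 mE; rewrite (lebesgue_homothety _ Hv) ?invr_gt0 // invrK.
Qed.

(** The box around [w + h] lies in the dilate by 5 of the box around [w]. Changing [<x, w + h>] into
    [<x, w>] costs [<x, h>], whose square is of order [a^4 <= a^3]; since the defect at most
    doubles, [|<x, w>|^2] stays below [25 a^3 / 64]. *)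
Lemma Ebox_compare w h : Bn w -> Ebox w (ct h) ->
  (v (Ebox (vadd w h)) <= (5 ^+ (2 * n))%:E * v (Ebox w))%E.
Proof.
move=> Bw Eh; have [Bz b1 b2 _] := Ebox_near Bw Eh.
have a0 : 0 < defect w by apply/defect_gt0.
have b0 : 0 < defect (vadd w h) by apply/defect_gt0.
rewrite -dilate_measure //; last exact: measurable_Ebox.
apply: le_measure; rewrite ?inE; [exact: measurable_Ebox| |].
  by apply: measurable_preimage_affine; exact: measurable_Ebox.
move: Eh; rewrite /Ebox /= ctK => -[h1 h2] x [x1 x2].
rewrite /preimage /= /affine ctK vadd0 nrm2_scale csq_real cinnerZl csqM csq_real.
have a1 := defect_le1 w.
have bsq : defect (vadd w h) ^+ 2 <= 4 * defect w ^+ 2.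
  by rewrite (_ : 4 * _ = (2 * defect w) ^+ 2); [rewrite ler_pXn2r ?nnegrE ?mulr_ge0 // ltW|ring].
have bcu : defect (vadd w h) ^+ 3 <= 8 * defect w ^+ 3.
  by rewrite (_ : 8 * _ = (2 * defect w) ^+ 3); [rewrite ler_pXn2r ?nnegrE ?mulr_ge0 // ltW|ring].
have a32 : defect w ^+ 4 <= defect w ^+ 3 by rewrite ler_wiXn2l // ltW.
have q1 : csq (cinner (tz x) w) <= 2 * (csq (cinner (tz x) (vadd w h)) + nrm2 (tz x) * nrm2 h).
  rewrite (_ : cinner (tz x) w = cinner (tz x) (vadd w h) + - cinner (tz x) h); last first.
    by rewrite cinnerDr addrK.
  apply: le_trans (csqD_le _ _) _; rewrite csqN ler_pM2l // lerD2l.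
  rewrite -sqr_cabs -!sqr_vnorm -exprMn ler_pXn2r ?nnegrE ?cabs_ge0 ?mulr_ge0 ?vnorm_ge0 //.
  exact: cinner_le.
have q2 : nrm2 (tz x) * nrm2 h <= (4 * defect w ^+ 2 / 64) * (defect w ^+ 2 / 64).
  by apply: ler_pM; rewrite ?nrm2_ge0 // (le_trans x1) // ler_wpM2r.
have q3 : (4 * defect w ^+ 2 / 64) * (defect w ^+ 2 / 64) = defect w ^+ 4 / 1024 by field.
rewrite q3 in q2.
have c5 : 5^-1 ^+ 2 = 25^-1 :> R by field.
have a20 : 0 < defect w ^+ 2 by rewrite exprn_gt0.
have a30 : 0 < defect w ^+ 3 by rewrite exprn_gt0.
rewrite c5; split.
  by clear -x1 bsq a20; lra.
by clear -q1 q2 x2 bcu a32 a30; lra.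
Qed.

End TestFunctionNorms.

(** * Upper bound for the test functions and the weighted sub-mean value property *)

Section CarlesonBound.
Variables (R : realType) (n : nat).
Local Notation C := (complex R).
Local Notation V := (Cvec R n).
Local Notation T := (Rcoords R n).
Variable v : {measure set T -> \bar R}.
Hypothesis Hv : is_lebesgue v.
Local Notation BR := (@BnR R n).
Implicit Types z w h : V.

Let qform z h : R := nrm2 h / (12 * defect z ^+ 2) + csq (cinner h z) / (12 * defect z ^+ 3).

(** The Gaussian term covers [|<h, z>| <= a] ([middle_inequality]), the constant one [|<h, z>| > a]
    ([far_inequality]). *)
Let kexp_split z w : Bn z -> Bn w ->
  expR (- kexp z w) <= expR (- qform z (vsub w z)) + expR (- (4 * defect z)^-1).
Proof.
move=> Bz; rewrite -{1 2}(vadd_sub z w); move: (vsub w z) => h Bw.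
have a0 : 0 < defect z by apply/defect_gt0.
have b0 : 0 < defect (vadd z h) by apply/defect_gt0.
have [Q0 ->] := kexpE Bz Bw.
have [le|lt] := leP (csq (cinner h z)) (defect z ^+ 2).
  have H := middle_inequality a0 b0 (nrm2_ge0 h) (defectD z h) Q0 le.
  by apply: (@le_trans _ _ (expR (- qform z h))); [rewrite ler_expR lerN2|rewrite lerDl expR_ge0].
have H := far_inequality a0 b0 (nrm2_ge0 h) Q0 lt.
by apply: (@le_trans _ _ (expR (- (4 * defect z)^-1))); [rewrite ler_expR lerN2|rewrite lerDr expR_ge0].
Qed.

Let rho : R := 2 ^+ n.+1.

(** [rho^2] is the threshold of [gaussian_bound]. The sublevel set lies in the dilate of the box by
    [32 rho], because [12 * 64 <= 32^2]. *)
Let qform_sublevel z : Bn z ->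
  (v [set x | (qform z (tz x) <= 4 ^+ n.+1)%R] <= ((32 * rho) ^+ (2 * n))%:E * v (Ebox z))%E.
Proof.
move=> Bz; have a0 : 0 < defect z by apply/defect_gt0.
have rho0 : 0 < rho by rewrite exprn_gt0.
have rho2 : 4 ^+ n.+1 = rho ^+ 2 by rewrite /rho -exprM mulnC exprM; congr (_ ^+ _); ring.
have mE := @measurable_Ebox R n z.
rewrite -dilate_measure // ?mulr_gt0 //.
have mr := @measurable_Re_tz R n; have mi := @measurable_Im_tz R n.
apply: le_measure; rewrite ?inE.
- apply: measurable_le_set => //; rewrite /qform; apply: measurable_funD; apply: measurable_funM => //.
    exact: measurable_nrm2_tz.
  by apply: (measurable_cinner (F := @tz R n) (G := fun=> z)).
- exact: measurable_preimage_affine.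
move=> x /=; rewrite rho2 /qform /Ebox /preimage /= /affine ctK vadd0 nrm2_scale csq_real
  cinnerZl csqM csq_real => H.
have a20 : 0 < 12 * defect z ^+ 2 by rewrite mulr_gt0 // exprn_gt0.
have a30 : 0 < 12 * defect z ^+ 3 by rewrite mulr_gt0 // exprn_gt0.
have n0 := nrm2_ge0 (tz x); have c0 := csq_ge0 (cinner (tz x) z).
have H1 : nrm2 (tz x) / (12 * defect z ^+ 2) <= rho ^+ 2.
  by apply: le_trans H; rewrite lerDl divr_ge0 // ltW.
have H2 : csq (cinner (tz x) z) / (12 * defect z ^+ 3) <= rho ^+ 2.
  by apply: le_trans H; rewrite lerDr divr_ge0 // ltW.
have r20 : 0 < rho ^+ 2 by rewrite exprn_gt0.
have K2 : (32 * rho) ^+ 2 = 1024 * rho ^+ 2 by ring.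
have K0 : 0 < (32 * rho) ^+ 2 by rewrite exprn_gt0 // mulr_gt0.
have fin (y d : R) : 0 <= d -> y <= rho ^+ 2 * (12 * d) -> ((32 * rho) ^+ 2)^-1 * y <= d / 64.
  move=> d0 yd; rewrite ler_pdivrMl // K2.
  have := mulr_ge0 (ltW r20) d0; move: yd; rewrite mulrA; move: (rho ^+ 2) => r yd rd.
  by clear -yd rd; lra.
move: H1 H2; rewrite !ler_pdivrMr // exprVn => H1 H2.
by split; apply: fin => //; rewrite exprn_ge0 // ltW.
Qed.

(** The term of degree [N = 4 n + 1] of the exponential series gives [e^{-1/(4a)} <= N! (4a)^N]; of
    the [N] factors [a], [4 n] match the volume of the ball inscribed in the box and one is bounded
    by 1. *)
Let tail_bound z : Bn z -> expR (- (4 * defect z)^-1) <=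
  (4 * n).+1`!%:R * 4 ^+ (4 * n).+1 * 8 ^+ (2 * n) * (defect z ^+ 2 / 8) ^+ (2 * n).
Proof.
move=> Bz; have a0 : 0 < defect z by apply/defect_gt0.
have t0 : 0 < (4 * defect z)^-1 by rewrite invr_gt0 mulr_gt0.
have := expR_ge1Dxn (4 * n) (ltW t0); set N := (4 * n).+1; set F : R := N`!%:R => H.
have F0 : 0 < F by rewrite ltr0n fact_gt0.
have tN : 0 < (4 * defect z)^-1 ^+ N / F by rewrite divr_gt0 // exprn_gt0.
have {}H : (4 * defect z)^-1 ^+ N / F <= expR (4 * defect z)^-1 by apply: le_trans H; rewrite lerDr.
rewrite expRN; apply: (@le_trans _ _ ((4 * defect z)^-1 ^+ N / F)^-1).
  by rewrite lef_pV2 // posrE expR_gt0.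
rewrite invf_div exprVn invrK exprMn [defect z ^+ N]exprS exprMn exprVn -exprM.
rewrite (_ : (2 * (2 * n) = 4 * n)%N); last by rewrite mulnA.
have d0 : 0 <= defect z ^+ (4 * n) by rewrite exprn_ge0 // ltW.
have e0 : 0 < 8 ^+ (2 * n) :> R by rewrite exprn_gt0.
rewrite -!mulrA; apply: ler_wpM2l; first exact: ltW.
apply: ler_wpM2l; first by rewrite exprn_ge0.
rewrite [8 ^+ _ * _]mulrC -mulrA mulVf ?gt_eqF // mulr1 ler_piMl //.
exact: defect_le1.
Qed.

Lemma nsq_Phi2_upper : exists Cn : R, 0 < Cn /\
  forall z, Bn z -> (nsq v (Phi2 z) <= Cn%:E * v (Ebox z))%E.
Proof.
have rho0 : 0 < rho by rewrite exprn_gt0.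
pose C1 : R := 2 * (32 * rho) ^+ (2 * n).
pose C2 : R := (4 * n).+1`!%:R * 4 ^+ (4 * n).+1 * 8 ^+ (2 * n).
have C10 : 0 < C1 by rewrite mulr_gt0 // exprn_gt0 // mulr_gt0.
have C20 : 0 < C2 by rewrite !mulr_gt0 ?exprn_gt0 // ltr0n fact_gt0.
exists (C1 + C2); split; first exact: addr_gt0.
move=> z Bz; rewrite nsq_Phi2E.
have mB := @measurable_BnR R n.
have mS := @measurable_vball R n 2.
have mr := @measurable_Re_tz R n; have mi := @measurable_Im_tz R n.
have a0 : 0 < defect z by apply/defect_gt0.
have q0 h : 0 <= qform z h.
  have i2 : 0 <= 12 * defect z ^+ 2 by rewrite mulr_ge0 // exprn_ge0 // ltW.
  have i3 : 0 <= 12 * defect z ^+ 3 by rewrite mulr_ge0 // exprn_ge0 // ltW.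
  by rewrite /qform addr_ge0 ?divr_ge0 ?nrm2_ge0 ?csq_ge0.
have qZ h (t : R) : qform z (vscale (Complex t 0) h) = t ^+ 2 * qform z h.
  by rewrite /qform nrm2_scale cinnerZl csqM csq_real; ring.
have mq : measurable_fun setT (fun x : T => qform z (tz x)).
  rewrite /qform; apply: measurable_funD; apply: measurable_funM => //.
    exact: measurable_nrm2_tz.
  by apply: (measurable_cinner (F := @tz R n) (G := fun=> z)).
have mq' : measurable_fun setT (fun x : T => expR (- qform z (vsub (tz x) z))).
  have := measurableT_comp mq (measurable_affine (1 : C) (fun j => - z j)).
  move=> H; do 2 apply: measurableT_comp => //; apply: eq_measurable_fun H => x _ /=.
  by rewrite /affine ctK vscale1.
have mq'E D : measurable_fun D (fun x : T => (expR (- qform z (vsub (tz x) z)))%:E).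
  by apply: measurable_funTS; apply/measurable_EFinP.
apply: (@le_trans _ _ (\int[v]_(y in BR) ((expR (- qform z (vsub (tz y) z)))%:E +
    (expR (- (4 * defect z)^-1))%:E))%E).
  apply: ge0_le_integral => //.
  - by apply/measurable_EFinP; exact: (measurable_kexp Hv Bz).
  - by apply: emeasurable_funD.
  - by move=> y By; rewrite -EFinD lee_fin; exact: kexp_split.
rewrite ge0_integralD //; try by move=> y _; rewrite lee_fin expR_ge0.
rewrite integral_cst // EFinD ge0_muleDl ?lee_fin ?(ltW C10) ?(ltW C20) //.
apply: leeD.
  (* Both points lie in the unit ball, so their difference lies in the ball of radius 2 of
     [gaussian_bound]. *)
  apply: (@le_trans _ _ (\int[v]_(y in vshift z (@vball R n 2)) (expR (- qform z (vsub (tz y) z)))%:E)%E).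
    apply: ge0_subset_integral => //; first exact: measurable_vshift.
    move=> y /BnRP By; rewrite /vshift /vball /= ctK -nrm2_le //.
    have := vnormD (tz y) (fun j => - z j); have /BnP Bz' := Bz.
    have -> : vnorm (fun j => - z j) = vnorm z.
      by rewrite /vnorm /nrm2; congr (Num.sqrt _); apply: eq_bigr => j _; rewrite csqN.
    by move=> h; apply: le_trans h _; lra.
  rewrite -(integral_vshift Hv (F := fun y => expR (- qform z (vsub y z)))) //; last exact: measurable_funTS.
  rewrite (eq_integral (fun x : T => (expR (- qform z (tz x)))%:E)); last first.
    by move=> x _; congr (expR (- qform z _))%:E; apply/funext => j; rewrite /vsub /vadd addrC addKr.
  apply: le_trans (gaussian_bound Hv mq q0 qZ) _.
  rewrite /C1 EFinM -muleA; apply: lee_wpmul2l; first by rewrite lee_fin.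
  exact: qform_sublevel.
apply: (@le_trans _ _ ((C2 * (defect z ^+ 2 / 8) ^+ (2 * n))%:E * v (@vball R n 1))%E).
  apply: lee_pmul => //; rewrite ?lee_fin ?expR_ge0 //; first exact: tail_bound.
  by apply: le_measure; rewrite ?inE //; [exact: measurable_vball|exact: BnR_vball].
rewrite EFinM -muleA; apply: lee_wpmul2l; first by rewrite lee_fin ltW.
exact: Ebox_lower.
Qed.

(* The factor cexp (- 1 / (1 - <., w>)) turns the weight into a bounded quantity
   near w while keeping holomorphy. *)
Lemma weighted_sub_mean (f : V -> C) w : in_A2 v f -> Bn w ->
  ((csq (f w) * expR (- psi w))%:E * v (Ebox w) <= (expR 1)%:E *
   \int[v]_(y in vshift w (Ebox w)) (csq (f (tz y)) * weight y)%:E)%E.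
Proof.
move=> fA Bw; have hf := in_A2_fhol fA.
pose G (y : V) : C := f y * cexp (-1 * (1 - cinner y w)^-1 + 0).
have hG : fhol G.
  move=> y By; have r0 := Re_one_sub_gt0 Bw By.
  have c0 : 1 - cinner y w != 0 by apply: contraTneq r0 => ->; rewrite ltxx.
  have [l Dl] := cdiff_exp_inv (-1) 0 c0.
  have [b Db] := fdiff_chain_cinner Dl.
  have [a Da] := hf y By.
  have K0 : 0 <= vnorm a + vnorm b by rewrite addr_ge0 ?vnorm_ge0.
  have ba h : cabs (vlin a h) <= (vnorm a + vnorm b) * vnorm h.
    by apply: le_trans (vlin_le _ _) _; rewrite ler_wpM2r ?vnorm_ge0 // lerDl vnorm_ge0.
  have bb h : cabs (vlin b h) <= (vnorm a + vnorm b) * vnorm h.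
    by apply: le_trans (vlin_le _ _) _; rewrite ler_wpM2r ?vnorm_ge0 // lerDr vnorm_ge0.
  exists (fun j => a j * cexp (-1 * (1 - cinner y w)^-1 + 0) + f y * b j).
  apply: (odiff_ext (fun=> erefl) _ (odiffM (@vnorm_ge0 R n) K0 ba bb Da Db)) => h.
  rewrite /vlin mulr_suml mulr_sumr -big_split; apply: eq_bigr => j _ /=; by rewrite mulrDl mulrA mulrAC.
have csqG y : csq (G y) = csq (f y) * expR (- 2 * complex.Re (1 - cinner y w)^-1).
  rewrite /G csqM csq_cexp; congr (_ * expR _).
  by rewrite addr0 mulN1r ReN mulrN mulNr.
(* At [w] the factor has squared modulus [expR (- 2 psi w)]; one of the two exponentials is
   cancelled at the end against the one in the bound [I]. *)
have Gw : csq (G w) = csq (f w) * expR (- psi w) * expR (- psi w).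
  rewrite csqG -mulrA -expRD cinnerxx; congr (_ * expR _).
  have -> : 1 - Complex (nrm2 w) 0 = Complex (defect w) 0.
    by apply: complex_eq; rewrite ?ReD ?ImD ?ReN ?ImN /= ?subr0.
  rewrite ReV csq_real /= /psi -/(defect w).
  have d0 : defect w != 0 by rewrite gt_eqF //; apply/defect_gt0.
  by field.
have mE := @measurable_Ebox R n w; have mS := measurable_vshift w mE.
have subB := vshift_Ebox_sub Bw; have mB := @measurable_BnR R n.
have H := @sub_mean R n v Hv G w (Ebox w) hG mE (@Ebox_circled R n w).
have {}H : ((csq (G w))%:E * v (Ebox w) <=
    \int[v]_(y in vshift w (Ebox w)) (csq (G (tz y)))%:E)%E.
  rewrite -(integral_vshift Hv (F := fun y => csq (G y))) //.
  - apply: H => x y Ex y1.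
    have Es : Ebox w (ct (vscale y (tz x))) by apply: Ebox_scale => //; rewrite tzK.
    by have [Bwy _ _ _] := Ebox_near Bw Es.
  - exact: measurable_funS (fhol_measurable_csq hG).
  - by move=> y; exact: csq_ge0.
have E0 := expR_gt0 (- psi w).
(* On the box [kexp w y <= 1] reads [- 2 Re (1 / (1 - <y, w>)) <= 1 - psi w - psi y]. *)
have I : (\int[v]_(y in vshift w (Ebox w)) (csq (G (tz y)))%:E <=
   (expR (- psi w) * expR 1)%:E * \int[v]_(y in vshift w (Ebox w)) (csq (f (tz y)) * weight y)%:E)%E.
  rewrite -ge0_integralZl_EFin ?mulr_ge0 ?expR_ge0 //; last 2 first.
  - by move=> y _; rewrite lee_fin mulr_ge0 ?csq_ge0 ?weight_ge0.
  - by apply/measurable_EFinP; exact: measurable_funS (measurable_csq_weight hf).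
  apply: ge0_le_integral => //.
  - by move=> y _; rewrite lee_fin csq_ge0.
  - by apply/measurable_EFinP; exact: measurable_funS (fhol_measurable_csq hG).
  - apply: measurable_funeM; apply/measurable_EFinP.
    exact: measurable_funS (measurable_csq_weight hf).
  - move=> y Ey; have [_ _ _] := Ebox_near Bw Ey; rewrite vadd_sub => k1.
    rewrite -EFinM lee_fin csqG mulrCA ler_wpM2l ?csq_ge0 // /weight -!expRD ler_expR.
    by move: k1; rewrite /kexp; lra.
have := le_trans H I; rewrite Gw.
rewrite (_ : csq (f w) * _ * _ = expR (- psi w) * (csq (f w) * expR (- psi w))); last by ring.
by rewrite !EFinM -!muleA lee_pmul2l ?lte_fin // -muleA.
Qed.

End CarlesonBound.

(** * Carleson measures and Toeplitz operators *)

Section Averaging.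
Variables (R : realType) (n : nat).
Local Notation C := (complex R).
Local Notation V := (Cvec R n).
Local Notation T := (Rcoords R n).
Variable v : {measure set T -> \bar R}.
Hypothesis Hv : is_lebesgue v.
Local Notation BR := (@BnR R n).
Variables (u : V -> R) (M : R).
Hypothesis u_meas : measurable_fun BR (fun x => u (tz x)).
Hypothesis u_ge0 : forall z, Bn z -> 0 <= u z.
Hypothesis uM : forall z, Bn z -> (uhat v u z <= M%:E)%E.

(** Pairs [(w, z)] with [z] in the box around [w]. The box is attached to the variable of [u]; the
    symmetry of [kexp] and [Ebox_compare] make it usable for fixed [z]. *)
Let region : set (T * T) := [set wz | Ebox (tz wz.1) (ct (vsub (tz wz.2) (tz wz.1)))].

Let measurable_region : measurable region.
Proof.
have r1 j : measurable_fun setT (fun x : T * T => complex.Re (tz x.1 j)).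
  exact: (measurableT_comp (measurable_Re_tz j) measurable_fst).
have i1 j : measurable_fun setT (fun x : T * T => complex.Im (tz x.1 j)).
  exact: (measurableT_comp (measurable_Im_tz j) measurable_fst).
have r2 j : measurable_fun setT (fun x : T * T => complex.Re (tz x.2 j)).
  exact: (measurableT_comp (measurable_Re_tz j) measurable_snd).
have i2 j : measurable_fun setT (fun x : T * T => complex.Im (tz x.2 j)).
  exact: (measurableT_comp (measurable_Im_tz j) measurable_snd).
have r3 j : measurable_fun setT (fun x : T * T => complex.Re (vsub (tz x.2) (tz x.1) j)).
  by rewrite /vsub; under eq_fun do rewrite ReD ReN; exact: measurable_funB.
have i3 j : measurable_fun setT (fun x : T * T => complex.Im (vsub (tz x.2) (tz x.1) j)).
  by rewrite /vsub; under eq_fun do rewrite ImD ImN; exact: measurable_funB.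
have md : measurable_fun setT (fun x : T * T => defect (tz x.1)).
  by rewrite /defect; apply: measurable_funB => //; exact: (measurable_nrm2 (F := fun x : T * T => tz x.1)).
rewrite (_ : region = [set x | nrm2 (vsub (tz x.2) (tz x.1)) <= defect (tz x.1) ^+ 2 / 64] `&`
   [set x | csq (cinner (vsub (tz x.2) (tz x.1)) (tz x.1)) <= defect (tz x.1) ^+ 3 / 64]); last first.
  by apply/seteqP; split => x; rewrite /region /Ebox /= ctK.
apply: measurableI; apply: measurable_le_set.
- exact: (measurable_nrm2 (F := fun x : T * T => vsub (tz x.2) (tz x.1))).
- by apply: measurable_funM => //; exact: measurable_funX.
- exact: (measurable_cinner (F := fun x : T * T => vsub (tz x.2) (tz x.1)) (G := fun x => tz x.1)).
- by apply: measurable_funM => //; exact: measurable_funX.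
Qed.

Let sectionE w : [set y | region (ct w, y)] = vshift w (Ebox w).
Proof. by apply/seteqP; split => y; rewrite /region /vshift /= ctK. Qed.

(** The double integral of [u(w) |f(z)|^2 e^{-psi(z)} / v(Ebox w)] over [region] is computed in both
    orders: one dominates the integral of [|f|^2 u e^{-psi}], the other is dominated by that of
    [|f|^2 e^{-psi}] times the bound on [uhat]. *)
Lemma carleson_of_averaging : exists2 A : R, 0 < A & forall f, in_A2 v f ->
  (wint v (fun z => (csq (f z) * u z)%R) <= A%:E * nsq v f)%E.
Proof.
have [Cn [Cn0 HC]] := nsq_Phi2_upper Hv.
have mB := @measurable_BnR R n.
(* Nonnegativity of the constant is obtained without a discussion of the sign of [M]. *)
pose M' := Num.max M 0.
pose A := expR 1 * (Cn * (5 ^+ (2 * n)) * expR 1 * M') + 1.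
have M'0 : 0 <= M' by rewrite le_max lexx orbT.
have A0 : 0 < A by rewrite ltr_wpDl // !mulr_ge0 ?expR_ge0 ?exprn_ge0 // ltW.
exists A => // f fA; have hf := in_A2_fhol fA.
have [u' u'_def] : exists u' : T -> R, u' = (fun x => u (tz x)) \_ BR by eexists.
have [g' g'_def] : exists g' : T -> R, g' = (fun x => csq (f (tz x)) * weight x) \_ BR by eexists.
have mu' : measurable_fun setT u'.
  rewrite u'_def.
  exact: ((measurable_restrictT (fun x => u (tz x)) mB).1 u_meas).
have mg' : measurable_fun setT g'.
  rewrite g'_def.
  exact: ((measurable_restrictT (fun x => csq (f (tz x)) * weight x) mB).1 (measurable_csq_weight hf)).
have u'E x : BR x -> u' x = u (tz x) by move=> Bx; rewrite u'_def patchE ifT // inE.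
have g'E x : BR x -> g' x = csq (f (tz x)) * weight x by move=> Bx; rewrite g'_def patchE ifT // inE.
have u'0 x : 0 <= u' x.
  by rewrite u'_def patchE; case: ifPn => // /[!inE] Bx; exact: u_ge0.
have g'0 x : 0 <= g' x.
  by rewrite g'_def patchE; case: ifP => // _; rewrite mulr_ge0 ?csq_ge0 ?weight_ge0.
have sf := lebesgue_sigma_finite Hv.
(* The inverse volume of the box, written as a power so that it is measurable on the whole space. *)
have [m m_def] : exists m : T -> R, m = fun w => fine (v [set y | region (w, y)]) `^ (-1) by eexists.
have mm : measurable_fun setT m.
  rewrite m_def.
  apply: (measurableT_comp (measurable_powR _)); apply: (measurableT_comp (fine_measurable measurableT)).
  exact: measurable_section.
have m0 w : 0 <= m w by rewrite m_def; exact: powR_ge0.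
have mE w : BR w -> m w = (fine (v (Ebox (tz w))))^-1.
  move=> Bw; rewrite m_def -{1}(tzK w) sectionE vshift_measure //; last exact: measurable_Ebox.
  by rewrite powR_inv1 // fine_ge0.
have [F F_def] : exists F : T * T -> R, F = fun wz => u' wz.1 * m wz.1 * g' wz.2 * \1_region wz by eexists.
have mF : measurable_fun setT F.
  rewrite F_def.
  apply: measurable_funM; last exact: measurable_indic.
  apply: measurable_funM; last exact: (measurableT_comp mg' measurable_snd).
  by apply: measurable_funM; [exact: (measurableT_comp mu' measurable_fst)|exact: (measurableT_comp mm measurable_fst)].
have F0 wz : 0 <= F wz by rewrite F_def !mulr_ge0.
have ton := tonelli_on sf sf mB mB mF F0.
have mF1 w : measurable_fun setT (fun z => F (w, z)).
  by apply: (measurableT_comp mF); exact: measurable_fun_pair.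
have mF2 z : measurable_fun setT (fun w => F (w, z)).
  by apply: (measurableT_comp mF); exact: measurable_fun_pair.
have mI1 : measurable_fun setT (fun w => \int[v]_(z in BR) (F (w, z))%:E)%E.
  apply: (eq_measurable_fun (fun w => \int[v]_z (\1_BR z * F (w, z))%:E)%E).
    by move=> w _; rewrite integral_indicM.
  apply: (measurable_partial_integral (f := fun wz : T * T => (\1_BR wz.2 * F wz)%:E) sf).
    apply/measurable_EFinP; apply: measurable_funM; last exact: mF.
    exact: (measurableT_comp (measurable_indic mB) measurable_snd).
  by move=> wz; rewrite lee_fin mulr_ge0.
have mI2 : measurable_fun setT (fun z => \int[v]_(w in BR) (F (w, z))%:E)%E.
  apply: (eq_measurable_fun (fun z => \int[v]_w (\1_BR w * F (w, z))%:E)%E).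
    by move=> z _; rewrite (integral_indicM _ _ (fun w => F (w, z))).
  apply: (measurable_partial_integral (f := fun zw : T * T => (\1_BR zw.2 * F (zw.2, zw.1))%:E) sf).
    apply/measurable_EFinP; apply: measurable_funM.
      exact: (measurableT_comp (measurable_indic mB) measurable_snd).
    by apply: (measurableT_comp mF); exact: measurable_swap.
  by move=> zw; rewrite lee_fin mulr_ge0.
have innerE w : BR w -> (\int[v]_(z in BR) (F (w, z))%:E = (u (tz w) * m w)%:E *
    \int[v]_(z in vshift (tz w) (Ebox (tz w))) (csq (f (tz z)) * weight z)%:E)%E.
  move=> Bw; have mS := measurable_vshift (tz w) (@measurable_Ebox R n (tz w)).
  have um0 : 0 <= u (tz w) * m w by rewrite mulr_ge0 // u_ge0.
  have regE z : \1_region (w, z) = \1_(vshift (tz w) (Ebox (tz w))) z :> R.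
    by rewrite -sectionE tzK !indicE; congr (_%:R); congr nat_of_bool; apply/idP/idP; rewrite !inE.
  rewrite (eq_integral (fun z => (u (tz w) * m w)%:E * (\1_(vshift (tz w) (Ebox (tz w))) z * g' z)%:E)%E).
    rewrite ge0_integralZl_EFin //; last 2 first.
    - by move=> z _; rewrite lee_fin mulr_ge0.
    - apply: measurable_funTS; apply/measurable_EFinP; apply: measurable_funM => //.
    congr (_ * _)%E; rewrite -integral_indicM.
    rewrite (eq_integral (fun z => (\1_(vshift (tz w) (Ebox (tz w))) z * g' z)%:E)); last first.
      move=> z _; congr (_%:E); rewrite !indicE.
      case: (boolP (z \in vshift (tz w) (Ebox (tz w)))) => [/[!inE] /(vshift_Ebox_sub Bw) Bz|_].
        by rewrite mem_set // !mul1r.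
      by rewrite !mul0r mulr0.
    rewrite integral_indicM; apply: eq_integral => z /[!inE] /(vshift_Ebox_sub Bw) Bz.
    by rewrite g'E.
  by move=> z _; rewrite -EFinM F_def /= u'E // regE; congr (_%:E); ring.
(* Integrating in [z] first: [weighted_sub_mean] divided by the volume of the box. *)
have low : (wint v (fun z => (csq (f z) * u z)%R) <=
    (expR 1)%:E * \int[v]_(w in BR) \int[v]_(z in BR) (F (w, z))%:E)%E.
  have I0 w : (0 <= \int[v]_(z in BR) (F (w, z))%:E)%E by apply: integral_ge0 => z _; rewrite lee_fin.
  rewrite -ge0_integralZl_EFin ?expR_ge0 //; last exact: measurable_funTS.
  rewrite /wint; apply: ge0_le_integral => //.
  - by move=> w Bw; rewrite lee_fin !mulr_ge0 ?csq_ge0 ?weight_ge0 ?u_ge0.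
  - apply/measurable_EFinP; apply: measurable_funM; last exact: measurable_weight.
    by apply: measurable_funM => //; exact: fhol_measurable_csq.
  - by apply: measurable_funeM; exact: measurable_funTS.
  - move=> w Bw; rewrite innerE //.
    have um0 : 0 <= u (tz w) * m w by rewrite mulr_ge0 // u_ge0.
    have um0e : (0 <= (u (tz w) * m w)%:E)%E by rewrite lee_fin.
    have := lee_wpmul2l um0e (weighted_sub_mean Hv fA Bw).
    have Eg : 0 < fine (v (Ebox (tz w))) by rewrite -lte_fin -Ebox_fin // Ebox_gt0.
    rewrite (Ebox_fin Hv Bw) mE // -!EFinM muleCA.
    by congr (_%:E <= _)%E; rewrite /weight; field; rewrite gt_eqF.
(* Integrating in [w] first: on [region] the exponent is at most 1 and the volume of the box around
   [w] is at least a multiple of [||Phi_{2,z}||^2], so the integrand is at most a multiple of that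
   of [uhat]. *)
have high z : BR z -> (\int[v]_(w in BR) (F (w, z))%:E <=
    (g' z * (Cn * (5 ^+ (2 * n)) * expR 1 * M'))%:E)%E.
  move=> Bz; have N0 := nsq_Phi2_gt0 Hv Bz.
  pose k := g' z * (Cn * 5 ^+ (2 * n) * expR 1).
  have k0 : 0 <= k by rewrite !mulr_ge0 ?expR_ge0 ?exprn_ge0 // ltW.
  have mU : measurable_fun BR (fun w => csq (Phi2 (tz z) (tz w)) / fine (nsq v (Phi2 (tz z))) *
      u (tz w) * weight w).
    apply: measurable_funM; last exact: measurable_weight.
    apply: measurable_funM => //; apply: measurable_funM => //.
    exact: fhol_measurable_csq (in_A2_fhol (Phi2_in_A2 Hv Bz)).
  have U0 w : BR w -> 0 <= csq (Phi2 (tz z) (tz w)) / fine (nsq v (Phi2 (tz z))) * u (tz w) * weight w.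
    by move=> Bw; rewrite !mulr_ge0 ?csq_ge0 ?invr_ge0 ?weight_ge0 ?u_ge0 // ltW.
  apply: (@le_trans _ _ (k%:E * uhat v u (tz z))%E); last first.
    rewrite mulrA -/k [leRHS]EFinM; apply: lee_wpmul2l; first by rewrite lee_fin.
    by apply: le_trans (uM Bz) _; rewrite lee_fin /M' le_max lexx.
  rewrite /uhat /wint -ge0_integralZl_EFin //; last exact/measurable_EFinP.
  apply: ge0_le_integral => //.
  - by move=> w _; rewrite lee_fin.
  - by apply: measurable_funTS; exact/measurable_EFinP.
  - by apply: measurable_funeM; exact/measurable_EFinP.
  - move=> w Bw; rewrite -EFinM lee_fin F_def indicE.
    case: (boolP ((w, z) \in region)) => [/[!inE] reg|_]; last by rewrite mulr0 mulr_ge0 // U0.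
    have [_ _ _ kle] := Ebox_near Bw reg.
    have cmp := Ebox_compare Hv Bw reg; rewrite vadd_sub in kle cmp.
    have vw0 : 0 < fine (v (Ebox (tz w))) by rewrite -lte_fin -Ebox_fin // Ebox_gt0.
    have Nle : fine (nsq v (Phi2 (tz z))) <= Cn * 5 ^+ (2 * n) * fine (v (Ebox (tz w))).
      rewrite -lee_fin -nsq_fin; last exact: Phi2_in_A2.
      apply: le_trans (HC _ Bz) _; rewrite -mulrA EFinM; apply: lee_wpmul2l.
        by rewrite lee_fin ltW.
      by rewrite EFinM -Ebox_fin.
    have e1 : 1 <= expR 1 * (csq (Phi2 (tz z) (tz w)) * weight w).
      by rewrite Phi2_weight -expRD kexp_sym -[leLHS]expR0 ler_expR; lra.
    rewrite mulr1 /= u'E // mE //.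
    rewrite (_ : k * _ = g' z * u (tz w) * ((Cn * 5 ^+ (2 * n) / fine (nsq v (Phi2 (tz z)))) *
       (expR 1 * (csq (Phi2 (tz z) (tz w)) * weight w)))); last by rewrite /k; ring.
    rewrite (_ : _ * g' z = g' z * u (tz w) * ((fine (v (Ebox (tz w))))^-1 * 1)); last by ring.
    apply: ler_wpM2l; first by rewrite mulr_ge0 // u_ge0.
    apply: ler_pM => //.
    by rewrite ler_pdivlMr // mulrC ler_pdivrMr.
apply: le_trans low _; rewrite ton /A EFinD ge0_muleDl ?lee_fin //; last first.
  by rewrite !mulr_ge0 ?expR_ge0 ?exprn_ge0 // ltW.
apply: (@le_trans _ _ ((expR 1 * (Cn * 5 ^+ (2 * n) * expR 1 * M'))%:E * nsq v f)%E); last first.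
  by rewrite leeDl // mule_ge0 // nsq_ge0.
rewrite EFinM -muleA; apply: lee_wpmul2l; first by rewrite lee_fin expR_ge0.
set k := _ * M'.
have k0 : 0 <= k by rewrite !mulr_ge0 ?expR_ge0 ?exprn_ge0 // ltW.
rewrite /nsq /wint -ge0_integralZl_EFin //; last 2 first.
- by move=> z _; rewrite lee_fin mulr_ge0 ?csq_ge0 ?weight_ge0.
- by apply/measurable_EFinP; exact: measurable_csq_weight.
apply: ge0_le_integral => //.
- by move=> z _; apply: integral_ge0 => w _; rewrite lee_fin.
- exact: measurable_funTS.
- by apply: measurable_funeM; apply/measurable_EFinP; exact: measurable_csq_weight.
- by move=> z Bz; apply: le_trans (high z Bz) _; rewrite -EFinM lee_fin g'E // mulrC.
Qed.

End Averaging.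

(** * Toeplitz operators *)

Section ToeplitzCarleson.
Variables (R : realType) (n : nat).
Local Notation C := (complex R).
Local Notation V := (Cvec R n).
Local Notation T := (Rcoords R n).
Variable v : {measure set T -> \bar R}.
Hypothesis Hv : is_lebesgue v.
Local Notation BR := (@BnR R n).
Variable K : V -> V -> C.
Hypothesis HK : is_bergman_kernel v K.
Variable u : V -> R.
Hypothesis u_meas : measurable_fun BR (fun x => u (tz x)).
Hypothesis u_ge0 : forall z, Bn z -> 0 <= u z.
Implicit Types f phi : V -> C.

Let mB : measurable BR := @measurable_BnR R n.

Lemma integrable_ge0 (h : T -> R) : measurable_fun BR h -> (forall x, BR x -> 0 <= h x) ->
  (\int[v]_(x in BR) (h x)%:E < +oo)%E -> v.-integrable BR (EFin \o h).
Proof.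
move=> mh h0 fin; apply/integrableP; split; first exact/measurable_EFinP.
rewrite (eq_integral (EFin \o h)) // => x /[!inE] Bx /=.
by rewrite ger0_norm // h0.
Qed.

(** The values 1 and [-1] of [t] give [2 |c| <= p + a], an integrable bound. *)
Lemma quadratic_integrable (p c a : T -> R) : v.-integrable BR (EFin \o p) ->
  v.-integrable BR (EFin \o a) -> measurable_fun BR c ->
  (forall x, BR x -> forall t, 0 <= t ^+ 2 * p x + 2 * t * c x + a x) ->
  v.-integrable BR (EFin \o c).
Proof.
move=> ip ia mc key; apply: (le_integrable mB _ _ (integrableD mB ip ia)); first exact/measurable_EFinP.
move=> x Bx /=; rewrite lee_fin; apply: le_trans (ler_norm _).
have := key x Bx 1; have := key x Bx (-1); rewrite expr1n sqrrN expr1n => h1 h2.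
by rewrite ler_norml; apply/andP; split; lra.
Qed.

Definition symbol_mul f : V -> C := fun w => f w * Complex (u w) 0.

Lemma toeplitzE f z : toeplitz v K u f z = cwint v (fun w => K z w * symbol_mul f w).
Proof. by congr (cwint v _); apply/funext => w; rewrite /symbol_mul mulrA. Qed.

Lemma rdot_symbol (a b : C) t : rdot a (b * Complex t 0) = t * rdot a b.
Proof. by rewrite /rdot ReM ImM /=; ring. Qed.

Lemma cross_symbol phi f x :
  cross phi (symbol_mul f) x = rdot (phi (tz x)) (f (tz x)) * u (tz x) * weight x.
Proof. by rewrite /cross rdot_symbol; ring. Qed.

Lemma measurable_cross_symbol phi f : in_A2 v phi -> in_A2 v f ->
  measurable_fun BR (cross phi (symbol_mul f)).
Proof.
move=> pA fA; rewrite (_ : cross _ _ = fun x => rdot (phi (tz x)) (f (tz x)) * u (tz x) * weight x).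
  apply: measurable_funM; last exact: measurable_weight.
  by apply: measurable_funM => //; exact: measurable_rdot (in_A2_fhol pA) (in_A2_fhol fA).
by apply/funext => x; exact: cross_symbol.
Qed.

Lemma measurable_csq_symbol f : in_A2 v f ->
  measurable_fun BR (fun x => csq (f (tz x)) * u (tz x) * weight x).
Proof.
move=> fA; apply: measurable_funM; last exact: measurable_weight.
by apply: measurable_funM => //; exact: fhol_measurable_csq (in_A2_fhol fA).
Qed.

Lemma csq_symbol_ge0 f x : BR x -> 0 <= csq (f (tz x)) * u (tz x) * weight x.
Proof. by move=> Bx; rewrite !mulr_ge0 ?csq_ge0 ?weight_ge0 // u_ge0. Qed.

(** Cauchy-Schwarz with the weight [u e^{-psi}] and the Carleson inequality for both factors bound
    [|<phi, f u>|^2] by [A^2 ||f||^2 ||phi||^2]. So [riesz_kernel] applies with [B = A^2 ||f||^2],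
    and its factor 4 is the one in the conclusion. *)
Lemma carleson_toeplitz (A : R) : 0 < A ->
  (forall f, in_A2 v f -> (wint v (fun z => (csq (f z) * u z)%R) <= A%:E * nsq v f)%E) ->
  forall f, in_A2 v f -> in_A2 v (toeplitz v K u f) /\
    (nsq v (toeplitz v K u f) <= (4 * A ^+ 2)%:E * nsq v f)%E.
Proof.
move=> A0 HA f fA; pose s phi (x : T) := csq (phi (tz x)) * u (tz x) * weight x.
have si phi : in_A2 v phi -> v.-integrable BR (EFin \o s phi).
  move=> pA; apply: integrable_ge0 => //; [exact: measurable_csq_symbol|exact: csq_symbol_ge0|].
  by apply: le_lt_trans (HA phi pA) _; rewrite (nsq_fin pA) -EFinM ltry.
have sA phi : in_A2 v phi -> \int[v]_(x in BR) s phi x <= A * fine (nsq v phi).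
  move=> pA; rewrite -lee_fin /Rintegral fineK; last exact: integrable_fin_num (si _ pA).
  by rewrite EFinM -nsq_fin //; exact: HA.
have key phi x : BR x -> forall t, 0 <= t ^+ 2 * s phi x + 2 * t * cross phi (symbol_mul f) x + s f x.
  move=> Bx t; rewrite cross_symbol /s.
  have uw0 : 0 <= u (tz x) * weight x by rewrite mulr_ge0 ?weight_ge0 // u_ge0.
  have := mulr_ge0 (csq_ge0 (Complex t 0 * phi (tz x) + f (tz x))) uw0.
  by rewrite csq_quadratic; congr (_ <= _); ring.
have gint phi (pA : in_A2 v phi) : v.-integrable BR (EFin \o cross phi (symbol_mul f)).
  apply: (quadratic_integrable (si _ pA) (si _ fA) _ (key phi)).
  exact: measurable_cross_symbol.
have N0 phi : 0 <= fine (nsq v phi) by rewrite fine_ge0 // nsq_ge0.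
have B0 : 0 <= A ^+ 2 * fine (nsq v f) by rewrite mulr_ge0 // sqr_ge0.
have gB phi (pA : in_A2 v phi) : ip v phi (symbol_mul f) ^+ 2 <= A ^+ 2 * fine (nsq v f) * fine (nsq v phi).
  have s0 (x : T) : BR x -> 0 <= s phi x by exact: csq_symbol_ge0.
  apply: le_trans (integral_discriminant mB (si _ pA) (gint _ pA) (si _ fA) s0 (key phi)) _.
  have I0 h : 0 <= \int[v]_(x in BR) s h x by apply: Rintegral_ge0 => x; exact: csq_symbol_ge0.
  apply: le_trans (ler_pM (I0 f) (I0 phi) (sA _ fA) (sA _ pA)) _.
  by rewrite le_eqVlt; apply/orP; left; apply/eqP; ring.
have [FA FN _] := riesz_kernel Hv HK B0 gint gB.
rewrite (_ : toeplitz v K u f = fun z => cwint v (fun w => K z w * symbol_mul f w)); last first.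
  by apply/funext => z; exact: toeplitzE.
by split => //; apply: le_trans FN _; rewrite [in leRHS](nsq_fin fA) -EFinM mulrA.
Qed.

Lemma uhatE z : Bn z ->
  uhat v u z = ((fine (nsq v (Phi2 z)))^-1%:E * wint v (fun w => (csq (Phi2 z w) * u w)%R))%E.
Proof.
move=> Bz; rewrite /uhat /wint -ge0_integralZl_EFin //.
- by apply: eq_integral => x _; rewrite -EFinM; congr (_%:E); ring.
- by move=> x Bx; rewrite lee_fin csq_symbol_ge0.
- by apply/measurable_EFinP; apply: measurable_csq_symbol; exact: Phi2_in_A2.
- by rewrite invr_ge0 fine_ge0 // nsq_ge0.
Qed.

Lemma uhat_le (A : R) z : Bn z ->
  (wint v (fun w => (csq (Phi2 z w) * u w)%R) <= A%:E * nsq v (Phi2 z))%E ->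
  (uhat v u z <= A%:E)%E.
Proof.
move=> Bz H; have N0 := nsq_Phi2_gt0 Hv Bz; rewrite uhatE //.
have i0 : (0 <= (fine (nsq v (Phi2 z)))^-1%:E)%E by rewrite lee_fin invr_ge0 ltW.
apply: le_trans (lee_wpmul2l i0 H) _.
rewrite (nsq_fin (Phi2_in_A2 Hv Bz)) -!EFinM lee_fin mulrCA mulVf ?mulr1 //.
by rewrite gt_eqF.
Qed.

Hypothesis u_L2 : (wint v (fun z => (u z ^+ 2)%R) < +oo)%E.

(* For a bounded f the product f u is square integrable, so that <T_u f, f> = <f u, f>
   although T_u is only given by its kernel. *)
Lemma bounded_toeplitz_symbol f (M : R) : in_A2 v f -> (forall w, Bn w -> csq (f w) <= M) ->
  wint v (fun w => (csq (f w) * u w)%R) = (ip v (toeplitz v K u f) f)%:E.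
Proof.
move=> fA fM; pose p phi (x : T) := csq (phi (tz x)) * weight x.
pose a (x : T) := csq (f (tz x)) * u (tz x) ^+ 2 * weight x.
have a0 x : 0 <= a x by rewrite mulr_ge0 ?weight_ge0 // mulr_ge0 ?csq_ge0 ?sqr_ge0.
have iu : v.-integrable BR (EFin \o fun x => u (tz x) ^+ 2 * weight x).
  apply: integrable_ge0 => //; last by move=> x _; rewrite mulr_ge0 ?weight_ge0 // sqr_ge0.
  by apply: measurable_funM; [exact: measurable_funX|exact: measurable_weight].
have ia : v.-integrable BR (EFin \o a).
  apply: (le_integrable mB _ _ (integrableZl mB M iu)).
    apply/measurable_EFinP; apply: measurable_funM; last exact: measurable_weight.
    by apply: measurable_funM; [exact: fhol_measurable_csq (in_A2_fhol fA)|exact: measurable_funX].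
  move=> x Bx /=; rewrite lee_fin; apply: le_trans (ler_norm _); rewrite ger0_norm // /a -mulrA.
  by apply: ler_wpM2r (fM _ Bx); rewrite mulr_ge0 ?weight_ge0 // sqr_ge0.
have ipp phi : in_A2 v phi -> v.-integrable BR (EFin \o p phi).
  move=> pA; apply: integrable_ge0; first exact: measurable_csq_weight (in_A2_fhol pA).
    by move=> x _; rewrite mulr_ge0 ?csq_ge0 ?weight_ge0.
  by case: pA.
have key phi x : BR x -> forall t, 0 <= t ^+ 2 * p phi x + 2 * t * cross phi (symbol_mul f) x + a x.
  move=> _ t; rewrite cross_symbol /p /a.
  have := mulr_ge0 (csq_ge0 (Complex t 0 * phi (tz x) + symbol_mul f (tz x))) (weight_ge0 x).
  by rewrite csq_quadratic /symbol_mul rdot_symbol csqM csq_real; congr (_ <= _); ring.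
have gint phi (pA : in_A2 v phi) : v.-integrable BR (EFin \o cross phi (symbol_mul f)).
  apply: (quadratic_integrable (ipp _ pA) ia _ (key phi)).
  exact: measurable_cross_symbol.
have B0 : 0 <= \int[v]_(x in BR) a x by apply: Rintegral_ge0 => x _.
have gB phi (pA : in_A2 v phi) :
    ip v phi (symbol_mul f) ^+ 2 <= \int[v]_(x in BR) a x * fine (nsq v phi).
  have p0 (x : T) : BR x -> 0 <= p phi x by move=> _; rewrite mulr_ge0 ?csq_ge0 ?weight_ge0.
  exact: (integral_discriminant mB (ipp _ pA) (gint _ pA) ia p0 (key phi)).
have [_ _ Fip] := riesz_kernel Hv HK B0 gint gB.
rewrite (_ : toeplitz v K u f = fun z => cwint v (fun w => K z w * symbol_mul f w)); last first.
  by apply/funext => z; exact: toeplitzE.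
rewrite Fip // /ip /Rintegral fineK; last exact: integrable_fin_num (gint _ fA).
by apply: eq_integral => x _; rewrite /= cross_symbol rdotxx.
Qed.

(** [uhat] at [z] is [<T_u Phi, Phi> / ||Phi||^2], at most the square root of [A] because the
    hypothesis bounds squared norms. As no sign of [A] is assumed, the root is replaced by
    [1 + |A|], using [A <= (1 + |A|)^2]. *)
Lemma toeplitz_averaging (A : R) : (forall f, in_A2 v f -> in_A2 v (toeplitz v K u f) /\
    (nsq v (toeplitz v K u f) <= A%:E * nsq v f)%E) ->
  forall z, Bn z -> (uhat v u z <= (1 + `|A|)%:E)%E.
Proof.
move=> HA z Bz; have PA := Phi2_in_A2 Hv Bz; have [M [_ PM]] := Phi2_bounded Bz.
have [TA TN] := HA _ PA; apply: uhat_le => //.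
have N0 := nsq_Phi2_gt0 Hv Bz.
rewrite (bounded_toeplitz_symbol PA PM) (nsq_fin PA) -EFinM lee_fin.
have := ip_cauchy_schwarz TA PA; rewrite !ip_self //.
move: TN; rewrite (nsq_fin TA) (nsq_fin PA) -EFinM lee_fin.
move: (ip v _ _) (fine (nsq v (toeplitz _ _ _ _))) (fine (nsq v (Phi2 z))) N0 => i t N N0 tN iN.
have A0 := normr_ge0 A; have AA := ler_norm A.
have N2 : 0 <= (1 + `|A|) * N by rewrite mulr_ge0 ?addr_ge0 // ltW.
apply: le_trans (ler_norm i) _; rewrite -(ler_pXn2r (n := 2)) ?nnegrE // real_normK ?num_real //.
apply: le_trans iN _; apply: (@le_trans _ _ (N * (A * N))); first by rewrite ler_wpM2l // ltW.
have -> : N * (A * N) = A * N ^+ 2 by ring.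
rewrite exprMn ler_wpM2r ?sqr_ge0 //; move: (`|A|) A0 AA => b b0 Ab.
by have := sqr_ge0 b; lra.
Qed.

End ToeplitzCarleson.

Theorem theorem4p6 (R : realType) (n : nat) (n_gt0 : (0 < n)%N)
  (v : {measure set (Rcoords R n) -> \bar R}) (Hv : is_lebesgue v)
  (K : Cvec R n -> Cvec R n -> complex R) (HK : is_bergman_kernel v K)
  (u : Cvec R n -> R)
  (u_meas : measurable_fun (@BnR R n) (fun x => u (tz x)))
  (u_pos : forall z, Bn z -> 0 < u z)
  (u_L2 : (wint v (fun z => (u z ^+ 2)%R) < +oo)%E) :
  let Ta := exists C : R, forall f, in_A2 v f ->
              in_A2 v (toeplitz v K u f) /\
              (nsq v (toeplitz v K u f) <= C%:E * nsq v f)%E in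
  let Tb := exists M : R, forall z, Bn z -> (uhat v u z <= M%:E)%E in
  let Tc := exists C : R, 0 < C /\ forall f, in_A2 v f ->
              (wint v (fun z => (csq (f z) * u z)%R) <= C%:E * nsq v f)%E in
  (Ta <-> Tb) /\ (Tb <-> Tc).
Proof.
have u_ge0 z : Bn z -> 0 <= u z by move=> /u_pos/ltW.
move=> Ta Tb Tc.
have ab : Ta -> Tb by move=> [A HA]; eexists; exact: (toeplitz_averaging Hv HK u_meas u_ge0 u_L2 HA).
have bc : Tb -> Tc by move=> [M HM]; have [A A0 HA] := carleson_of_averaging Hv u_meas u_ge0 HM; exists A.
have ca : Tc -> Ta by move=> [A [A0 HA]]; eexists; exact: (carleson_toeplitz Hv HK u_meas u_ge0 A0 HA).
have cb : Tc -> Tb.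
  by move=> [A [A0 HA]]; exists A => z Bz; apply: (uhat_le Hv u_meas u_ge0 Bz); exact: HA (Phi2_in_A2 Hv Bz).
by split; split; auto.
Qed.
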